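(* Let $F$ be a non-archimedean locally compact field with residue field $k$ of characteristic $p$ and cardinality $q$, and let $\tilde G=\mathrm{GL}_2(F)$. Let $I$ be the standard Iwahori subgroup of $\tilde G$ and $I_1$ its pro-$p$ Sylow subgroup. Let $\mathcal C=\mathrm{ind}_{I_1}^{\tilde G}(1)$ and $\mathcal C'=\mathrm{ind}_I^{\tilde G}(1)$ be the compact inductions over $\overline{\mathbf F}_p$, and let $\mathcal H=\mathrm{End}_{\tilde G}(\mathcal C)$. Let $G=\mathrm{GL}_2(k)$, $U\subset G$ the subgroup of upper triangular unipotent matrices, $C$ the representation of $G$ over $\overline{\mathbf F}_p$ induced from the trivial character of $U$, and $H=\mathrm{End}_G(C)$. (1) The $\mathcal H$-module $\mathcal C$ is flat if and only if the $H$-module $C$ is flat, in other words if and only if $q=p$. In this case, these are even projective modules. (2) The $\mathcal H$-module $\mathcal C'$ is projective.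
   Context: $\overline{\mathbf F}_p$ is an algebraic closure of $k$; $\mathcal O$ is the ring of integers of $F$ and $\mathfrak p$ its maximal ideal. $I$ (resp. $I_1$) is the group of matrices in $\mathrm{GL}_2(\mathcal O)$ whose reduction modulo $\mathfrak p$ is upper triangular (resp. upper triangular unipotent). For a compact open subgroup $J$, $\mathrm{ind}_J^{\tilde G}(1)$ is the space of functions $J\backslash\tilde G\to\overline{\mathbf F}_p$ with finite support, with $\tilde G$ acting by right translations. $\mathcal C$ is a left $\mathcal H$-module. The space $\mathcal C'$ is an $\mathcal H$-module as follows: there is a central idempotent $\varepsilon_1\in\mathcal H$ which is the projection of $\mathcal C$ onto its subspace $\mathcal C'$ of left $I$-invariant functions (given by averaging over left translations by $I/I_1$, a group of order prime to $p$), so $\mathcal C'=\varepsilon_1\mathcal C$ is a left $\mathcal H$-submodule (indeed a direct factor) of $\mathcal C$, and $\mathcal H$ acts on it through $\varepsilon_1\mathcal H=\mathrm{End}_{\tilde G}(\mathcal C')$. $C$ is the space of functions $G\to\overline{\mathbf F}_p$ invariant under left translations by $U$, with $G$ acting by right translations; it is a left $H$-module. *)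

(* Defs.v *)
From HB Require Import structures.
From mathcomp Require Import all_boot all_order all_algebra.
From mathcomp Require Import boolp classical_sets functions reals topology.
From mathcomp Require Import freeg ring.

Set Implicit Arguments.
Unset Strict Implicit.
Unset Printing Implicit Defensive.

Import Order.TTheory GRing.Theory Num.Theory.

Local Open Scope classical_set_scope.
Local Open Scope ring_scope.
Local Open Scope quotient_scope.

(* A right R-module is a left module over the converse ring R^c. *)
Definition ract (R : pzRingType) (A : lmodType R^c) (a : A) (r : R) : A :=
  (r : R^c) *: a.

Section Tensor.
Variables (R : pzRingType) (A : lmodType R^c) (M : lmodType R).

(* The tensor product is the quotient of the free abelian group on A * M by
   the subgroup tensor_null generated by tensor_rel. *)
Inductive tensor_rel : {freeg (A * M)%type} -> Prop :=
| TensorDl a b m : tensor_rel (<< (a + b, m) >> - << (a, m) >> - << (b, m) >>)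
| TensorDr a m n : tensor_rel (<< (a, m + n) >> - << (a, m) >> - << (a, n) >>)
| TensorZ a r m : tensor_rel (<< (ract a r, m) >> - << (a, r *: m) >>).

Inductive tensor_null : {freeg (A * M)%type} -> Prop :=
| TensorNullRel x of tensor_rel x : tensor_null x
| TensorNull0 : tensor_null 0
| TensorNullB x y of tensor_null x & tensor_null y : tensor_null (x - y).

Definition tensor_null_pred : {pred {freeg (A * M)%type}} :=
  fun x => `[< tensor_null x >].

Fact tensor_null_zmod : zmod_closed tensor_null_pred.
Proof.
split; first by apply/asboolP; exact: TensorNull0.
by move=> x y /asboolP hx /asboolP hy; apply/asboolP; exact: TensorNullB.
Qed.
HB.instance Definition _ :=
  GRing.isZmodClosed.Build _ tensor_null_pred tensor_null_zmod.

Definition tensor := Quotient.quot tensor_null_pred.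

Definition tens (a : A) (m : M) : tensor := \pi_tensor << (a, m) >>.

End Tensor.

Section TensorMap.
Variables (R : pzRingType) (A B : lmodType R^c) (M : lmodType R).

Definition tensor_lift (i : A -> B) (x : {freeg (A * M)%type}) :
    {freeg (B * M)%type} :=
  fglift (fun y => << (i y.1, y.2) >>) x.

Fact tensor_lift_zmod_morphism i : zmod_morphism (tensor_lift i).
Proof. exact: lift_is_additive. Qed.
HB.instance Definition _ i := GRing.isZmodMorphism.Build _ _ (tensor_lift i)
  (tensor_lift_zmod_morphism i).

Definition tensor_map (i : A -> B) (z : tensor A M) : tensor B M :=
  \pi_(tensor B M) (tensor_lift i (repr z)).

Lemma tensor_map_pi (i : {linear A -> B}) x :
  tensor_map i (\pi_(tensor A M) x) = \pi_(tensor B M) (tensor_lift i x).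
Proof.
apply/eqP; rewrite -Quotient.idealrBE -raddfB /=.
have : repr (\pi_(tensor A M) x) - x \in
   @tensor_null_pred R A M.
  by rewrite Quotient.idealrBE reprK.
move: (_ - x) => y /asboolP; elim=> {x y} [x|  |x y _ hx _ hy]; last 2 first.
- by rewrite raddf0 rpred0.
- by rewrite raddfB rpredB.
move=> hx; apply/asboolP/TensorNullRel.
case: hx => [a b m|a m n|a r m]; rewrite !raddfB /= /tensor_lift !liftU !scale1r /=.
- by rewrite raddfD; exact: TensorDl.
- exact: TensorDr.
- rewrite /ract linearZ; exact: TensorZ.
Qed.

Lemma tensor_mapE (i : {linear A -> B}) a m :
  tensor_map i (tens a m) = tens (i a) m.
Proof. by rewrite /tens tensor_map_pi /tensor_lift liftU scale1r. Qed.

Lemma tensor_mapD (i : {linear A -> B}) : {morph @tensor_map i : x y / x + y}.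
Proof.
move=> x y; rewrite -[x]reprK -[y]reprK -pi_addr !tensor_map_pi -pi_addr.
by rewrite raddfD.
Qed.

End TensorMap.

Section FlatProjective.
Variables (R : pzRingType) (M : lmodType R).

Definition flat : Prop :=
  forall (A B : lmodType R^c) (i : {linear A -> B}),
    injective i -> injective (@tensor_map R A B M i).

Definition projective : Prop :=
  forall (N P : lmodType R) (g : {linear N -> P}) (f : {linear M -> P}),
    (forall y, exists x, g x = y) ->
    exists h : {linear M -> N}, forall x, g (h x) = f x.

End FlatProjective.
Arguments flat : clear implicits.
Arguments projective : clear implicits.

(* The ring endG act consists of the E-linear endomorphisms of V that commute
   with every act g; its product is the composition. *)
Section EndG.
Variables (E : fieldType) (V : lmodType E) (X : Type).
Variable act : X -> {linear V -> V}.

Definition equivariant (phi : V -> V) : Prop :=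
  linear phi /\ forall g v, phi (act g v) = act g (phi v).

Definition equivariant_pred : {pred V -> V} := fun phi => `[< equivariant phi >].

Record endG := EndG { endG_fun :> V -> V; _ : endG_fun \in equivariant_pred }.
HB.instance Definition _ := [isSub for endG_fun].
HB.instance Definition _ := [Choice of endG by <:].

Fact equivariant_zmod : zmod_closed equivariant_pred.
Proof.
split=> [|f1 f2 /asboolP[l1 c1] /asboolP[l2 c2]]; apply/asboolP; split.
- by move=> a u v; rewrite [RHS]addr0 [RHS]scaler0.
- by move=> g v; rewrite [RHS]raddf0.
- by move=> a u v; rewrite !fctE l1 l2 scalerBr opprD addrACA.
- by move=> g v; rewrite !fctE c1 c2 raddfB.
Qed.
HB.instance Definition _ :=
  GRing.isZmodClosed.Build _ equivariant_pred equivariant_zmod.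
HB.instance Definition _ := [SubChoice_isSubZmodule of endG by <:].

Lemma endGP (phi : endG) : equivariant phi.
Proof. by apply/asboolP; exact: (valP phi). Qed.

Lemma endG_inj (phi psi : endG) : phi =1 psi -> phi = psi.
Proof. by move=> e; apply/val_inj/funext. Qed.

Fact endG_one_subproof : (id : V -> V) \in equivariant_pred.
Proof. by apply/asboolP. Qed.
Definition endG_one := EndG endG_one_subproof.

Fact endG_mul_subproof (phi psi : endG) : (phi \o psi) \in equivariant_pred.
Proof.
have [[l1 c1] [l2 c2]] := (endGP phi, endGP psi).
by apply/asboolP; split=> [a u v|g v] /=; rewrite ?l2 ?l1 ?c2 ?c1.
Qed.
Definition endG_mul phi psi := EndG (endG_mul_subproof phi psi).

Lemma endGD (phi psi : endG) v : (phi + psi) v = phi v + psi v.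
Proof. by []. Qed.

Lemma endG_add (phi : endG) : {morph phi : u v / u + v}.
Proof. by move=> u v; have [l _] := endGP phi; have := l 1 u v; rewrite !scale1r. Qed.

Fact endG_mulA : associative endG_mul.
Proof. by move=> f g h; apply: endG_inj. Qed.
Fact endG_mul1l : left_id endG_one endG_mul.
Proof. by move=> f; apply: endG_inj. Qed.
Fact endG_mul1r : right_id endG_one endG_mul.
Proof. by move=> f; apply: endG_inj. Qed.
Fact endG_mulDl : left_distributive endG_mul +%R.
Proof. by move=> f g h; apply: endG_inj. Qed.
Fact endG_mulDr : right_distributive endG_mul +%R.
Proof. by move=> f g h; apply: endG_inj => v; exact: endG_add. Qed.

HB.instance Definition _ := GRing.Zmodule_isPzRing.Build endG
  endG_mulA endG_mul1l endG_mul1r endG_mulDl endG_mulDr.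

Lemma endGM (phi psi : endG) v : (phi * psi) v = phi (psi v).
Proof. by []. Qed.

(* An alias of V carrying its structure of left endG-module, since V itself
   carries its structure of E-module. *)
Definition taut_of (a : X -> {linear V -> V}) : Type := V.
Local Notation taut := (taut_of act).
HB.instance Definition _ := GRing.Zmodule.on taut.

Definition taut_scale (phi : endG) (v : taut) : taut := phi v.

Fact taut_scaleA a b v : taut_scale a (taut_scale b v) = taut_scale (a * b) v.
Proof. by []. Qed.
Fact taut_scale1 : left_id 1 taut_scale. Proof. by []. Qed.
Fact taut_scaleDr : right_distributive taut_scale +%R.
Proof. by move=> phi u v; exact: endG_add. Qed.
Fact taut_scaleDl v : {morph taut_scale^~ v : a b / a + b}.
Proof. by []. Qed.
HB.instance Definition _ := GRing.Zmodule_isLmodule.Build endG taut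
  taut_scaleA taut_scale1 taut_scaleDr taut_scaleDl.

End EndG.

(* ind J E is the compact induction of the trivial character of J: the functions
   on J\G with finite support, seen as left J-invariant functions on G whose
   support lies in finitely many cosets J y. *)
Section Induction.
Variables (G : groupType) (J : set G) (E : fieldType).
Implicit Types (f : G -> E^o) (g x : G).

Definition left_inv (K : set G) f := forall j x, K j -> f (j * x)%g = f x.

Definition finsupp_mod f := exists s : seq G,
  forall x, f x != 0 -> exists j y, [/\ J j, y \in s & x = (j * y)%g].

Definition ind_pred : {pred G -> E^o} :=
  fun f => `[< left_inv J f /\ finsupp_mod f >].

Record ind := Ind { ind_fun :> G -> E^o; _ : ind_fun \in ind_pred }.
HB.instance Definition _ := [isSub for ind_fun].
HB.instance Definition _ := [Choice of ind by <:].

Fact ind_submod : submod_closed ind_pred.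
Proof.
split=> [|a f1 f2 /asboolP[l1 [s1 c1]] /asboolP[l2 [s2 c2]]]; apply/asboolP; split.
- by [].
- by exists [::] => x; rewrite [0 x]/= eqxx.
- by move=> j x Kj; rewrite !fctE l1 // l2.
- exists (s1 ++ s2) => x; rewrite !fctE.
  have [->|/c1[j [y [Jj ys ->]]] _] := eqVneq (f1 x) 0; last first.
    by exists j, y; rewrite mem_cat ys.
  rewrite scaler0 add0r => /c2[j [y [Jj ys ->]]].
  by exists j, y; rewrite mem_cat ys orbT.
Qed.
HB.instance Definition _ := GRing.isSubmodClosed.Build _ _ ind_pred ind_submod.
HB.instance Definition _ := [SubChoice_isSubLmodule of ind by <:].

Lemma indP (f : ind) : left_inv J f /\ finsupp_mod f.
Proof. by apply/asboolP; exact: (valP f). Qed.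

Lemma ind_inj (f1 f2 : ind) : f1 =1 f2 -> f1 = f2.
Proof. by move=> e; apply/val_inj/funext. Qed.

Fact rtrans_subproof g (f : ind) : (fun x : G => f (x * g)%g) \in ind_pred.
Proof.
have [l [s c]] := indP f; apply/asboolP; split.
  by move=> j x Jj; rewrite /= -mulgA; exact: l.
exists [seq (y * g^-1)%g | y <- s] => x /c[j [y [Jj ys e]]].
exists j, (y * g^-1)%g; split => //; first by apply/mapP; exists y.
by rewrite mulgA -e mulgK.
Qed.
Definition rtrans g (f : ind) : ind := Ind (rtrans_subproof g f).

Fact rtrans_linear g : linear (rtrans g).
Proof. by move=> a u v; apply: ind_inj. Qed.
HB.instance Definition _ g := GRing.isLinear.Build _ _ _ _ (rtrans g) (rtrans_linear g).

Definition hecke := endG (fun g : G => rtrans g : {linear ind -> ind}).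
Definition ind_hecke := taut_of (fun g : G => rtrans g : {linear ind -> ind}).

End Induction.

Section GL2.
Variable R : comUnitRingType.

Record GL2 := MkGL2 { GL2_mx :> 'M[R]_2; _ : GL2_mx \in unitmx }.
HB.instance Definition _ := [isSub for GL2_mx].
HB.instance Definition _ := [Choice of GL2 by <:].

Lemma GL2_unit (g : GL2) : GL2_mx g \in unitmx.
Proof. exact: (valP g). Qed.

Definition GL2_one := MkGL2 (unitmx1 R 2).

Fact GL2_inv_subproof (g : GL2) : invmx g \in unitmx.
Proof. by rewrite unitmx_inv GL2_unit. Qed.
Definition GL2_inv g := MkGL2 (GL2_inv_subproof g).

Fact GL2_mul_subproof (g h : GL2) : g *m h \in unitmx.
Proof. by rewrite unitmx_mul !GL2_unit. Qed.
Definition GL2_mul g h := MkGL2 (GL2_mul_subproof g h).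

Fact GL2_mulA : associative GL2_mul.
Proof. by move=> g h l; apply/val_inj; rewrite /= mulmxA. Qed.
Fact GL2_mul1g : left_id GL2_one GL2_mul.
Proof. by move=> g; apply/val_inj; rewrite /= mul1mx. Qed.
Fact GL2_mulg1 : right_id GL2_one GL2_mul.
Proof. by move=> g; apply/val_inj; rewrite /= mulmx1. Qed.
Fact GL2_mulVg : left_inverse GL2_one GL2_inv GL2_mul.
Proof. by move=> g; apply/val_inj; rewrite /= mulVmx ?GL2_unit. Qed.
Fact GL2_mulgV : right_inverse GL2_one GL2_inv GL2_mul.
Proof. by move=> g; apply/val_inj; rewrite /= mulmxV ?GL2_unit. Qed.

HB.instance Definition _ := isGroup.Build GL2
  GL2_mulA GL2_mul1g GL2_mulg1 GL2_mulVg GL2_mulgV.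

Definition borel2 : set GL2 := [set g | g 1 0 = 0].
Definition unip2 : set GL2 := [set g | [/\ g 1 0 = 0, g 0 0 = 1 & g 1 1 = 1]].

End GL2.

Section GL2Map.
Variables (R S : comUnitRingType) (f : {rmorphism R -> S}).

Fact GL2_map_subproof (g : GL2 R) : map_mx f g \in unitmx.
Proof. by rewrite unitmxE det_map_mx rmorph_unit // -unitmxE GL2_unit. Qed.
Definition GL2_map g := MkGL2 (GL2_map_subproof g).

Lemma GL2_mapM : {morph GL2_map : g h / (g * h)%g}.
Proof. by move=> g h; apply/val_inj; rewrite /= map_mxM. Qed.

End GL2Map.

Record nonarch_abs (R : realType) (F : fieldType) := NonarchAbs {
  nabs :> F -> R;
  nabs_ge0 : forall x, 0 <= nabs x;
  nabs_eq0 : forall x, nabs x = 0 -> x = 0;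
  nabsM : {morph nabs : x y / x * y};
  nabs_max : forall x y, nabs (x + y) <= Num.max (nabs x) (nabs y);
  nabs_nontrivial : exists2 x, x != 0 & nabs x != 1
}.

Section NonarchTheory.
Variables (R : realType) (F : fieldType) (v : nonarch_abs R F).

Lemma nabs1 : v 1 = 1.
Proof.
have [x x0 _] := nabs_nontrivial v.
have vx0 : v x != 0 by apply: contra x0 => /eqP/nabs_eq0 ->.
by apply: (mulfI vx0); rewrite -nabsM !mulr1.
Qed.

Lemma nabs0 : v 0 = 0.
Proof.
have [x x0 vx1] := nabs_nontrivial v.
have : (v x - 1) * v 0 = 0 by rewrite mulrBl mul1r -nabsM mulr0 subrr.
by move/eqP; rewrite mulf_eq0 subr_eq0 (negPf vx1) => /eqP.
Qed.

Lemma nabs_gt0 x : x != 0 -> 0 < v x.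
Proof.
by move=> x0; rewrite lt_neqAle nabs_ge0 andbT eq_sym; apply: contra x0 => /eqP/nabs_eq0 ->.
Qed.

Lemma nabsN x : v (- x) = v x.
Proof.
have e : v (-1) ^+ 2 = 1 by rewrite expr2 -nabsM mulrNN mulr1 nabs1.
have : v (-1) = 1.
  move/eqP: e; rewrite sqrf_eq1 => /orP[/eqP//|/eqP e].
  by have := nabs_ge0 v (-1); rewrite e oppr_ge0 ler10.
by move=> e1; rewrite -mulN1r nabsM e1 mul1r.
Qed.

Lemma nabsV x : v x^-1 = (v x)^-1.
Proof.
have [->|x0] := eqVneq x 0; first by rewrite invr0 nabs0 invr0.
by apply: (mulfI (lt0r_neq0 (nabs_gt0 x0))); rewrite -nabsM !divff ?nabs1 // lt0r_neq0 ?nabs_gt0.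
Qed.

(* An alias of F carrying the metric and the topology defined by v. *)
Definition nabs_space (w : nonarch_abs R F) : Type := F.
Local Notation Fv := (nabs_space v).
HB.instance Definition _ := Choice.on Fv.

Let dist (x y : Fv) : R := v ((x : F) - y).
Fact nabs_distxx x : dist x x = 0.
Proof. by rewrite /dist subrr nabs0. Qed.
Fact nabs_dist_positivity x y : dist x y = 0 -> x = y.
Proof. by move/nabs_eq0/eqP; rewrite subr_eq0 => /eqP. Qed.
Fact nabs_dist_sym x y : dist x y = dist y x.
Proof. by rewrite /dist -nabsN opprB. Qed.
Fact nabs_dist_triangle y x z : dist x z <= dist x y + dist y z.
Proof.
rewrite /dist -[X in v X](@subrKA F y) //.
by apply: (le_trans (nabs_max _ _ _)); rewrite ge_max lerDl lerDr !nabs_ge0.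
Qed.
HB.instance Definition _ := isMetric.Build R Fv
  nabs_distxx nabs_dist_positivity nabs_dist_sym nabs_dist_triangle.

Definition nabs_ring_pred : {pred F} := fun x => v x <= 1.

Fact nabs_subring : subring_closed nabs_ring_pred.
Proof.
rewrite /nabs_ring_pred; split=> [|x y|x y]; rewrite -!topredE /=.
- by rewrite nabs1.
- by move=> hx hy; apply: (le_trans (nabs_max _ _ _)); rewrite ge_max hx nabsN.
- by move=> hx hy; rewrite nabsM mulr_ile1 ?nabs_ge0.
Qed.
HB.instance Definition _ := GRing.isSubringClosed.Build _ nabs_ring_pred nabs_subring.

Record nabs_ring := NabsRing { nabs_ring_val :> F; _ : nabs_ring_val \in nabs_ring_pred }.
HB.instance Definition _ := [isSub for nabs_ring_val].
HB.instance Definition _ := [Choice of nabs_ring by <:].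
HB.instance Definition _ := [SubChoice_isSubComNzRing of nabs_ring by <:].

Lemma nabs_ringP (x : nabs_ring) : v x <= 1.
Proof. exact: (valP x). Qed.

Definition nabs_ring_unit : {pred nabs_ring} := fun x => v x == 1.

Fact nabs_ring_inv_subproof (x : nabs_ring) :
  (if x \in nabs_ring_unit then (val x)^-1 else val x) \in nabs_ring_pred.
Proof.
case: ifP => [|_]; last exact: (valP x).
by rewrite -!topredE /= /nabs_ring_unit /nabs_ring_pred nabsV => /eqP ->; rewrite invr1.
Qed.
Definition nabs_ring_inv x := NabsRing (nabs_ring_inv_subproof x).

Fact nabs_ring_mulVr : {in nabs_ring_unit, left_inverse 1 nabs_ring_inv *%R}.
Proof.
move=> x xu; apply/val_inj; rewrite /= xu mulVf //.
by apply/eqP => x0; move: xu; rewrite -topredE /= /nabs_ring_unit x0 nabs0 eq_sym oner_eq0.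
Qed.
Fact nabs_ring_unitP (x y : nabs_ring) : y * x = 1 -> nabs_ring_unit x.
Proof.
move=> /(congr1 val) /= /(congr1 v); rewrite nabsM nabs1 => e.
rewrite /nabs_ring_unit eq_le nabs_ringP /= -[leLHS]e.
by rewrite -[leRHS]mul1r ler_wpM2r ?nabs_ge0 ?nabs_ringP.
Qed.
Fact nabs_ring_inv_out : {in [predC nabs_ring_unit], nabs_ring_inv =1 id}.
Proof. by move=> x; rewrite inE => /negPf xu; apply/val_inj; rewrite /= xu. Qed.
HB.instance Definition _ := GRing.ComNzRing_hasMulInverse.Build nabs_ring
  nabs_ring_mulVr nabs_ring_unitP nabs_ring_inv_out.

End NonarchTheory.

(* A residue_map v k presents the field k as the quotient of the ring of integers
   of v by its maximal ideal. *)
Record residue_map (R : realType) (F : fieldType) (v : nonarch_abs R F) (k : fieldType) :=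
  ResidueMap {
  resmap :> {rmorphism nabs_ring v -> k};
  resmap_surj : forall y, exists x, resmap x = y;
  resmap_ker : forall x : nabs_ring v, resmap x = 0 <-> v x < 1
}.

Section Iwahori.
Variables (R : realType) (F : fieldType) (v : nonarch_abs R F).
Variables (k : fieldType) (red : residue_map v k).

(* iwahori and iwahori1 are the subgroups of GL2 (nabs_ring v), embedded in GL2 F,
   whose reduction is upper triangular, resp. upper triangular unipotent. *)
Definition iwahori : set (GL2 F) :=
  GL2_map (val : {rmorphism nabs_ring v -> F}) @` (GL2_map red @^-1` @borel2 k).

Definition iwahori1 : set (GL2 F) :=
  GL2_map (val : {rmorphism nabs_ring v -> F}) @` (GL2_map red @^-1` @unip2 k).

End Iwahori.

(* The last two conditions are what makes the space of left J-invariant functions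
   in ind J1 E stable under End_G(ind J1 E), see hecke_left_inv; iwahori_pair
   below proves that they hold for the Iwahori subgroup. *)
Record hecke_pair (G : groupType) (J1 J : set G) : Prop := HeckePair {
  hp_sub : J1 `<=` J;
  hp_one : J 1%g;
  hp_mul : forall x y, J x -> J y -> J (x * y)%g;
  hp_inv : forall x, J x -> J (x^-1)%g;
  hp_fin : exists s : seq G, forall x, J x ->
    exists j y, [/\ J1 j, y \in s & x = (j * y)%g];
  hp_fact : forall t g, J t ->
    exists j1 j, [/\ J1 j1, J j & (t * g = j1 * g * j)%g]
}.

Section IndSub.
Variables (G : groupType) (J1 J : set G) (hp : hecke_pair J1 J) (E : fieldType).

Fact ind_incl_subproof (f : ind J E) : ind_fun f \in @ind_pred G J1 E.
Proof.
have [l [s c]] := indP f; apply/asboolP; split.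
  by move=> j x /(hp_sub hp); exact: l.
have [r hr] := hp_fin hp.
exists [seq (z * y)%g | z <- r, y <- s] => x /c[j [y [Jj ys ->]]].
have [j1 [z [J1j zr ->]]] := hr _ Jj.
exists j1, (z * y)%g; split; rewrite ?mulgA //.
by apply/allpairsP; exists (z, y).
Qed.
Definition ind_incl (f : ind J E) : ind J1 E := Ind (ind_incl_subproof f).

Lemma ind_incl_inj : injective ind_incl.
Proof. by move=> f1 f2 [e]; apply: ind_inj => x; rewrite e. Qed.

Fact ind_restr_subproof (f : ind J1 E) :
  left_inv J f -> ind_fun f \in @ind_pred G J E.
Proof.
move=> lJ; have [l [s c]] := indP f; apply/asboolP; split => //.
exists s => x /c[j [y [Jj ys ->]]]; exists j, y; split => //.
exact: (hp_sub hp).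
Qed.

Lemma ind_inclP (f : ind J1 E) :
  left_inv J f <-> exists f' : ind J E, f = ind_incl f'.
Proof.
split=> [lJ|[f' ->]]; last exact: (indP f').1.
by exists (Ind (ind_restr_subproof lJ)); apply: ind_inj.
Qed.

Fact ind_char_subproof y :
  (fun x : G => `[< exists2 j, J j & x = (j * y)%g >]%:R) \in @ind_pred G J E.
Proof.
apply/asboolP; split=> [j x Jj|] /=.
  congr (_%:R); congr nat_of_bool; apply: asbool_equiv_eq; split=> [[i Ji e]|[i Ji ->]].
    exists (j^-1 * i)%g; first by apply: (hp_mul hp) => //; exact: (hp_inv hp).
    by rewrite -mulgA -e mulKg.
  by exists (j * i)%g; rewrite ?mulgA //; exact: (hp_mul hp).
exists [:: y] => x; case: asboolP => [[j Jj ->] _|]; last by rewrite eqxx.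
by exists j, y; rewrite inE.
Qed.
Definition ind_char y : ind J E := Ind (ind_char_subproof y).

Lemma hecke_left_inv (phi : hecke J1 E) (f : ind J E) :
  left_inv J (phi (ind_incl f)).
Proof.
have [phil phic] := endGP phi.
have char1 : left_inv J (phi (ind_incl (ind_char 1%g))).
  move=> t x Jt; set h := phi _.
  have hr j y : J j -> h (y * j)%g = h y.
    move=> Jj; rewrite -[LHS]/(rtrans j h y) -phic.
    congr ((phi _ : ind J1 E) y); apply: ind_inj => z /=.
    congr (_%:R); congr nat_of_bool; apply: asbool_equiv_eq.
    split=> [[i Ji e]|[i Ji ->]].
      exists (i * j^-1)%g; first by apply: (hp_mul hp) => //; exact: (hp_inv hp).
      by rewrite mulg1 in e; rewrite mulg1 -e mulgK.
    by exists (i * j)%g; rewrite ?mulg1 //; exact: (hp_mul hp).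
  have [j1 [j [J1j Jj ->]]] := hp_fact hp x Jt.
  by rewrite hr // (indP h).1.
have chary y : left_inv J (phi (ind_incl (ind_char y))).
  have -> : ind_incl (ind_char y) = rtrans y^-1%g (ind_incl (ind_char 1%g)).
    apply: ind_inj => z /=.
    congr (_%:R); congr nat_of_bool; apply: asbool_equiv_eq.
    split=> [[i Ji ->]|[i Ji e]]; exists i => //; first by rewrite mulg1 mulgK.
    by rewrite mulg1 in e; rewrite -e mulgVK.
  by rewrite phic => j x Jj /=; rewrite -mulgA; exact: char1.
have [_ [s]] := indP f; elim: s f => [|y s IHs] f hs.
  have -> : ind_incl f = 0.
    apply: ind_inj => x /=; apply/eqP/negPn/negP => /hs[j [y [_]]].
    by rewrite in_nil.
  have -> : phi 0 = 0 by have := phil (-1) 0 0; rewrite scaler0 addr0 scaleN1r addNr.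
  by [].
pose f' : ind J E := f - (f y : E) *: ind_char y.
have -> : ind_incl f = (f y : E) *: ind_incl (ind_char y) + ind_incl f'.
  by apply: ind_inj => x /=; rewrite !fctE /= addrC subrK.
rewrite phil => j x Jj /=; rewrite !fctE chary //; congr (_ + _).
apply: IHs => // z; rewrite /= !fctE /=.
case: asboolP => [[i Ji ->]|nz].
  by rewrite (indP f).1 // [_ *: _]mulr1 subrr eqxx.
rewrite scaler0 subr0 => /hs[i [w [Ji]]]; rewrite inE => /orP[/eqP -> e|ws ->].
  by case: nz; exists i.
by exists i, w.
Qed.

(* An alias of ind J E carrying its structure of End_G(ind J1 E)-module, which is
   that of a submodule of ind J1 E: ind_incl identifies ind J E with the left
   J-invariant functions in ind J1 E (ind_inclP), and the action is the one
   induced along ind_incl (ind_sub_scaleE). *)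
Definition ind_sub_of (h : hecke_pair J1 J) : Type := ind J E.
Local Notation ind_sub := (ind_sub_of hp).
HB.instance Definition _ := GRing.Zmodule.on ind_sub.

Definition ind_sub_scale (phi : hecke J1 E) (f : ind_sub) : ind_sub :=
  Ind (ind_restr_subproof (hecke_left_inv phi f)).

Lemma ind_sub_scaleE phi f :
  ind_incl (ind_sub_scale phi f) = phi (ind_incl f).
Proof. exact: ind_inj. Qed.

Lemma ind_inclD : {morph ind_incl : f g / f + g}.
Proof. by move=> f g; apply: ind_inj. Qed.

Fact ind_sub_scaleA a b f :
  ind_sub_scale a (ind_sub_scale b f) = ind_sub_scale (a * b) f.
Proof. by apply: ind_incl_inj; rewrite !ind_sub_scaleE. Qed.
Fact ind_sub_scale1 : left_id 1 ind_sub_scale.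
Proof. by move=> f; apply: ind_incl_inj; rewrite ind_sub_scaleE. Qed.
Fact ind_sub_scaleDr : right_distributive ind_sub_scale +%R.
Proof.
move=> a f g; apply: ind_incl_inj.
by rewrite ind_inclD !ind_sub_scaleE ind_inclD endG_add.
Qed.
Fact ind_sub_scaleDl f : {morph ind_sub_scale^~ f : a b / a + b}.
Proof. by move=> a b; apply: ind_incl_inj; rewrite ind_inclD !ind_sub_scaleE. Qed.
HB.instance Definition _ := GRing.Zmodule_isLmodule.Build (hecke J1 E) ind_sub
  ind_sub_scaleA ind_sub_scale1 ind_sub_scaleDr ind_sub_scaleDl.

End IndSub.

Section GL2Entries.
Variable S : comUnitRingType.
Implicit Types g h : GL2 S.

Definition mx22 (a b c d : S) : 'M[S]_2 :=
  \matrix_(i, j) (if i == 0 then (if j == 0 then a else b)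
                  else (if j == 0 then c else d)).

Lemma mx22E a b c d : (mx22 a b c d 0 0 = a) * (mx22 a b c d 0 1 = b) *
  (mx22 a b c d 1 0 = c) * (mx22 a b c d 1 1 = d).
Proof. by rewrite !mxE. Qed.

Lemma ord2 (i : 'I_2) : i = 0 \/ i = 1.
Proof. by case: i => [[|[|//]] hi]; [left|right]; exact: val_inj. Qed.

Lemma mx22_eq (A B : 'M[S]_2) : A 0 0 = B 0 0 -> A 0 1 = B 0 1 ->
  A 1 0 = B 1 0 -> A 1 1 = B 1 1 -> A = B.
Proof.
move=> e1 e2 e3 e4; apply/matrixP => i j.
by case: (ord2 i) => ->; case: (ord2 j) => ->.
Qed.

Lemma det22 (A : 'M[S]_2) : \det A = A 0 0 * A 1 1 - A 0 1 * A 1 0.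
Proof.
rewrite (expand_det_row _ 0) !big_ord_recl big_ord0 /cofactor !det_mx11 !mxE.
rewrite addr0 expr0 expr1 mul1r mulN1r mulrN.
by congr (A _ _ * A _ _ - A _ _ * A _ _); apply: val_inj.
Qed.

Lemma GL2_det g : g 0 0 * g 1 1 - g 0 1 * g 1 0 \is a GRing.unit.
Proof. by rewrite -det22 -unitmxE GL2_unit. Qed.

Lemma GL2_mulE g h i j : (g * h)%g i j = g i 0 * h 0 j + g i 1 * h 1 j.
Proof.
rewrite mxE !big_ord_recl big_ord0 addr0.
by congr (_ + g i _ * h _ j); apply: val_inj.
Qed.

End GL2Entries.

Section GL2Subgroups.
Variable k : fieldType.
Implicit Types g h : GL2 k.

Lemma borel2_diag g : borel2 g -> (g 0 0 != 0) /\ (g 1 1 != 0).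
Proof.
move=> g0; have := GL2_det g; rewrite g0 mulr0 subr0 unitfE mulf_eq0 negb_or.
by case/andP.
Qed.

Lemma borel2_1 : borel2 (1%g : GL2 k).
Proof. by rewrite /borel2 /= mxE. Qed.

Lemma borel2_M g h : borel2 g -> borel2 h -> borel2 (g * h)%g.
Proof. by move=> g0 h0; rewrite /borel2 /= GL2_mulE g0 h0 mul0r mulr0 addr0. Qed.

Lemma borel2_V g : borel2 g -> borel2 (g^-1)%g.
Proof.
move=> g0; have [_ g1] := borel2_diag g0.
have := GL2_mulE g g^-1%g 1 0; rewrite mulgV g0 mul0r add0r mxE /=.
by move/esym/eqP; rewrite mulf_eq0 (negPf g1) => /eqP.
Qed.

Lemma unip2_borel2 g : unip2 g -> borel2 g. Proof. by case. Qed.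

Lemma unip2_div g h : borel2 g -> borel2 h -> g 0 0 = h 0 0 -> g 1 1 = h 1 1 ->
  unip2 (g * h^-1)%g.
Proof.
move=> bg bh e0 e1; have [h0 h1] := borel2_diag bh.
have bl : borel2 (g * h^-1)%g by apply: borel2_M => //; exact: borel2_V.
split => //.
  have := GL2_mulE (g * h^-1)%g h 0 0; rewrite mulgVK e0 bh mulr0 addr0.
  by rewrite -[LHS]mul1r => /(mulIf h0).
have := GL2_mulE (g * h^-1)%g h 1 1; rewrite mulgVK e1 bl mul0r add0r.
by rewrite -[LHS]mul1r => /(mulIf h1).
Qed.

Lemma unip2_1 : unip2 (1%g : GL2 k).
Proof. by split; rewrite mxE. Qed.

Lemma unip2_V g : unip2 g -> unip2 (g^-1)%g.
Proof.
move=> [g0 g1 g2]; rewrite -[g^-1%g]mul1g; apply: unip2_div => //.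
- exact: borel2_1.
- by rewrite mxE.
- by rewrite mxE.
Qed.

Lemma unip2_M g h : unip2 g -> unip2 h -> unip2 (g * h)%g.
Proof.
move=> ug /unip2_V uh; rewrite -[h]invgK; have [u0 u1 u2] := uh.
have [g0 g1 g2] := ug; apply: unip2_div => //; by rewrite (g1, g2) (u1, u2).
Qed.

End GL2Subgroups.

Section GL2MapGroup.
Variables (R S : comUnitRingType) (f : {rmorphism R -> S}).

Lemma GL2_map1 : GL2_map f 1%g = 1%g.
Proof. by apply/val_inj; rewrite /= map_mx1. Qed.

Lemma GL2_mapV g : GL2_map f g^-1%g = (GL2_map f g)^-1%g.
Proof.
apply: (mulgI (GL2_map f g)); rewrite -GL2_mapM !mulgV; exact: GL2_map1.
Qed.

End GL2MapGroup.

Section IwahoriTheory.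
Variables (R : realType) (F : fieldType) (v : nonarch_abs R F).
Variables (k : finFieldType) (red : residue_map v k).

Local Notation I := (iwahori red).
Local Notation I1 := (iwahori1 red).

Lemma iwahori_1 : I 1%g.
Proof. by exists 1%g; rewrite /= ?GL2_map1 //; exact: borel2_1. Qed.

Lemma iwahori_M g h : I g -> I h -> I (g * h)%g.
Proof.
move=> [A a <-] [B b <-]; exists (A * B)%g; last exact: GL2_mapM.
rewrite /= GL2_mapM; exact: borel2_M.
Qed.

Lemma iwahori_V g : I g -> I g^-1%g.
Proof.
move=> [A a <-]; exists (A^-1)%g; last exact: GL2_mapV.
rewrite /= GL2_mapV; exact: borel2_V.
Qed.

Lemma iwahori1_M g h : I1 g -> I1 h -> I1 (g * h)%g.
Proof.
move=> [A a <-] [B b <-]; exists (A * B)%g; last exact: GL2_mapM.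
rewrite /= GL2_mapM; exact: unip2_M.
Qed.

Lemma iwahori1_V g : I1 g -> I1 g^-1%g.
Proof.
move=> [A a <-]; exists (A^-1)%g; last exact: GL2_mapV.
rewrite /= GL2_mapV; exact: unip2_V.
Qed.

Lemma iwahori1_sub : I1 `<=` I.
Proof. by move=> g [A a <-]; exists A => //; exact: unip2_borel2. Qed.

Lemma iwahori_fin : exists s : seq (GL2 F), forall x, I x ->
  exists j y, [/\ I1 j, y \in s & x = (j * y)%g].
Proof.
pose P (c : k * k) (A : GL2 (nabs_ring v)) :=
  [/\ borel2 (GL2_map red A), GL2_map red A 0 0 = c.1 & GL2_map red A 1 1 = c.2].
pose rep c : GL2 (nabs_ring v) :=
  if pselect (exists A, P c A) is left e then sval (cid e) else 1%g.
have repP c A : P c A -> P c (rep c).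
  by move=> p; rewrite /rep; case: pselect => [e|[]]; [exact: (svalP (cid e))|exists A].
exists [seq GL2_map (val : {rmorphism nabs_ring v -> F}) (rep c) | c <- enum {: k * k}].
move=> x [A bA <-].
pose c := (GL2_map red A 0 0, GL2_map red A 1 1).
have [bB e0 e1] : P c (rep c) by apply: (repP c A).
exists (GL2_map (val : {rmorphism nabs_ring v -> F}) (A * (rep c)^-1)%g).
exists (GL2_map (val : {rmorphism nabs_ring v -> F}) (rep c)); split.
- exists (A * (rep c)^-1)%g => //; rewrite /= GL2_mapM GL2_mapV.
  exact: unip2_div.
- by apply/mapP; exists c; rewrite ?mem_enum.
- by rewrite -GL2_mapM mulgVK.
Qed.

Definition to_ring (x : F) : nabs_ring v := insubd 0 x.
Lemma to_ringK x : v x <= 1 -> val (to_ring x) = x.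
Proof. by move=> h; rewrite insubdK. Qed.

Lemma nabs_unit (x : nabs_ring v) : v x = 1 -> x \is a GRing.unit.
Proof. by move=> h; rewrite -[_ \is a _]/(v x == 1) h. Qed.

Lemma iwahori_lift (g : GL2 F) : (forall i j, v (g i j) <= 1) -> v (\det g) = 1 ->
  exists A : GL2 (nabs_ring v),
    g = GL2_map (val : {rmorphism nabs_ring v -> F}) A.
Proof.
move=> h hd.
pose A : 'M_2 := \matrix_(i, j) to_ring (g i j).
have e : map_mx (val : {rmorphism nabs_ring v -> F}) A = g.
  by apply/matrixP => i j; rewrite !mxE; exact: to_ringK.
have uA : A \in unitmx.
  rewrite unitmxE; apply: nabs_unit.
  by rewrite -[nabs_ring_val _]/((val : {rmorphism nabs_ring v -> F}) _) -det_map_mx e.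
by exists (MkGL2 uA); apply/val_inj.
Qed.

Lemma iwahori1_intro (g : GL2 F) : (forall i j, v (g i j) <= 1) ->
  v (\det g) = 1 -> v (g 1 0) < 1 -> v (g 0 0 - 1) < 1 -> v (g 1 1 - 1) < 1 ->
  I1 g.
Proof.
move=> h hd h0 h1 h2; have [A e] := iwahori_lift h hd.
have red1 (x : nabs_ring v) : v (val x - 1) < 1 -> red x = 1.
  move=> hx; have /eqP := (resmap_ker red (x - 1)).2 hx.
  by rewrite rmorphB rmorph1 subr_eq0 => /eqP.
move: h0 h1 h2; rewrite e !mxE => /(resmap_ker red) h0 /red1 h1 /red1 h2.
by exists A => //; split; rewrite !mxE.
Qed.

Lemma iwahori_intro (g : GL2 F) : (forall i j, v (g i j) <= 1) ->
  v (\det g) = 1 -> v (g 1 0) < 1 -> I g.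
Proof.
move=> h hd h0; have [A e] := iwahori_lift h hd.
by move: h0; rewrite e mxE => /(resmap_ker red) h0; exists A; rewrite //= /borel2 /= mxE.
Qed.

Lemma iwahori_elim (g : GL2 F) : I g -> [/\ forall i j, v (g i j) <= 1,
  v (g 1 0) < 1, v (g 0 0) = 1 & v (g 1 1) = 1].
Proof.
move=> [A bA <-]; have [b0 b1] := borel2_diag bA.
have un (x : nabs_ring v) : red x != 0 -> v x = 1.
  move=> rx; apply/eqP; rewrite eq_le nabs_ringP /= leNgt; apply: contra rx.
  by move/(resmap_ker red)/eqP.
move: bA b0 b1; rewrite /= /borel2 /= !mxE => bA b0 b1; split.
- by move=> i j; rewrite mxE nabs_ringP.
- by apply/(resmap_ker red).
- exact: un.
- exact: un.
Qed.

End IwahoriTheory.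

Section IwahoriFact.
Variables (R : realType) (F : fieldType) (v : nonarch_abs R F).
Variables (k : finFieldType) (red : residue_map v k).
Implicit Types g h : GL2 F.

Local Notation I := (iwahori red).
Local Notation I1 := (iwahori1 red).

Fact mx22_unit (a b c d : F) : a * d - b * c != 0 -> mx22 a b c d \in unitmx.
Proof. by move=> h; rewrite unitmxE det22 !mx22E unitfE. Qed.

Fact up_unit (x : F) : 1 * 1 - x * 0 != 0 :> F.
Proof. by rewrite mulr1 mulr0 subr0 oner_neq0. Qed.
Fact lo_unit (x : F) : 1 * 1 - 0 * x != 0 :> F.
Proof. by rewrite mulr1 mul0r subr0 oner_neq0. Qed.

Definition up_mx (x : F) : GL2 F :=
  MkGL2 (mx22_unit (up_unit x)).

Definition lo_mx (x : F) : GL2 F :=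
  MkGL2 (mx22_unit (lo_unit x)).

Lemma up_mx_iwahori1 x : v x <= 1 -> I1 (up_mx x).
Proof.
move=> hx; apply: iwahori1_intro; rewrite ?det22 /= ?mx22E ?subrr ?nabs0 ?ltr01 //.
- by move=> i j; case: (ord2 i) => ->; case: (ord2 j) => ->;
    rewrite mx22E ?nabs0 ?nabs1 ?ler01.
- by rewrite mulr0 mulr1 subr0 nabs1.
Qed.

Lemma lo_mx_iwahori1 x : v x < 1 -> I1 (lo_mx x).
Proof.
move=> hx; apply: iwahori1_intro; rewrite ?det22 /= ?mx22E ?subrr ?nabs0 ?ltr01 //.
- by move=> i j; case: (ord2 i) => ->; case: (ord2 j) => ->;
    rewrite mx22E ?nabs0 ?nabs1 ?ler01 ?(ltW hx).
- by rewrite mul0r mulr1 subr0 nabs1.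
Qed.

Definition monomial g := (g 0 1 = 0 /\ g 1 0 = 0) \/ (g 0 0 = 0 /\ g 1 1 = 0).

Definition decomposable g :=
  exists i n j, [/\ I1 i, monomial n, I j & g = (i * n * j)%g].

Lemma decomposable_mono g : monomial g -> decomposable g.
Proof.
move=> mg; exists 1%g, g, 1%g; split; rewrite ?mulg1 ?mul1g //.
  by rewrite -(mulgV 1%g); apply: iwahori1_M; [|apply: iwahori1_V];
    rewrite (_ : 1%g = up_mx 0); try (by apply: up_mx_iwahori1; rewrite nabs0 ler01);
    apply/val_inj/mx22_eq; rewrite /= !mxE.
exact: iwahori_1.
Qed.

Lemma decomposable_l e g : I1 e -> decomposable (e * g)%g -> decomposable g.
Proof.
move=> he [i [n [j [hi hn hj eq]]]]; exists (e^-1 * i)%g, n, j; split => //.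
  by apply: iwahori1_M => //; exact: iwahori1_V.
by rewrite -[LHS](mulKg e) eq !mulgA.
Qed.

Lemma decomposable_r e g : I e -> decomposable (g * e)%g -> decomposable g.
Proof.
move=> he [i [n [j [hi hn hj eq]]]]; exists i, n, (j * e^-1)%g; split => //.
  by apply: iwahori_M => //; exact: iwahori_V.
by rewrite mulgA -eq mulgK.
Qed.

Lemma up_mulE x g : [/\ (up_mx x * g)%g 0 0 = g 0 0 + x * g 1 0,
  (up_mx x * g)%g 0 1 = g 0 1 + x * g 1 1, (up_mx x * g)%g 1 0 = g 1 0 &
  (up_mx x * g)%g 1 1 = g 1 1].
Proof. by rewrite !GL2_mulE /= !mx22E; split; ring. Qed.

Lemma lo_mulE x g : [/\ (lo_mx x * g)%g 0 0 = g 0 0,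
  (lo_mx x * g)%g 0 1 = g 0 1, (lo_mx x * g)%g 1 0 = g 1 0 + x * g 0 0 &
  (lo_mx x * g)%g 1 1 = g 1 1 + x * g 0 1].
Proof. by rewrite !GL2_mulE /= !mx22E; split; ring. Qed.

Lemma mul_upE x g : [/\ (g * up_mx x)%g 0 0 = g 0 0,
  (g * up_mx x)%g 0 1 = g 0 1 + x * g 0 0, (g * up_mx x)%g 1 0 = g 1 0 &
  (g * up_mx x)%g 1 1 = g 1 1 + x * g 1 0].
Proof. by rewrite !GL2_mulE /= !mx22E; split; ring. Qed.

Lemma mul_loE x g : [/\ (g * lo_mx x)%g 0 0 = g 0 0 + x * g 0 1,
  (g * lo_mx x)%g 0 1 = g 0 1, (g * lo_mx x)%g 1 0 = g 1 0 + x * g 1 1 &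
  (g * lo_mx x)%g 1 1 = g 1 1].
Proof. by rewrite !GL2_mulE /= !mx22E; split; ring. Qed.

Lemma nabs_div_le1 x y : y != 0 -> (v (- (x / y)) <= 1) = (v x <= v y).
Proof.
move=> y0; rewrite nabsN nabsM nabsV ler_pdivrMr ?mul1r //; exact: nabs_gt0.
Qed.

Lemma nabs_div_lt1 x y : y != 0 -> (v (- (x / y)) < 1) = (v x < v y).
Proof.
move=> y0; rewrite nabsN nabsM nabsV ltr_pdivrMr ?mul1r //; exact: nabs_gt0.
Qed.

Lemma nabs_lt_neq0 x y : v x < v y -> y != 0.
Proof.
by move=> h; apply/eqP => y0; move: h; rewrite y0 nabs0 ltNge nabs_ge0.
Qed.

Lemma subdivK (x y : F) : y != 0 -> x + - (x / y) * y = 0.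
Proof. by move=> y0; rewrite mulNr divfK ?subrr. Qed.

Lemma decomposable_bl g : g 1 0 = 0 -> decomposable g.
Proof.
move=> c0; have := GL2_det g; rewrite c0 mulr0 subr0 unitfE mulf_eq0 negb_or.
case/andP=> a0 d0.
have [bd|db] := leP (v (g 0 1)) (v (g 1 1)).
  apply: (decomposable_l (e := up_mx (- (g 0 1 / g 1 1)))).
    by apply: up_mx_iwahori1; rewrite nabs_div_le1.
  apply: decomposable_mono; left.
  by have [_ -> -> _] := up_mulE (- (g 0 1 / g 1 1)) g; rewrite subdivK.
have [ba|ab] := leP (v (g 0 1)) (v (g 0 0)).
  apply: (decomposable_r (e := up_mx (- (g 0 1 / g 0 0)))).
    by apply/iwahori1_sub/up_mx_iwahori1; rewrite nabs_div_le1.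
  apply: decomposable_mono; left.
  by have [_ -> -> _] := mul_upE (- (g 0 1 / g 0 0)) g; rewrite subdivK.
have b0 := nabs_lt_neq0 db.
apply: (decomposable_l (e := lo_mx (- (g 1 1 / g 0 1)))).
  by apply: lo_mx_iwahori1; rewrite nabs_div_lt1.
set h := (_ * g)%g; have [h00 h01 h10 h11] := lo_mulE (- (g 1 1 / g 0 1)) g.
rewrite -/h in h00 h01 h10 h11; rewrite subdivK // in h11.
apply: (decomposable_r (e := lo_mx (- (g 0 0 / g 0 1)))).
  by apply/iwahori1_sub/lo_mx_iwahori1; rewrite nabs_div_lt1.
apply: decomposable_mono; right.
have [-> _ _ ->] := mul_loE (- (g 0 0 / g 0 1)) h.
by rewrite h00 h01 h11 subdivK.
Qed.

Lemma decomposable_br g : g 1 1 = 0 -> decomposable g.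
Proof.
move=> d0; have := GL2_det g; rewrite d0 mulr0 sub0r unitfE oppr_eq0 mulf_eq0 negb_or.
case/andP=> b0 c0.
have [ac|ca] := leP (v (g 0 0)) (v (g 1 0)).
  apply: (decomposable_l (e := up_mx (- (g 0 0 / g 1 0)))).
    by apply: up_mx_iwahori1; rewrite nabs_div_le1.
  apply: decomposable_mono; right.
  by have [-> _ _ ->] := up_mulE (- (g 0 0 / g 1 0)) g; rewrite subdivK.
have [ba|ab] := leP (v (g 0 1)) (v (g 0 0)); last first.
  apply: (decomposable_r (e := lo_mx (- (g 0 0 / g 0 1)))).
    by apply/iwahori1_sub/lo_mx_iwahori1; rewrite nabs_div_lt1.
  apply: decomposable_mono; right.
  by have [-> _ _ ->] := mul_loE (- (g 0 0 / g 0 1)) g; rewrite subdivK.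
have a0 := nabs_lt_neq0 ca.
apply: (decomposable_l (e := lo_mx (- (g 1 0 / g 0 0)))).
  by apply: lo_mx_iwahori1; rewrite nabs_div_lt1.
set h := (_ * g)%g; have [h00 h01 h10 h11] := lo_mulE (- (g 1 0 / g 0 0)) g.
rewrite -/h in h00 h01 h10 h11; rewrite subdivK // in h10.
apply: (decomposable_r (e := up_mx (- (g 0 1 / g 0 0)))).
  by apply/iwahori1_sub/up_mx_iwahori1; rewrite nabs_div_le1.
apply: decomposable_mono; left.
have [_ -> -> _] := mul_upE (- (g 0 1 / g 0 0)) h.
by rewrite h00 h01 h10 subdivK.
Qed.

Lemma iwahori_decomposition g : decomposable g.
Proof.
have [c0|c0] := eqVneq (g 1 0) 0; first exact: decomposable_bl.
have [dc|cd] := leP (v (g 1 1)) (v (g 1 0)).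
  apply: (decomposable_r (e := up_mx (- (g 1 1 / g 1 0)))).
    by apply/iwahori1_sub/up_mx_iwahori1; rewrite nabs_div_le1.
  apply: decomposable_br.
  by have [_ _ _ ->] := mul_upE (- (g 1 1 / g 1 0)) g; rewrite subdivK.
have d0 := nabs_lt_neq0 cd.
apply: (decomposable_r (e := lo_mx (- (g 1 0 / g 1 1)))).
  by apply/iwahori1_sub/lo_mx_iwahori1; rewrite nabs_div_lt1.
apply: decomposable_bl.
by have [_ _ -> _] := mul_loE (- (g 1 0 / g 1 1)) g; rewrite subdivK.
Qed.

Definition torus g := [/\ g 0 1 = 0, g 1 0 = 0, v (g 0 0) = 1 & v (g 1 1) = 1].

Lemma torus_iwahori g : torus g -> I g.
Proof.
move=> [b0 c0 a1 d1]; apply: iwahori_intro.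
- by move=> i j; case: (ord2 i) => ->; case: (ord2 j) => ->;
    rewrite ?b0 ?c0 ?a1 ?d1 ?nabs0 ?ler01.
- by rewrite det22 b0 mul0r subr0 nabsM a1 d1 mulr1.
- by rewrite c0 nabs0 ltr01.
Qed.

Lemma nabs1_neq0 x : v x = 1 -> x != 0.
Proof. by move=> h; apply/eqP => x0; move/eqP: h; rewrite x0 nabs0 eq_sym oner_eq0. Qed.

Lemma iwahori_torus g : I g -> exists i d, [/\ I1 i, torus d & g = (i * d)%g].
Proof.
move=> /iwahori_elim [hle h10 h00 h11].
have a0 := nabs1_neq0 h00; have d0 := nabs1_neq0 h11.
have du : g 0 0 * g 1 1 - 0 * 0 != 0 by rewrite mul0r subr0 mulf_neq0.
pose d : GL2 F := MkGL2 (mx22_unit du).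
have td : torus d by split; rewrite mx22E.
have iu : 1 * 1 - (g 0 1 / g 1 1) * (g 1 0 / g 0 0) != 0.
  have -> : 1 * 1 - (g 0 1 / g 1 1) * (g 1 0 / g 0 0) =
      (g 0 0 * g 1 1 - g 0 1 * g 1 0) / (g 0 0 * g 1 1) by field; rewrite a0 d0.
  by rewrite mulf_neq0 ?invr_eq0 ?mulf_neq0 //; have := GL2_det g; rewrite unitfE.
pose i : GL2 F := MkGL2 (mx22_unit iu).
have ei : g = (i * d)%g.
  apply/val_inj/mx22_eq; rewrite [RHS]GL2_mulE /= !mx22E; field; by rewrite ?a0 ?d0.
exists i, d; split => //; apply: iwahori1_intro => /=.
- move=> x y; case: (ord2 x) => ->; case: (ord2 y) => ->; rewrite mx22E ?nabs1 //.
    by rewrite nabsM nabsV h11 invr1 mulr1.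
  by rewrite nabsM nabsV h00 invr1 mulr1.
- have dd : v (\det d) = 1 by rewrite det22 /= !mx22E mul0r subr0 nabsM h00 h11 mulr1.
  have e : \det g = \det i * \det d by rewrite ei -det_mulmx.
  have lg : v (\det i) = v (\det g) by rewrite e nabsM dd mulr1.
  rewrite det22 /= !mx22E mulr1.
  have hlt : v (- (g 0 1 / g 1 1 * (g 1 0 / g 0 0))) < 1.
    rewrite nabsN !nabsM !nabsV h00 h11 invr1 !mulr1.
    by apply: le_lt_trans h10; rewrite ler_piMl ?nabs_ge0.
  move: hlt; move: (- _) => z hz; apply/eqP; rewrite eq_le; apply/andP; split.
    by apply: (le_trans (nabs_max _ _ _)); rewrite ge_max nabs1 lexx ltW.
  rewrite leNgt; apply/negP => h1.
  have : v (1 + z - z) < 1.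
    by apply: (le_lt_trans (nabs_max _ _ _)); rewrite gt_max nabsN h1 hz.
  by rewrite addrK nabs1 ltxx.
- by rewrite mx22E nabsM nabsV h00 invr1 mulr1.
- by rewrite mx22E subrr nabs0 ltr01.
- by rewrite mx22E subrr nabs0 ltr01.
Qed.

Lemma torus_monomial d n : torus d -> monomial n ->
  exists2 d', torus d' & (d * n = n * d')%g.
Proof.
move=> [d01 d10 d00 d11] hn.
have a0 := nabs1_neq0 d00; have b0 := nabs1_neq0 d11.
have u1 : d 0 0 * d 1 1 - 0 * 0 != 0 by rewrite mul0r subr0 mulf_neq0.
have u2 : d 1 1 * d 0 0 - 0 * 0 != 0 by rewrite mul0r subr0 mulf_neq0.
case: hn => [[n0 n1]|[n0 n1]].
  exists (MkGL2 (mx22_unit u1)); first by split; rewrite mx22E.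
  by apply/val_inj/mx22_eq; rewrite [LHS]GL2_mulE [RHS]GL2_mulE /= !mx22E
    ?d01 ?d10 ?n0 ?n1; ring.
exists (MkGL2 (mx22_unit u2)); first by split; rewrite mx22E.
by apply/val_inj/mx22_eq; rewrite [LHS]GL2_mulE [RHS]GL2_mulE /= !mx22E
  ?d01 ?d10 ?n0 ?n1; ring.
Qed.

Lemma iwahori_fact t g : I t ->
  exists j1 j, [/\ I1 j1, I j & (t * g = j1 * g * j)%g].
Proof.
move=> It; have [i [n [j [hi hn hj ->]]]] := iwahori_decomposition g.
have [i' [d [hi' hd ed]]] := iwahori_torus (iwahori_M It (iwahori1_sub hi)).
have [d' hd' nd] := torus_monomial hd hn.
exists (i' * i^-1)%g, (j^-1 * d' * j)%g; split.
- by apply: iwahori1_M => //; exact: iwahori1_V.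
- apply: iwahori_M => //; apply: iwahori_M; first exact: iwahori_V.
  exact: torus_iwahori.
- rewrite !mulgA ed mulgVK mulgK -[(i' * d * n)%g]mulgA nd !mulgA.
  by [].
Qed.

Lemma iwahori_pair : hecke_pair I1 I.
Proof.
split.
- exact: iwahori1_sub.
- exact: iwahori_1.
- by move=> x y; exact: iwahori_M.
- by move=> x; exact: iwahori_V.
- exact: iwahori_fin.
- by move=> t g; exact: iwahori_fact.
Qed.

End IwahoriFact.

(* ind (iwahori red) E as a module over End_G(ind (iwahori1 red) E) *)
Definition iwahori_ind (R : realType) (F : fieldType) (v : nonarch_abs R F)
    (k : finFieldType) (red : residue_map v k) (E : fieldType) : Type :=
  ind_sub_of E (iwahori_pair red).
HB.instance Definition _ R F v k red E :=
  GRing.Lmodule.on (@iwahori_ind R F v k red E).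

(* For a finite group the support condition in ind is void. *)
Lemma ind_unip2P (k : finFieldType) (E : fieldType) (f : GL2 k -> E^o) :
  f \in @ind_pred (GL2 k) (@unip2 k) E <-> left_inv (@unip2 k) f.
Proof.
split=> [/asboolP[]//|l]; apply/asboolP; split => //.
exists (pmap insub (enum {: 'M[k]_2})) => x _; exists 1%g, x; split.
- exact: unip2_1.
- by rewrite mem_pmap_sub /= mem_enum.
- by rewrite mul1g.
Qed.

(* Main.v *)
(* Both modules are treated at once, by means of a group K with a surjection onto
   GL2 k in which J is the preimage of U: K is G itself for the finite group, and
   the group of integral matrices for the pro-p Iwahori subgroup.

   If q <> p, the Hecke operator T of the Weyl element kills the monomial x^(p-1) y
   in the entries (x, y) of the bottom row, because sums of small powers over k
   vanish. Flatness would write it as a sum of terms a f with T a = 0; but the part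
   of degree p of such a term is additive in (x, y), and x^(p-1) y is not.

   If q = p, or if only the trivial character of the torus occurs, there are
   generators v_x and Hecke operators e_x with e_x v_x = v_x, such that every
   relation between the v_x is a consequence of h_x e_x = 0; the module is then
   the direct sum of the projective left ideals generated by the e_x. For the finite
   group the v_x are torus eigenfunctions of the form x^(r-o) y^o, and T multiplies
   them by binomial coefficients C(o, r) with o < q, which are invertible if q = p.
   For the p-adic group one takes the v_x with o = r at the base edge of the
   tree and translates those with o > r to all vertices. In a relation, seen from
   a vertex farthest from the base edge, all the other terms lie beyond one edge.
   This makes the terms at that vertex add up to a function invariant under the
   pro-p Iwahori subgroup, and the finite case shows that they vanish. *)

From HB Require Import structures.
Require Import Defs.
From mathcomp Require Import all_boot all_order all_algebra.
From mathcomp Require Import boolp classical_sets functions reals topology.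
From mathcomp Require Import freeg ring finfield zify.

Set Implicit Arguments.
Unset Strict Implicit.
Unset Printing Implicit Defensive.

Import Order.TTheory GRing.Theory Num.Theory.

Local Open Scope classical_set_scope.
Local Open Scope ring_scope.
Local Open Scope quotient_scope.

(** * Dual bases *)

(** The binomial coefficients come from power sums. In the sum over [t] of [t^(q-1-r) (z+t)^o] only
    those terms of the expansion survive where the exponent of [t] is divisible by [q-1]: up to sign
    this is ['C(o, r) z^(o-r)], with a second term if [r = 0] and [o = q-1]. For the trivial
    character [r = 0] and the coefficient is 1, whatever [q] is; this is the source of the second
    assertion. The obstacle in the p-adic case is that a Hecke operator does not preserve the
    functions supported on the group [K] of integral matrices, so a relation cannot simply be
    restricted to the finite group. Instead the images are restricted to a coset [g K]. By the last
    condition of [level], a suitable choice of [g] in its coset makes the restriction invariant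
    under [U] again, and every Hecke operator then induces one of the finite group. The functions
    with [o = r] belong to edges rather than to vertices: they are right invariant under the pro-p
    Iwahori subgroup, and the matrix reversing the base edge acts on them through the Hecke algebra.
    Hence they are taken at one edge only. *)

Section BiadditiveLift.
Variables (R : pzRingType) (A : lmodType R^c) (M : lmodType R) (Z : zmodType).
Variable b : A -> M -> Z.

Definition bilift (x : {freeg (A * M)%type}) : Z :=
  fglift (fun y => b y.1 y.2 : zmodule Z) x.

Fact bilift_zmod_morphism : zmod_morphism bilift.
Proof. by exact: (@lift_is_additive _ _ (zmodule Z)). Qed.
HB.instance Definition _ := GRing.isZmodMorphism.Build _ _ bilift
  bilift_zmod_morphism.

Lemma biliftU a m : bilift << (a, m) >> = b a m.
Proof. by rewrite /bilift liftU scale1r. Qed.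

End BiadditiveLift.

Section TensorNull.
Variables (R : pzRingType) (A : lmodType R^c) (M : lmodType R).

Lemma bilift_null (Z : zmodType) (b : A -> M -> Z) (N : Z -> Prop) :
    N 0 -> (forall x y, N x -> N y -> N (x - y)) ->
    (forall a a' m, N (b (a + a') m - b a m - b a' m)) ->
    (forall a m m', N (b a (m + m') - b a m - b a m')) ->
    (forall a r m, N (b (ract a r) m - b a (r *: m))) ->
  forall x, tensor_null x -> N (bilift b x).
Proof.
move=> N0 NB hl hr hZ x; elim=> {x} [x|  |x y _ Nx _ Ny]; last 2 first.
- by rewrite raddf0.
- by rewrite raddfB; exact: NB.
by case=> [a a' m|a m m'|a r m]; rewrite !raddfB /= !biliftU; [apply: hl|apply: hr|apply: hZ].
Qed.

Lemma bilift_null0 (Z : zmodType) (b : A -> M -> Z) :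
    (forall m, {morph b^~ m : a a' / a + a'}) ->
    (forall a, {morph b a : m m' / m + m'}) ->
    (forall a r m, b (ract a r) m = b a (r *: m)) ->
  forall x, tensor_null x -> bilift b x = 0.
Proof.
move=> hl hr hZ.
apply: (bilift_null (b := b) (N := fun z => z = 0)) => //= [x y -> ->|a a' m|a m m'|a r m].
- by rewrite subr0.
- by rewrite hl addrAC addrK subrr.
- by rewrite hr addrAC addrK subrr.
- by rewrite hZ subrr.
Qed.

Definition tproj (x : {freeg (A * M)%type}) : tensor A M := \pi_(tensor A M) x.

Fact tproj_zmod_morphism : zmod_morphism tproj.
Proof. by move=> x y; rewrite /tproj raddfB. Qed.
HB.instance Definition _ := GRing.isZmodMorphism.Build _ _ tproj
  tproj_zmod_morphism.

Lemma tproj_eq0 x : tproj x = 0 <-> tensor_null x.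
Proof.
have E : (x \in @tensor_null_pred R A M) = (tproj x == 0).
  by rewrite -[x in LHS]subr0 Quotient.idealrBE pi_zeror.
by split=> [/eqP|hx]; [rewrite -E => /asboolP|apply/eqP; rewrite -E; apply/asboolP].
Qed.

Lemma tensDl a b m : tens (a + b) m = tens a m + tens b m :> tensor A M.
Proof.
apply/eqP; rewrite -subr_eq0 opprD addrA; apply/eqP.
rewrite -[LHS]/(tproj _ - tproj _ - tproj _) -!raddfB.
by apply/tproj_eq0/TensorNullRel/TensorDl.
Qed.

Lemma tensDr a m n : tens a (m + n) = tens a m + tens a n :> tensor A M.
Proof.
apply/eqP; rewrite -subr_eq0 opprD addrA; apply/eqP.
rewrite -[LHS]/(tproj _ - tproj _ - tproj _) -!raddfB.
by apply/tproj_eq0/TensorNullRel/TensorDr.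
Qed.

Lemma tensZ a r m : tens (ract a r) m = tens a (r *: m) :> tensor A M.
Proof.
apply/eqP; rewrite -subr_eq0; apply/eqP.
rewrite -[LHS]/(tproj _ - tproj _) -!raddfB.
by apply/tproj_eq0/TensorNullRel/TensorZ.
Qed.

Lemma tens0l m : tens 0 m = 0 :> tensor A M.
Proof. by apply: (@addrI _ (tens 0 m)); rewrite -tensDl !addr0. Qed.

Lemma tens0r a : tens a 0 = 0 :> tensor A M.
Proof. by apply: (@addrI _ (tens a 0)); rewrite -tensDr !addr0. Qed.

Lemma tens_sumr (X : Type) (s : seq X) a (F : X -> M) :
  tens a (\sum_(x <- s) F x) = \sum_(x <- s) tens a (F x) :> tensor A M.
Proof. exact: (big_morph (@tens R A M a) (tensDr a) (tens0r a)). Qed.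

Definition tensl m a : tensor A M := tens a m.

Fact tensl_zmod_morphism m : zmod_morphism (tensl m).
Proof.
by move=> a b; apply: (@addIr _ (tens b m)); rewrite /tensl -tensDl !subrK.
Qed.
HB.instance Definition _ m := GRing.isZmodMorphism.Build _ _ (tensl m)
  (tensl_zmod_morphism m).

End TensorNull.

Lemma big_uniq_sub (X : eqType) (N : nmodType) (F : X -> N) (s s' : seq X) :
    uniq s -> uniq s' -> {subset s' <= s} -> (forall x, x \notin s' -> F x = 0) ->
  \sum_(x <- s) F x = \sum_(x <- s') F x.
Proof.
move=> us us' sub F0; rewrite (bigID (mem s')) /= [X in _ + X]big1 ?addr0 //.
rewrite -big_filter; apply: perm_big; apply: uniq_perm => //.
  exact: filter_uniq.
by move=> x; rewrite mem_filter andb_idr //; exact: sub.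
Qed.

(** The criterion of the dual basis lemma, which characterises projective modules. It also gives
    flatness directly, since the [lam x] turn an element of [A] tensor [M] into a finite family of
    elements of [A]. *)
Definition dual_basis (R : pzRingType) (M : lmodType R) : Prop :=
  exists (X : choiceType) (v : X -> M) (lam : X -> {linear M -> R^o}),
    forall m, exists s : seq X, [/\ uniq s, forall x, x \notin s -> lam x m = 0
      & m = \sum_(x <- s) (lam x m : R) *: v x].

Section DualBasis.
Variables (R : pzRingType) (M : lmodType R).
Variables (X : choiceType) (v : X -> M) (lam : X -> {linear M -> R^o}).
Hypothesis lamP : forall m, exists s : seq X,
  [/\ uniq s, forall x, x \notin s -> lam x m = 0
    & m = \sum_(x <- s) (lam x m : R) *: v x].

Definition supp_of (m : M) : seq X := sval (cid (lamP m)).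

Lemma supp_of_uniq m : uniq (supp_of m).
Proof. by have [] := svalP (cid (lamP m)). Qed.
Lemma supp_of_out m x : x \notin supp_of m -> lam x m = 0.
Proof. by have [_ h _] := svalP (cid (lamP m)); apply: h. Qed.
Lemma supp_of_sum m : m = \sum_(x <- supp_of m) (lam x m : R) *: v x.
Proof. by have [_ _ h] := svalP (cid (lamP m)). Qed.

Section Extend.
Variables (N : lmodType R) (n : X -> N).

Definition dual_ext (m : M) : N := \sum_(x <- supp_of m) (lam x m : R) *: n x.

Lemma dual_extE m s : uniq s -> {subset supp_of m <= s} ->
  dual_ext m = \sum_(x <- s) (lam x m : R) *: n x.
Proof.
move=> us sub; apply/esym/big_uniq_sub => //; first exact: supp_of_uniq.
by move=> x /supp_of_out ->; exact: scale0r.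
Qed.

Fact dual_ext_linear : linear dual_ext.
Proof.
move=> a m m'; set s := undup (supp_of (a *: m + m') ++ supp_of m ++ supp_of m').
have us : uniq s by exact: undup_uniq.
have sub z : z \in [:: a *: m + m'; m; m'] -> {subset supp_of z <= s}.
  move=> hz x hx; rewrite mem_undup !mem_cat.
  by move: hz; rewrite !inE => /or3P[] /eqP <-; rewrite hx ?orbT.
rewrite !(@dual_extE _ s us); try by apply: sub; rewrite !inE eqxx ?orbT.
rewrite scaler_sumr -big_split /=; apply: eq_bigr => x _.
by rewrite linearP scalerDl -scalerA.
Qed.
HB.instance Definition _ := GRing.isLinear.Build _ _ _ _ dual_ext dual_ext_linear.

End Extend.

Lemma dual_projective : projective R M.
Proof.
move=> N P g f surj.
have [n hn] : exists n : X -> N, forall x, g (n x) = f (v x).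
  exists (fun x => sval (cid (surj (f (v x))))) => x.
  exact: (svalP (cid (surj (f (v x))))).
exists (dual_ext n : {linear M -> N}) => m /=.
rewrite /dual_ext linear_sum [in RHS](supp_of_sum m) linear_sum.
by apply: eq_bigr => x _; rewrite !linearZ /= hn.
Qed.

End DualBasis.

Section DualFlat.
Variables (R : pzRingType) (M : lmodType R).
Hypothesis db : dual_basis M.

Lemma tensor_map_eq0 (A B : lmodType R^c) (i : {linear A -> B}) :
    (forall z : tensor A M, tensor_map i z = 0 -> z = 0) ->
  injective (@tensor_map R A B M i).
Proof.
move=> h x y e; apply/eqP; rewrite -subr_eq0; apply/eqP/h.
have tN z : tensor_map i (- z : tensor A M) = - tensor_map i z.
  apply: (@addrI _ (tensor_map i z)); rewrite -tensor_mapD !subrr.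
  apply: (@addrI _ (tensor_map i (0 : tensor A M))).
  by rewrite -tensor_mapD !addr0.
by rewrite tensor_mapD tN e subrr.
Qed.

(** An element of the tensor product is the sum of the [tens a_x (v x)], where [a_x] is its image
    under the identity tensor [lam x]. These coordinates commute with [i]: if [i] kills the element,
    then [i a_x = 0], hence [a_x = 0]. *)
Lemma dual_flat : flat R M.
Proof.
have [X [v [lam lamP]]] := db.
move=> A B i inj; apply: tensor_map_eq0 => z; rewrite -[z]reprK tensor_map_pi.
pose ev (A' : lmodType R^c) x (a : A') (m : M) : A' := ract a (lam x m).
have evnull (A' : lmodType R^c) x y : tensor_null y -> bilift (ev A' x) y = 0.
  apply: bilift_null0 => [m a a'|a m m'|a r m].
  - exact: scalerDr.
  - by rewrite /ev raddfD; exact: scalerDl.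
  - by rewrite /ev /ract linearZ scalerA.
rewrite -!/(tproj _) !tproj_eq0; move: (repr z) => y {z} /evnull hy.
have {}hy x : bilift (ev A x) y = 0.
  apply: inj; rewrite raddf0 -(hy x).
  elim/freeg_ind_dom0: y {hy} => [|c [a m] y _ _ IH]; first by rewrite !raddf0.
  rewrite !raddfD /= IH -[c]intz -freegU_mulz !raddfMz /=; congr (_ *~ _ + _).
  by rewrite biliftU /tensor_lift liftU scale1r biliftU /ev /ract linearZ.
suff [s hs] : exists s0 : seq X, forall s, uniq s -> {subset s0 <= s} ->
    tproj y = \sum_(x <- s) tens (bilift (ev A x) y) (v x).
  apply/tproj_eq0; rewrite (hs (undup s)) ?undup_uniq //.
    by rewrite big1 // => x _; rewrite hy tens0l.
  by move=> x; rewrite mem_undup.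
elim/freeg_ind_dom0: y {hy} => [|c [a m] y _ _ [s1 IH]].
  by exists [::] => s _ _; rewrite raddf0 big1 // => x _; rewrite raddf0 tens0l.
have [s2 [us2 out2 e2]] := lamP m.
exists (s1 ++ s2) => s us sub; rewrite raddfD /= (IH s) //; last first.
  by move=> x hx; apply: sub; rewrite mem_cat hx.
under [RHS]eq_bigr => x _ do rewrite raddfD /= tensDl.
rewrite big_split /=; congr (_ + _).
rewrite -[c]intz -freegU_mulz raddfMz /=.
under eq_bigr => x _.
  rewrite raddfMz /= biliftU -/(tensl (v x) _) raddfMz /=; over.
rewrite -mulrz_suml; congr (_ *~ _).
rewrite -[LHS]/(tens a m) {1}e2 tens_sumr.
under eq_bigr => x _ do rewrite -tensZ.
apply/esym/big_uniq_sub => // [x hx|x /out2 e]; first by apply: sub; rewrite mem_cat hx orbT.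
by rewrite /tensl /ev e /ract scale0r tens0l.
Qed.

End DualFlat.

(* Only the case of one relation in one unknown of the equational criterion. *)
Section FlatRelation.
Variables (R : pzRingType) (r : R).

Definition principal_pred : {pred (R^c)^o} := fun x => `[< exists a, x = r * a :> R >].

Fact principal_submod : submod_closed principal_pred.
Proof.
split=> [|s x y /asboolP[a ->] /asboolP[b ->]]; apply/asboolP.
  by exists 0; rewrite mulr0.
by exists (a * (s : R) + b); rewrite mulrDr mulrA.
Qed.
HB.instance Definition _ := GRing.isSubmodClosed.Build _ _ principal_pred
  principal_submod.

Record principal := Principal { principal_val : (R^c)^o;
  _ : principal_val \in principal_pred }.
HB.instance Definition _ := [isSub for principal_val].
HB.instance Definition _ := [Choice of principal by <:].
HB.instance Definition _ := [SubChoice_isSubLmodule of principal by <:].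

Lemma principalP (x : principal) : exists a : R, val x = r * a :> R.
Proof. by apply/asboolP; exact: (valP x). Qed.

Fact principal_gen_subproof : (r : (R^c)^o) \in principal_pred.
Proof. by apply/asboolP; exists 1; rewrite mulr1. Qed.
Definition principal_gen := Principal principal_gen_subproof.

(** The element [r] tensor [m] vanishes over [R], hence by flatness already over the right ideal
    [r R]. The choice [c] of preimages under left multiplication by [r] is linear only up to
    elements annihilated by [r], an error that [N] absorbs. So [c principal_gen *: m] lies in [N],
    and so does [(1 - c principal_gen) *: m]. *)
Lemma flat_relation (M : lmodType R) (m : M) : flat R M -> r *: m = 0 ->
  exists s : seq (R * M),
    (forall x, x \in s -> r * x.1 = 0) /\ m = \sum_(x <- s) x.1 *: x.2.
Proof.
move=> fl rm0.
have tv : tens principal_gen m = 0 :> tensor principal M.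
  apply: (fl _ _ (val : {linear principal -> (R^c)^o})); first exact: val_inj.
  rewrite -[in RHS](tens0l _ 0) !tensor_mapE raddf0 tens0l.
  transitivity (tens (ract (1 : (R^c)^o) r) m : tensor _ M).
    by congr (tens _ m); exact/esym/(@mulr1 R^c r).
  by rewrite tensZ rm0 tens0r.
pose c (x : principal) : R := sval (cid (principalP x)).
have cP x : r * c x = val x by rewrite (svalP (cid (principalP x))).
pose N (n : M) := exists s : seq (R * M),
    (forall x, x \in s -> r * x.1 = 0) /\ n = \sum_(x <- s) x.1 *: x.2.
have N1 a n : r * a = 0 -> N (a *: n).
  by move=> h; exists [:: (a, n)]; rewrite big_seq1; split => // x; rewrite inE => /eqP ->.
have NB n n' : N n -> N n' -> N (n - n').
  move=> [s [h ->]] [s' [h' ->]]; exists (s ++ [seq (- x.1, x.2) | x <- s']); split.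
    move=> x; rewrite mem_cat => /orP[/h//|/mapP[y /h' e ->]].
    by rewrite mulrN e oppr0.
  rewrite big_cat big_map -sumrN; congr (_ + _).
  by apply: eq_bigr => x _; rewrite scaleNr.
have N0 : N 0 by rewrite -(scale0r m); apply: N1; rewrite mulr0.
have h : N (c principal_gen *: m).
  rewrite -(biliftU (fun x n => c x *: n)).
  apply: (bilift_null N0 NB _ _ _ ((tproj_eq0 _).1 tv)) => [a a' n|a n n'|a t n].
  - rewrite -!scalerBl; apply: N1.
    by rewrite !mulrBr !cP raddfD /= addrAC addrK subrr.
  - by rewrite scalerDr addrAC addrK subrr.
  - rewrite scalerA -scalerBl; apply: N1.
    by rewrite mulrBr mulrA !cP subrr.
have -> : m = (1 - c principal_gen) *: m - (0 - c principal_gen *: m).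
  by rewrite sub0r opprK scalerBl scale1r subrK.
apply: (NB _ _); first by apply: N1; rewrite mulrBr mulr1 cP subrr.
by apply: NB.
Qed.

End FlatRelation.

(* [M] is the direct sum of the projective modules [R e_x]. *)
Section IdempotentBasis.
Variables (R : pzRingType) (M : lmodType R) (X : choiceType).
Variables (v : X -> M) (e : X -> R).
Hypothesis ev : forall x, e x *: v x = v x.
Hypothesis indep : forall (s : seq X) (c : X -> R), uniq s ->
  \sum_(x <- s) c x *: v x = 0 -> forall x, x \in s -> c x * e x = 0.
Hypothesis gen : forall m, exists s : seq (X * R), m = \sum_(p <- s) p.2 *: v p.1.

Let repr_of m : exists sc : seq X * (X -> R),
  uniq sc.1 /\ m = \sum_(x <- sc.1) sc.2 x *: v x.
Proof.
have [s ->] := gen m; elim: s => [|[y r] s [[t c] /= [ut e']]].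
  by exists ([::], fun=> 0); rewrite !big_nil.
have [yt|yt] := boolP (y \in t).
  exists (t, fun x => (if x == y then r else 0) + c x); split=> //=.
  under [RHS]eq_bigr => x _ do rewrite scalerDl.
  rewrite big_cons e' big_split /= [in RHS](bigD1_seq y) //= eqxx.
  by rewrite [X in _ + X + _]big1 ?addr0 // => x /negPf ->; exact: scale0r.
exists (y :: t, fun x => if x == y then r else c x); rewrite /= yt; split=> //.
rewrite !big_cons e' /= eqxx; congr (_ + _); rewrite !big_seq; apply: eq_bigr => x xt.
by case: eqP => // exy; rewrite -exy xt in yt.
Qed.

Definition idem_coord (x : X) (m : M) : R^o :=
  let sc := sval (cid (repr_of m)) in if x \in sc.1 then sc.2 x * e x else 0.

(** By [indep], two choices of [c x] have the same product with [e x], so [c x * e x] is a well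
    defined coordinate. Idempotence of [e x] is [indep] applied to [(1 - e x) *: v x = 0]. *)
Lemma idem_coordE m (s : seq X) (c : X -> R) : uniq s ->
  m = \sum_(x <- s) c x *: v x ->
  forall x, idem_coord x m = if x \in s then c x * e x else 0.
Proof.
move=> us em x; rewrite /idem_coord.
case: (cid _) => -[s' c'] /= [us' em'].
set t := undup (s ++ s'); have ut : uniq t := undup_uniq _.
pose ext (s0 : seq X) (c0 : X -> R) y := if y \in s0 then c0 y else 0.
have extE s0 c0 : uniq s0 -> {subset s0 <= t} ->
    \sum_(y <- t) ext s0 c0 y *: v y = \sum_(y <- s0) c0 y *: v y.
  move=> u0 sub; rewrite (big_uniq_sub ut u0 sub); last first.
    by move=> y /negPf hy; rewrite /ext hy scale0r.
  by rewrite !big_seq; apply: eq_bigr => y hy; rewrite /ext hy.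
have st : {subset s <= t} by move=> y hy; rewrite mem_undup mem_cat hy.
have st' : {subset s' <= t} by move=> y hy; rewrite mem_undup mem_cat hy orbT.
have rel : \sum_(y <- t) (ext s' c' y - ext s c y) *: v y = 0.
  under eq_bigr => y _ do rewrite scalerBl.
  by rewrite sumrB !extE // -em -em' subrr.
have [xt|xt] := boolP (x \in t); last first.
  have /negPf -> : x \notin s' by apply: contra xt; apply: st'.
  by have /negPf -> : x \notin s by apply: contra xt; apply: st.
have /eqP := indep ut rel xt; rewrite mulrBl subr_eq0 /ext => /eqP.
by do 2 case: ifP; rewrite ?mul0r.
Qed.

Fact idem_coord_linear x : linear (idem_coord x).
Proof.
move=> a m m'; have [[s c] /= [us em]] := repr_of m; have [[s' c'] /= [us' em']] := repr_of m'.
set t := undup (s ++ s'); have ut : uniq t := undup_uniq _.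
pose ext (s0 : seq X) (c0 : X -> R) y := if y \in s0 then c0 y else 0.
have extE s0 c0 : uniq s0 -> {subset s0 <= t} ->
    \sum_(y <- t) ext s0 c0 y *: v y = \sum_(y <- s0) c0 y *: v y.
  move=> u0 sub; rewrite (big_uniq_sub ut u0 sub); last first.
    by move=> y /negPf hy; rewrite /ext hy scale0r.
  by rewrite !big_seq; apply: eq_bigr => y hy; rewrite /ext hy.
have st : {subset s <= t} by move=> y hy; rewrite mem_undup mem_cat hy.
have st' : {subset s' <= t} by move=> y hy; rewrite mem_undup mem_cat hy orbT.
have ea : a *: m + m' = \sum_(y <- t) (a * ext s c y + ext s' c' y) *: v y.
  under eq_bigr => y _ do rewrite scalerDl -scalerA.
  by rewrite big_split /= -scaler_sumr !extE // -em -em'.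
rewrite (idem_coordE ut ea) (idem_coordE us em) (idem_coordE us' em').
have [xt|xt] := boolP (x \in t).
  rewrite mulrDl -mulrA /ext; congr (_ + _); last by case: ifP; rewrite ?mul0r.
  by case: ifP; rewrite ?mul0r ?mulr0 // => _; rewrite scaler0.
have /negPf -> : x \notin s' by apply: contra xt; apply: st'.
have /negPf -> : x \notin s by apply: contra xt; apply: st.
by rewrite scaler0 addr0.
Qed.
HB.instance Definition _ x := GRing.isLinear.Build _ _ _ _ (idem_coord x)
  (idem_coord_linear x).

Lemma idempotent_dual_basis : dual_basis M.
Proof.
exists X, v, (fun x => idem_coord x : {linear M -> R^o}) => m.
have [[s c] /= [us em]] := repr_of m; exists s; split=> // [x /negPf hx|].
  by rewrite /= (idem_coordE us em) hx.
rewrite {1}em !big_seq; apply: eq_bigr => x hx.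
by rewrite /= (idem_coordE us em) hx -scalerA ev.
Qed.

End IdempotentBasis.

(** * The general linear group of a finite field *)

Section GL2Field.
Variable k : fieldType.
Implicit Types a b g : GL2 k.

Definition gl22 (x y z t : k) : GL2 k := insubd (1%g : GL2 k) (mx22 x y z t).

Lemma gl22K x y z t : x * t - y * z != 0 -> GL2_mx (gl22 x y z t) = mx22 x y z t.
Proof. by move=> h; rewrite /gl22 -[GL2_mx _]/(val _) insubdK //; exact: mx22_unit. Qed.

Lemma gl22E x y z t : x * t - y * z != 0 ->
  (gl22 x y z t 0 0 = x) * (gl22 x y z t 0 1 = y) *
  (gl22 x y z t 1 0 = z) * (gl22 x y z t 1 1 = t).
Proof. by move=> h; rewrite gl22K // !mx22E. Qed.

Definition det2 g : k := \det (GL2_mx g).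

Lemma det2E g : det2 g = g 0 0 * g 1 1 - g 0 1 * g 1 0. Proof. exact: det22. Qed.

Lemma det2M a b : det2 (a * b)%g = det2 a * det2 b. Proof. exact: det_mulmx. Qed.

Lemma det2_neq0 g : det2 g != 0.
Proof. by have := GL2_det g; rewrite -det22 unitfE. Qed.

Lemma GL2_eq a b : a 0 0 = b 0 0 -> a 0 1 = b 0 1 -> a 1 0 = b 1 0 -> a 1 1 = b 1 1 ->
  a = b.
Proof. by move=> *; apply/val_inj/mx22_eq. Qed.

Lemma GL2_1E i j : (1%g : GL2 k) i j = (i == j)%:R.
Proof. by rewrite mxE. Qed.

Lemma bottom_neq0 g : g 1 0 = 0 -> g 1 1 != 0.
Proof.
by move=> h; have := det2_neq0 g; rewrite det2E h mulr0 subr0 mulf_eq0 negb_or => /andP[].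
Qed.

Definition diag2 (t1 t2 : k) : GL2 k := gl22 t1 0 0 t2.
(* The product of the Weyl element (0 1; -1 0) with the unipotent (1 z; 0 1). *)
Definition weyl_u (z : k) : GL2 k := gl22 0 1 (-1) (- z).
Definition unip_u (z : k) : GL2 k := gl22 1 z 0 1.

Lemma weyl_u_det z : 0 * - z - 1 * -1 != 0 :> k.
Proof. by rewrite mul0r sub0r mulrN1 opprK oner_neq0. Qed.
Lemma unip_u_det z : 1 * 1 - z * 0 != 0 :> k.
Proof. by rewrite mulr0 mulr1 subr0 oner_neq0. Qed.
Lemma diag2_det t1 t2 : t1 != 0 -> t2 != 0 -> t1 * t2 - 0 * 0 != 0 :> k.
Proof. by move=> h1 h2; rewrite mul0r subr0 mulf_neq0. Qed.

Lemma weyl_uE z g : [/\ (weyl_u z * g)%g 0 0 = g 1 0, (weyl_u z * g)%g 0 1 = g 1 1,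
  (weyl_u z * g)%g 1 0 = - (g 0 0 + z * g 1 0) &
  (weyl_u z * g)%g 1 1 = - (g 0 1 + z * g 1 1)].
Proof. by rewrite !GL2_mulE !(gl22E (weyl_u_det z)); split; ring. Qed.

Lemma weyl_uM z x : (weyl_u z * unip_u x)%g = weyl_u (z + x).
Proof.
have [e1 e2 e3 e4] := weyl_uE z (unip_u x).
have E1 := gl22E (unip_u_det x); have E2 := gl22E (weyl_u_det (z + x)).
by apply: GL2_eq; rewrite ?(e1, e2, e3, e4) E2 !E1; ring.
Qed.

Lemma diag2E t1 t2 g : t1 != 0 -> t2 != 0 ->
  [/\ (diag2 t1 t2 * g)%g 0 0 = t1 * g 0 0, (diag2 t1 t2 * g)%g 0 1 = t1 * g 0 1,
  (diag2 t1 t2 * g)%g 1 0 = t2 * g 1 0 & (diag2 t1 t2 * g)%g 1 1 = t2 * g 1 1].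
Proof.
by move=> h1 h2; rewrite !GL2_mulE !(gl22E (diag2_det h1 h2)); split; ring.
Qed.

Lemma det_weyl_u z : det2 (weyl_u z) = 1.
Proof. by rewrite det2E !(gl22E (weyl_u_det z)); ring. Qed.
Lemma det_diag2 t1 t2 : t1 != 0 -> t2 != 0 -> det2 (diag2 t1 t2) = t1 * t2.
Proof. by move=> h1 h2; rewrite det2E !(gl22E (diag2_det h1 h2)); ring. Qed.
Lemma unip_u_unip z : unip2 (unip_u z).
Proof. by split; rewrite (gl22E (unip_u_det z)). Qed.

Lemma unip2_u (u : GL2 k) : unip2 u -> u = unip_u (u 0 1).
Proof. by case=> h0 h1 h2; apply: GL2_eq; rewrite (gl22E (unip_u_det _)). Qed.

Lemma unip2_det (u : GL2 k) : unip2 u -> det2 u = 1.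
Proof. by case=> h0 h1 h2; rewrite det2E h0 h1 h2; ring. Qed.

End GL2Field.

(** * Hecke operators as averages of left translations *)

Section Averages.
Variables (k : finFieldType) (E : fieldType).
Implicit Types (a b g : GL2 k) (phi : GL2 k -> E).

Definition unip_inv phi := forall u b, unip2 u -> phi (u * b)%g = phi b.

(** The determinant and the bottom row form a complete set of invariants of the cosets [U b]. *)
Lemma unip_inv_eq phi a b : unip_inv phi ->
  a 1 0 = b 1 0 -> a 1 1 = b 1 1 -> det2 a = det2 b -> phi a = phi b.
Proof.
move=> inv h0 h1 hd; rewrite -[a](mulgVK b) inv //.
set u := (a * b^-1)%g; have eu : (u * b)%g = a by exact: mulgVK.
have row1 j : u 1 j = (1%g : GL2 k) 1 j.
  by rewrite /u -(mulgV b) !GL2_mulE h0 h1.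
have b10 : u 1 0 = 0 by rewrite row1 GL2_1E.
have b11 : u 1 1 = 1 by rewrite row1 GL2_1E.
split=> //; have := det2M u b; rewrite eu hd -{1}[det2 b]mul1r.
by move/(mulIf (det2_neq0 b)); rewrite det2E b10 b11 mulr1 mulr0 subr0.
Qed.

Definition avg_fun (s : seq (E * GL2 k)) phi b : E := \sum_(x <- s) x.1 * phi (x.2 * b)%g.

(** A weighted sum of left translations need not preserve left invariance. The condition is stated
    over the finite group, where it is easy to check, and makes [s] define a Hecke operator for
    every [level]. *)
Definition avg_ok (s : seq (E * GL2 k)) := forall phi, unip_inv phi -> unip_inv (avg_fun s phi).

Definition weyl_seq : seq (E * GL2 k) := [seq (1, weyl_u z) | z <- enum k].

Lemma avg_weyl phi b : avg_fun weyl_seq phi b = \sum_(z : k) phi (weyl_u z * b)%g.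
Proof.
by rewrite /avg_fun big_map big_enum; apply: eq_bigr => z _; rewrite mul1r.
Qed.

Lemma weyl_ok : avg_ok weyl_seq.
Proof.
move=> phi inv u b /unip2_u ->; move: (u 0 1) => x.
rewrite !avg_weyl [RHS](reindex_inj (addIr x)) /=.
by apply: eq_bigr => z _; rewrite mulgA weyl_uM.
Qed.

Definition unit_seq : seq k := [seq t <- enum k | t != 0].

Definition torus_seq (c : k -> k -> E) : seq (E * GL2 k) :=
  [seq (c t1 t2, diag2 t1 t2) | t1 <- unit_seq, t2 <- unit_seq].

Lemma avg_torus c phi b : avg_fun (torus_seq c) phi b =
  \sum_(t1 : k | t1 != 0) \sum_(t2 : k | t2 != 0) c t1 t2 * phi (diag2 t1 t2 * b)%g.
Proof.
rewrite /avg_fun /torus_seq big_allpairs_dep /= /unit_seq big_filter big_enum_cond /=.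
by apply: eq_bigr => t1 _; rewrite big_filter big_enum_cond.
Qed.

Lemma torus_ok c : avg_ok (torus_seq c).
Proof.
move=> phi inv u b hu; rewrite !avg_torus.
apply: eq_bigr => t1 h1; apply: eq_bigr => t2 h2; congr (_ * _).
have [u0 u1 u2] := hu.
apply: unip_inv_eq => //; last by rewrite !det2M (unip2_det hu) mul1r.
  have [_ _ -> _] := diag2E (u * b)%g h1 h2; have [_ _ -> _] := diag2E b h1 h2.
  by rewrite GL2_mulE u0 u2; ring.
have [_ _ _ ->] := diag2E (u * b)%g h1 h2; have [_ _ _ ->] := diag2E b h1 h2.
by rewrite GL2_mulE u0 u2; ring.
Qed.

End Averages.

Section IndChar.
Variables (Gm : groupType) (J1 J : set Gm) (hp : hecke_pair J1 J) (E : fieldType).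
Local Notation one_J := (ind_char hp E 1%g).

Lemma ind_char1E x : one_J x = `[< J x >]%:R.
Proof.
rewrite /=; congr (_%:R); congr nat_of_bool; apply: asbool_equiv_eq.
by split=> [[j Jj ->]|Jx]; [rewrite mulg1|exists x; rewrite ?mulg1].
Qed.

Lemma ind_char_gen (P : ind J E -> Prop) :
    P 0 -> (forall c f f', P f -> P f' -> P (c *: f + f')) ->
    (forall x, P (rtrans x one_J)) -> forall f, P f.
Proof.
move=> P0 PD P1 f; have [_ [t]] := indP f.
elim: t f => [|y t IH] f hf.
  suff -> : f = 0 by [].
  by apply: ind_inj => x; apply/eqP/negPn/negP => /hf[j [y [_]]].
pose g := rtrans y^-1%g one_J.
have -> : f = (f y : E) *: g + (f - (f y : E) *: g) by rewrite addrC subrK.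
apply: PD; first exact: P1.
apply: IH => x.
have -> : (f - (f y : E) *: g) x = f x - f y * `[< J (x * y^-1)%g >]%:R.
  by rewrite -ind_char1E.
case: asboolP => [Jx|nJ].
  by rewrite -{1}[x](mulgVK y) (indP f).1 // mulr1 subrr eqxx.
rewrite mulr0 subr0 => /hf[j [w [Jj]]]; rewrite inE => /orP[/eqP -> e|wt ->].
  by case: nJ; rewrite e mulgK.
by exists j, w.
Qed.

End IndChar.

(* A presentation of [GL2 k] as a quotient of a subgroup [lv_grp] in which [J] is
   the preimage of the unipotent subgroup. The last condition says that the
   intersection of a conjugate of [J] with [lv_grp] covers a conjugate of the
   unipotent subgroup. *)
Record level (k : finFieldType) (Gm : groupType) (J : set Gm) := Level {
  lv_grp : set Gm;
  lv_red : Gm -> GL2 k;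
  lv_lift : GL2 k -> Gm;
  lv_1 : lv_grp 1%g;
  lv_M : forall x y, lv_grp x -> lv_grp y -> lv_grp (x * y)%g;
  lv_V : forall x, lv_grp x -> lv_grp x^-1%g;
  lv_redM : forall x y, lv_grp x -> lv_grp y ->
    lv_red (x * y)%g = (lv_red x * lv_red y)%g;
  lv_liftP : forall a, lv_grp (lv_lift a);
  lv_liftK : forall a, lv_red (lv_lift a) = a;
  lv_J : forall x, J x <-> lv_grp x /\ unip2 (lv_red x);
  lv_unip : forall g, exists a, forall u, unip2 u ->
    exists t, [/\ lv_grp t, lv_red t = (a * u * a^-1)%g & J (g^-1 * t * g)%g]
}.

Section Level.
Variables (k : finFieldType) (E : fieldType) (Gm : groupType) (J : set Gm).
Variable lv : level k J.
Local Notation K := (lv_grp lv).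
Local Notation red := (lv_red lv).
Local Notation lft := (lv_lift lv).
Implicit Types (f : ind J E) (phi : GL2 k -> E).

Lemma red1 : red 1%g = 1%g.
Proof.
by apply: (mulgI (red 1%g)); rewrite -lv_redM ?mulg1 //; exact: lv_1.
Qed.

Lemma redV x : K x -> red x^-1%g = (red x)^-1%g.
Proof.
move=> Kx; apply: (mulgI (red x)); rewrite -lv_redM ?mulgV ?red1 //; exact: lv_V.
Qed.

Lemma lvJ_K x : J x -> K x. Proof. by case/(lv_J lv). Qed.
Lemma lvJ_unip x : J x -> unip2 (red x). Proof. by case/(lv_J lv). Qed.

Lemma lvJ_1 : J 1%g.
Proof. by apply/(lv_J lv); rewrite red1; split; [exact: lv_1|exact: unip2_1]. Qed.

Lemma lvJ_M x y : J x -> J y -> J (x * y)%g.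
Proof.
move=> /(lv_J lv)[Kx ux] /(lv_J lv)[Ky uy]; apply/(lv_J lv); split.
  exact: lv_M.
by rewrite lv_redM //; exact: unip2_M.
Qed.

Lemma lvJ_V x : J x -> J x^-1%g.
Proof.
move=> /(lv_J lv)[Kx ux]; apply/(lv_J lv); split; first exact: lv_V.
by rewrite redV //; exact: unip2_V.
Qed.

Lemma lvJ_div x y : K x -> K y -> red x = red y -> J (x * y^-1)%g.
Proof.
move=> Kx Ky e; have KV := lv_V Ky; apply/(lv_J lv); split; first exact: lv_M.
rewrite lv_redM // redV // e mulgV; exact: unip2_1.
Qed.

Lemma lv_left_inv f x y g : K x -> K y -> red x = red y -> f (x * g)%g = f (y * g)%g.
Proof.
by move=> Kx Ky e; rewrite -[x](mulgVK y) -mulgA [LHS](indP f).1 //; exact: (lvJ_div Kx Ky e).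
Qed.

Lemma level_pair : hecke_pair J J.
Proof.
split=> //; [exact: lvJ_1|exact: lvJ_M|exact: lvJ_V| |].
  by exists [:: 1%g] => x Jx; exists x, 1%g; rewrite inE mulg1.
move=> t g Jt; exists t, 1%g; rewrite mulg1; split=> //; exact: lvJ_1.
Qed.

Definition loc (x : Gm) f : GL2 k -> E := fun a => f (lft a * x)%g.

Lemma loc_K x f g : K g -> f (g * x)%g = loc x f (red g).
Proof. by move=> Kg; apply: lv_left_inv => //; [exact: lv_liftP|rewrite lv_liftK]. Qed.

Lemma loc_unip x f : unip_inv (loc x f).
Proof.
move=> u b hu; have Kl := lv_liftP lv; rewrite /loc.
rewrite (@lv_left_inv _ _ (lft u * lft b)%g) //; first last.
- by rewrite lv_redM // !lv_liftK.
- exact: lv_M.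
by rewrite -mulgA [LHS](indP f).1 //; apply/(lv_J lv); rewrite lv_liftK.
Qed.

Section Avg.
Variable s : seq (E * GL2 k).
Hypothesis ok : avg_ok s.

Definition avg_val f (g : Gm) : E := \sum_(x <- s) x.1 * f (lft x.2 * g)%g.

Lemma avg_valE f x a : avg_val f (lft a * x)%g = avg_fun s (loc x f) a.
Proof.
apply: eq_bigr => -[c b] _ /=; congr (_ * _); have Kl := lv_liftP lv.
rewrite mulgA; apply: lv_left_inv => //; first exact: lv_M.
by rewrite lv_redM // !lv_liftK.
Qed.

Lemma avg_val_K f x g : K g -> avg_val f (g * x)%g = avg_fun s (loc x f) (red g).
Proof.
move=> Kg; rewrite -avg_valE; apply: eq_bigr => -[c b] _ /=; congr (_ * _).
have Kl := lv_liftP lv; rewrite !mulgA; apply: lv_left_inv; try exact: lv_M.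
by rewrite !lv_redM // !lv_liftK.
Qed.

Fact avg_subproof f : (avg_val f : Gm -> E^o) \in @ind_pred Gm J E.
Proof.
have [li [t ft]] := indP f; have Kl := lv_liftP lv.
apply/asboolP; split=> [j x Jj|].
  have Kj := lvJ_K Jj; rewrite avg_val_K // -[x in RHS]mul1g avg_val_K; last exact: lv_1.
  by rewrite -[red j]mulg1 red1; apply: (ok (loc_unip x f)); exact: lvJ_unip.
(* Modulo [J] on the left, [(lft a)^-1 * j] depends only on its reduction [a^-1 * red j], and
   [red j] is one of the finitely many [unip_u z]. *)
pose t' (a : GL2 k) (z : k) := [seq (lft (a^-1 * unip_u z) * y)%g | y <- t].
exists (flatten [seq flatten [seq t' c.2 z | z <- enum k] | c <- s]) => x nz.
have [[c a] cs fa] : exists2 c, c \in s & f (lft c.2 * x)%g != 0.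
  apply/hasP; apply: contra_neqT nz => /hasPn h; rewrite /avg_val big_seq big1 //.
  by move=> c /h /negPn/eqP ->; rewrite mulr0.
have [j [y [Jj yt e]]] := ft _ fa; have Kj := lvJ_K Jj.
have Kk : K ((lft a)^-1 * j)%g by apply: lv_M => //; exact: lv_V.
have rk : red ((lft a)^-1 * j)%g = (a^-1 * red j)%g.
  by rewrite lv_redM //; [rewrite redV // lv_liftK|exact: lv_V].
exists ((lft a)^-1 * j * (lft (a^-1 * red j))^-1)%g, (lft (a^-1 * red j) * y)%g.
split; last by rewrite mulgA mulgVK -mulgA -e mulKg.
  by apply: (lvJ_div Kk) => //; rewrite lv_liftK.
apply/flattenP; exists (flatten [seq t' a z | z <- enum k]).
  by apply/mapP; exists (c, a).
apply/flattenP; exists (t' a (red j 0 1)).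
  by apply/mapP; exists (red j 0 1); rewrite ?mem_enum.
by apply/mapP; exists y => //; rewrite -(unip2_u (lvJ_unip Jj)).
Qed.

Definition avg_ind f : ind J E := Ind (avg_subproof f).

Fact avg_equivariant :
  avg_ind \in equivariant_pred (fun g : Gm => rtrans g : {linear ind J E -> ind J E}).
Proof.
apply/asboolP; split=> [a f1 f2|g f]; apply: ind_inj => x /=.
  rewrite !fctE /= /avg_val scaler_sumr -big_split /=.
  by apply: eq_bigr => y _; rewrite mulrDr mulrCA.
by apply: eq_bigr => y _; rewrite mulgA.
Qed.
Definition avg : hecke J E := EndG avg_equivariant.

Lemma loc_avg x f : loc x (avg f) =1 avg_fun s (loc x f).
Proof. by move=> a; rewrite -avg_valE. Qed.

End Avg.

Section LeftTranslation.
Variable n : Gm.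
Hypothesis nJ : forall j, J (n * j * n^-1)%g <-> J j.

Fact ltrans_subproof f : (fun g => f (n * g)%g : E^o) \in @ind_pred Gm J E.
Proof.
have [li [t ft]] := indP f; apply/asboolP; split=> [j x Jj|].
  by rewrite -[RHS](li (n * j * n^-1)%g) ?nJ // !mulgA mulgVK.
exists [seq (n^-1 * y)%g | y <- t] => x /ft[j [y [Jj yt e]]].
exists (n^-1 * j * n)%g, (n^-1 * y)%g; split.
- by apply/nJ; rewrite !mulgA mulgV mul1g mulgK.
- by apply/mapP; exists y.
- by rewrite !mulgA mulgK -mulgA -e mulKg.
Qed.

Definition ltrans_ind f : ind J E := Ind (ltrans_subproof f).

Fact ltrans_equivariant :
  ltrans_ind \in equivariant_pred (fun g : Gm => rtrans g : {linear ind J E -> ind J E}).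
Proof.
apply/asboolP; split=> [a f1 f2|g f]; apply: ind_inj => x //=.
by rewrite mulgA.
Qed.
Definition ltrans : hecke J E := EndG ltrans_equivariant.

End LeftTranslation.

Fact hscal_equivariant (c : E) : (fun f : ind J E => c *: f)
  \in equivariant_pred (fun g : Gm => rtrans g : {linear ind J E -> ind J E}).
Proof.
apply/asboolP; split=> [a f1 f2|g f]; last by rewrite linearZ.
by rewrite scalerDr !scalerA mulrC.
Qed.
Definition hscal c : hecke J E := EndG (hscal_equivariant c).

Definition ind1 : ind J E := ind_char level_pair E 1%g.

Lemma ind1E x : ind1 x = `[< J x >]%:R. Proof. exact: ind_char1E. Qed.

Lemma ind_gen (P : ind J E -> Prop) :
    P 0 -> (forall c f f', P f -> P f' -> P (c *: f + f')) ->
    (forall x, P (rtrans x ind1)) -> forall f, P f.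
Proof. exact: ind_char_gen. Qed.

Lemma hecke_eq0 (h : hecke J E) : h ind1 = 0 -> h = 0.
Proof.
move=> h0; have [hl hc] := endGP h.
have hz : h 0 = 0 by have := hl (-1) 0 0; rewrite scaler0 addr0 scaleN1r addNr.
apply: endG_inj; apply: ind_gen => //= [c f f' e e'|x].
  by rewrite hl e e' scaler0 addr0.
by rewrite hc h0 linear0.
Qed.

End Level.

(** * Power sums over a finite field *)

Section PowerSums.
Variables (k : finFieldType) (p : nat).
Hypothesis kp : p \in [pchar k].
Local Notation n := (#|k|.-1).

Lemma card_k : #|k| = n.+1.
Proof. by rewrite prednK //; apply/card_gt0P; exists 0. Qed.

Lemma expf_n (x : k) : x != 0 -> x ^+ n = 1.
Proof. by move=> x0; apply: (mulfI x0); rewrite -exprS -card_k expf_card mulr1. Qed.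

Lemma n_gt0 : (0 < n)%N.
Proof. by have := finNzRing_gt1 k; rewrite card_k ltnS. Qed.

Lemma natr_card_k : (#|k|%:R = 0 :> k).
Proof.
have : \sum_(x : k) (x + 1) = \sum_(x : k) x.
  by rewrite [RHS](reindex_inj (addIr 1)).
by rewrite big_split /= sumr_const => /eqP; rewrite -subr_eq0 addrAC subrr add0r => /eqP.
Qed.

Lemma natr_n : (n%:R = -1 :> k).
Proof. by apply/eqP; rewrite -subr_eq0 opprK -mulrSr -card_k natr_card_k. Qed.

Lemma dvd_p_card : (p %| #|k|)%N.
Proof. by rewrite (dvdn_pcharf kp) natr_card_k. Qed.

Lemma exp_neq1 i : (0 < i < n)%N -> exists2 g : k, g != 0 & g ^+ i != 1.
Proof.
move=> /andP[i0 iN]; apply/exists_inP; apply: contraLR iN => /exists_inPn h.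
rewrite -leqNgt; pose P : {poly k} := 'X^i - 1%:P.
have sP : size P = i.+1 by rewrite size_XnsubC.
have P0 : P != 0 by rewrite -size_poly_eq0 sP.
have := @max_poly_roots _ P (enum (predC1 (0 : k))) P0.
rewrite enum_uniq -cardE cardC1 sP ltnS; apply=> //.
apply/allP => x; rewrite mem_enum /= => x0.
by rewrite /root !hornerE subr_eq0; have /negPn := h x x0.
Qed.

(** Replacing [z] by [g * z] multiplies the sum by [g ^+ i], which is not 1 for some [g]. For
    [i = 0] the convention [0 ^+ 0 = 1] makes the sum equal to [q], which is 0 in [k]. *)
Lemma psum_lt i : (i < n)%N -> \sum_(z : k) z ^+ i = 0.
Proof.
case: i => [|i] iN.
  under eq_bigr => z _ do rewrite expr0.
  by rewrite sumr_const natr_card_k.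
have [g g0 g1] := @exp_neq1 i.+1 iN.
apply: (mulfI (x := g ^+ i.+1 - 1)); first by rewrite subr_eq0.
rewrite mulr0 mulrBl mul1r mulr_sumr [X in _ - X](reindex_inj (mulfI g0)) /=.
by apply/eqP; rewrite subr_eq0; apply/eqP/eq_bigr => z _; rewrite exprMn.
Qed.

Lemma sum_nz (N : zmodType) (F : k -> N) : \sum_(z | z != 0) F z = \sum_z F z - F 0.
Proof. by rewrite [X in X - _](bigD1 0) //= addrC addrK. Qed.

Lemma psum_nz i : \sum_(z : k | z != 0) z ^+ i = - (n %| i)%N%:R.
Proof.
have e : \sum_(z : k | z != 0) z ^+ i = \sum_(z : k | z != 0) z ^+ (i %% n).
  apply: eq_bigr => z z0.
  by rewrite {1}(divn_eq i n) exprD mulnC exprM expf_n // expr1n mul1r.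
rewrite e sum_nz psum_lt ?ltn_mod ?n_gt0 // sub0r /dvdn.
by case: (_ %% n)%N => [|j]; rewrite ?expr0 ?expr0n ?eqxx.
Qed.

Lemma psum i : \sum_(z : k) z ^+ i = - ((0 < i) && (n %| i))%N%:R.
Proof.
case: i => [|i]; first by rewrite psum_lt ?n_gt0 // oppr0.
by rewrite -psum_nz sum_nz expr0n subr0.
Qed.

Lemma psum_poly (P : {poly k}) : (size P <= n)%N -> \sum_(z : k) P.[z] = 0.
Proof.
move=> sP; under eq_bigr => z _ do rewrite horner_coef.
rewrite exchange_big big1 //= => i _; rewrite -mulr_sumr psum_lt ?mulr0 //.
exact: leq_trans sP.
Qed.

End PowerSums.

Section FiniteLevel.
Variable (k : finFieldType).

Fact fin_level_subproof (g : GL2 k) : exists a, forall u, unip2 u ->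
  exists t, [/\ [set: GL2 k] t, t = (a * u * a^-1)%g & unip2 (g^-1 * t * g)%g].
Proof.
by exists g => u hu; exists (g * u * g^-1)%g; rewrite !mulgA mulgVK mulVg mul1g.
Qed.

(** Kept transparent: later proofs use by conversion that the group is everything and that [lv_red]
    and [lv_lift] are the identity. *)
Definition fin_level : level k (@unip2 k).
Proof.
apply: (@Level k _ _ [set: GL2 k] id id) => //; first by move=> x; split=> [|[]].
exact: fin_level_subproof.
Defined.

End FiniteLevel.

(** * Extension by zero from the group of a level *)

Section Extension.
Variables (k : finFieldType) (E : fieldType) (Gm : groupType) (J : set Gm).
Variable lv : level k J.
Local Notation K := (lv_grp lv).
Local Notation red := (lv_red lv).
Local Notation lft := (lv_lift lv).
Local Notation C := (ind (@unip2 k) E).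
Local Notation lvf := (fin_level k).
Implicit Types (c : C) (f : ind J E).

Lemma unip_inv_ind c : unip_inv c.
Proof. by move=> u b hu; exact: (indP c).1. Qed.

Definition mkC (phi : GL2 k -> E) (h : unip_inv phi) : C :=
  Ind ((ind_unip2P (phi : GL2 k -> E^o)).2 (fun j x hj => h j x hj)).

(** It identifies [C] with the functions in [ind J E] supported on [K]; their right translates span
    [ind J E], since [ind1] is among them by [ext_ind1]. *)
Definition ext_val c g : E := if pselect (K g) then c (red g) else 0.

Lemma ext_valK c g : K g -> ext_val c g = c (red g).
Proof. by rewrite /ext_val; case: pselect. Qed.

Lemma ext_valN c g : ~ K g -> ext_val c g = 0.
Proof. by rewrite /ext_val; case: pselect. Qed.

Fact ext_subproof c : (ext_val c : Gm -> E^o) \in @ind_pred Gm J E.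
Proof.
apply/asboolP; split=> [j x Jj|].
  have [Kj uj] := (lv_J lv j).1 Jj.
  have [Kx|nKx] := pselect (K x).
    by rewrite !ext_valK ?lv_redM ?(indP c).1 //; exact: lv_M.
  rewrite !ext_valN // => Kjx; apply: nKx; rewrite -(mulKg j x).
  by apply: lv_M => //; exact: lv_V.
have [_ [t ft]] := indP c; exists (map lft t) => x.
have [Kx|nKx] := pselect (K x); last by rewrite ext_valN // eqxx.
rewrite ext_valK // => /ft[j [y [uj yt e]]]; exists (x * (lft y)^-1)%g, (lft y); split.
- have Kl := lv_liftP lv y; apply/(lv_J lv); split; first by apply: lv_M => //; exact: lv_V.
  by rewrite lv_redM // ?redV // ?e ?lv_liftK ?mulgK //; exact: lv_V.
- by apply/mapP; exists y.
- by rewrite mulgVK.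
Qed.
Definition ext c : ind J E := Ind (ext_subproof c).

Lemma ext_K c g : K g -> ext c g = c (red g).
Proof. exact: ext_valK. Qed.

Lemma ext_nK c g : ~ K g -> ext c g = 0.
Proof. exact: ext_valN. Qed.

Lemma ext_eq c f : (forall g, K g -> f g = c (red g)) -> (forall g, ~ K g -> f g = 0) ->
  f = ext c.
Proof.
move=> h1 h2; apply: ind_inj => g.
by have [Kg|nKg] := pselect (K g); [rewrite ext_K ?h1|rewrite ext_nK ?h2].
Qed.

Fact ext_linear : linear ext.
Proof.
move=> a c c'; apply/esym/ext_eq => g Kg.
  by rewrite -[LHS]/(a * ext c g + ext c' g) !ext_K.
by rewrite -[LHS]/(a * ext c g + ext c' g) !ext_nK // mulr0 addr0.
Qed.
HB.instance Definition _ := GRing.isLinear.Build _ _ _ _ ext ext_linear.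

Lemma ext_rtrans x c : K x -> ext (rtrans (red x) c) = rtrans x (ext c).
Proof.
move=> Kx; apply/esym/ext_eq => g Kg.
  by rewrite -[LHS]/(ext c (g * x)%g) ext_K ?lv_redM //; exact: lv_M.
rewrite -[LHS]/(ext c (g * x)%g) ext_nK // => Kgx; apply: Kg.
by rewrite -(mulgK x g); apply: lv_M => //; exact: lv_V.
Qed.

Lemma ext_avg s (ok : avg_ok s) c : ext (avg lvf ok c) = avg lv ok (ext c).
Proof.
apply/esym/ext_eq => g Kg.
  rewrite -[g in LHS]mulg1 /= avg_val_K //; apply: eq_bigr => -[x a] _ /=.
  by congr (_ * _); rewrite /loc /= mulg1 ext_valK ?lv_liftK //; exact: lv_liftP.
rewrite /= /avg_val big1 // => -[x a] _ /=; rewrite ext_valN ?mulr0 //.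
have Kl := lv_liftP lv a; move=> Kag; apply: Kg.
by rewrite -(mulKg (lft a) g); apply: lv_M => //; exact: lv_V.
Qed.

Lemma ext_ind1 : ext (ind1 E lvf) = ind1 E lv.
Proof.
apply/esym/ext_eq => g Kg; rewrite ?ind1E; last first.
  by case: asboolP => // /(lv_J lv)[].
congr (_%:R); congr nat_of_bool; apply: asbool_equiv_eq; rewrite (lv_J lv).
by split=> [[]|].
Qed.

End Extension.

(** * Failure of flatness when q is not p *)

Section Nonflat.
Variables (k : finFieldType) (E : fieldType) (iota : {rmorphism k -> E}).
Variable p : nat.
Hypothesis kp : p \in [pchar k].
Hypothesis pk : (p.+2 <= #|k|)%N.
Local Notation n := (#|k|.-1).
Implicit Types (phi : GL2 k -> E) (b : GL2 k).

Let p_lt : (p < n)%N. Proof. by have := pk; rewrite (card_k k). Qed.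
Let p_gt0 : (0 < p)%N. Proof. by rewrite prime_gt0 // (pcharf_prime kp). Qed.

(* The isotypic part on which diag(1/t, t) acts by t^p. *)
Definition deg_p phi b : E :=
  \sum_(t : k | t != 0) iota t ^- p * phi (diag2 (t^-1)%R t * b)%g.

Definition row_additive phi := forall b b1 b2,
  det2 b1 = det2 b -> det2 b2 = det2 b ->
  b 1 0 = b1 1 0 + b2 1 0 -> b 1 1 = b1 1 1 + b2 1 1 ->
  deg_p phi b = deg_p phi b1 + deg_p phi b2.

Lemma row_additive_trans phi a : row_additive phi -> row_additive (fun b => phi (b * a)%g).
Proof.
move=> h b b1 b2 d1 d2 e0 e1.
have E0 x : deg_p (fun b => phi (b * a)%g) x = deg_p phi (x * a)%g.
  by apply: eq_bigr => t _; rewrite mulgA.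
by rewrite !E0; apply: h; rewrite ?det2M ?d1 ?d2 // !GL2_mulE e0 e1; ring.
Qed.

Lemma row_additive0 : row_additive (fun=> 0).
Proof.
move=> b b1 b2 *; rewrite /deg_p !big1 ?addr0 // => t _; exact: mulr0.
Qed.

Lemma row_additiveD c phi phi' : row_additive phi -> row_additive phi' ->
  row_additive (fun b => c * phi b + phi' b).
Proof.
move=> h h' b b1 b2 d1 d2 e0 e1.
have E0 x : deg_p (fun b => c * phi b + phi' b) x = c * deg_p phi x + deg_p phi' x.
  rewrite /deg_p mulr_sumr -big_split /=; apply: eq_bigr => t _.
  by rewrite mulrDr mulrCA.
by rewrite !E0 (h b b1 b2) // (h' b b1 b2) //; ring.
Qed.

Lemma row_additive_eq phi phi' : phi =1 phi' -> row_additive phi -> row_additive phi'.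
Proof.
move=> e h b b1 b2 d1 d2 e0 e1.
have E0 x : deg_p phi' x = deg_p phi x by apply: eq_bigr => t _; rewrite e.
by rewrite !E0; apply: h.
Qed.

Lemma anti_det (x d : k) : x != 0 -> 0 * 0 - (- (d / x)) * x = d.
Proof. by move=> x0; rewrite mul0r sub0r mulNr opprK divfK. Qed.

Definition anti2 (x d : k) : GL2 k := gl22 0 (- (d / x)) x 0.

Lemma anti2E x d : x != 0 -> d != 0 -> [/\ anti2 x d 0 0 = 0,
  anti2 x d 0 1 = - (d / x), anti2 x d 1 0 = x, anti2 x d 1 1 = 0 & det2 (anti2 x d) = d].
Proof.
move=> x0 d0; have h : 0 * 0 - (- (d / x)) * x != 0 by rewrite anti_det.
by rewrite det2E !(gl22E h) anti_det.
Qed.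

(* On functions biinvariant under U, the vanishing of the Hecke operator of the
   Weyl element forces the part of degree p to be a multiple of [x ^ p]. *)
Lemma row_additive_ker phi : unip_inv phi ->
    (forall u b, unip2 u -> phi (b * u)%g = phi b) ->
    avg_fun (weyl_seq k E) phi =1 (fun=> 0) -> row_additive phi.
Proof.
move=> inv rinv ker.
(* By the Bruhat decomposition, [phi] is determined by its values at the matrices [anti2 x d] and at
   the diagonal matrices. *)
have FE b : b 1 0 != 0 -> phi b = phi (anti2 (b 1 0) (det2 b)).
  move=> x0; have [e1 e2 e3 e4 e5] := anti2E x0 (det2_neq0 b).
  rewrite -[RHS](rinv (unip_u (b 1 1 / b 1 0))); last exact: unip_u_unip.
  apply: unip_inv_eq => //; rewrite ?det2M ?e5 ?(unip2_det (unip_u_unip _)) ?mulr1 //.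
    by rewrite GL2_mulE e3 e4 !(gl22E (unip_u_det _)); ring.
  by rewrite GL2_mulE e3 e4 !(gl22E (unip_u_det _)); field.
have GE b : b 1 0 = 0 -> phi b = phi (diag2 (det2 b / b 1 1) (b 1 1)).
  move=> x0; have y0 := bottom_neq0 x0; have d0 := det2_neq0 b.
  have z0 : det2 b / b 1 1 != 0 by rewrite mulf_neq0 ?invr_eq0.
  by apply: unip_inv_eq; rewrite ?det_diag2 ?divfK // /diag2 (gl22E (diag2_det z0 y0)).
pose S d := \sum_(x : k | x != 0) phi (anti2 x d).
(* In the vanishing sum at [anti2 x d] the term [z = 0] is the value at [diag2 x y] and the other
   terms add up to [S d]. So the values at diagonal matrices depend on the determinant only. *)
have GS d y : d != 0 -> y != 0 -> phi (diag2 (d / y) y) = - S d.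
  move=> d0 y0; pose x := d / y.
  have x0 : x != 0 by rewrite mulf_neq0 ?invr_eq0.
  have [e1 e2 e3 e4 e5] := anti2E x0 d0.
  have /= := ker (anti2 x d); rewrite avg_weyl (bigD1 0) //= => h.
  apply/eqP; rewrite -subr_eq0 opprK -[X in _ == X]h; apply/eqP; congr (_ + _).
    have [_ _ w1 w2] := weyl_uE 0 (anti2 x d).
    rewrite [RHS]GE; last by rewrite w1 e1 e3; ring.
    rewrite w2 e2 e4 det2M det_weyl_u e5 mul1r.
    by congr (phi (diag2 (_ / _) _)); rewrite /x; field; rewrite y0 d0.
  rewrite /S (reindex_onto (fun z => - (z * x)) (fun t => - t / x)); last first.
    by move=> t t0; rewrite divfK // opprK.
  apply: eq_big => z.
    by rewrite /= oppr_eq0 mulf_eq0 (negPf x0) orbF opprK mulfK // eqxx andbT.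
  rewrite /= oppr_eq0 mulf_eq0 (negPf x0) orbF => /andP[z0 _].
  have [_ _ w1 w2] := weyl_uE z (anti2 x d).
  rewrite [RHS]FE; last by rewrite w1 e1 e3 add0r oppr_eq0 mulf_neq0.
  rewrite w1 e1 e3 add0r.
  by rewrite det2M det_weyl_u e5 mul1r.
(* The part of degree [p] is [x^p] times a function of the determinant. At [x = 0] this holds
   because the sum of the [t^p] vanishes, as [0 < p < q - 1]. Additivity is then that of
   Frobenius. *)
have degE b : deg_p phi b = iota (b 1 0) ^+ p *
    (\sum_(t : k | t != 0) iota t ^- p * phi (anti2 t (det2 b))).
  have d0 := det2_neq0 b.
  have [x0|x0] := eqVneq (b 1 0) 0.
    rewrite x0 rmorph0 expr0n eqn0Ngt p_gt0 mul0r /deg_p.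
    have y0 := bottom_neq0 x0.
    rewrite (eq_bigr (fun t => iota (t^-1 ^+ p) * - S (det2 b))); last first.
      move=> t t0; rewrite rmorphXn fmorphV exprVn; congr (_ * _).
      have ti0 : t^-1 != 0 by rewrite invr_eq0.
      have [_ _ w1 w2] := diag2E b ti0 t0.
      rewrite GE ?w1 ?w2 ?x0 ?mulr0 //. rewrite det2M det_diag2 // mulVf // mul1r.
      by rewrite GS // mulf_neq0.
    rewrite -mulr_suml -rmorph_sum /=.
    rewrite (reindex_inj invr_inj) /= (eq_bigl (fun t => t != 0)); last first.
      by move=> t; rewrite invr_eq0.
    under eq_bigr => t _ do rewrite invrK.
    by rewrite sum_nz psum_lt // expr0n eqn0Ngt p_gt0 subr0 rmorph0 mul0r.
  rewrite /deg_p mulr_sumr [RHS](reindex_onto (fun t => t * b 1 0) (fun t => t / b 1 0)).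
    apply: eq_big => t; first by rewrite mulf_eq0 (negPf x0) orbF mulfK // eqxx andbT.
    move=> t0; have ti0 : t^-1 != 0 by rewrite invr_eq0.
    have [_ _ w1 w2] := diag2E b ti0 t0.
    rewrite FE ?w1 ?mulf_neq0 // det2M det_diag2 // mulVf // mul1r.
    rewrite mulrA; congr (_ * _); rewrite rmorphM exprMn; field.
    by rewrite !expf_neq0 ?fmorph_eq0.
  by move=> t t0; rewrite divfK.
move=> b b1 b2 d1 d2 e0 e1; rewrite !degE d1 d2 -mulrDl; congr (_ * _).
have cE : p \in [pchar E] by rewrite (fmorph_pchar iota).
by rewrite e0 rmorphD -!(pFrobenius_autE cE) rmorphD.
Qed.

(* The monomial x^(p-1) y in the entries x, y of the bottom row. *)
Definition mono_p b : E := iota (b 1 0) ^+ p.-1 * iota (b 1 1).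

Lemma mono_p_unip : unip_inv mono_p.
Proof.
move=> u b [u0 u1 u2].
by rewrite /mono_p !GL2_mulE u0 u2 !mul0r !add0r !mul1r.
Qed.

(** The bottom row of [weyl_u z * b] is affine in [z], so the values of a polynomial of degree at
    most [p] are summed over [k], and [p < q - 1]. *)
Lemma avg_mono_p b : avg_fun (weyl_seq k E) mono_p b = 0.
Proof.
pose l (x y : k) : {poly k} := - (x%:P + y%:P * 'X).
have sl x y : (size (l x y) <= 2)%N.
  rewrite size_polyN (leq_trans (size_polyD _ _)) // geq_max.
  rewrite (leq_trans (size_polyC_leq1 _)) //= (leq_trans (size_polyMleq _ _)) //.
  by rewrite size_polyX addn2 ltnS size_polyC_leq1.
pose L1 := l (b 0 0) (b 1 0); pose L2 := l (b 0 1) (b 1 1); pose P := L1 ^+ p.-1 * L2.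
have sP : (size P <= n)%N.
  apply: leq_trans p_lt; rewrite (leq_trans (size_polyMleq _ _)) //.
  have h1 : (size (L1 ^+ p.-1) <= p)%N.
    apply: (leq_trans (size_poly_exp_leq _ _)).
    have : ((size L1).-1 * p.-1 <= 1 * p.-1)%N.
      rewrite leq_mul //; have := sl (b 0 0) (b 1 0); rewrite -/L1.
      by case: (size L1) => [|[|[|m]]].
    by rewrite mul1n -ltnS prednK.
  have := leq_add h1 (sl _ _ : (size L2 <= 2)%N).
  by rewrite addn2; case: (_ + _)%N.
transitivity (iota (\sum_(z : k) P.[z])); last by rewrite psum_poly // rmorph0.
rewrite avg_weyl rmorph_sum.
apply: eq_bigr => z _; have [_ _ w1 w2] := weyl_uE z b.
by rewrite /mono_p w1 w2 !hornerE -rmorphXn -rmorphM /= ![_ * z]mulrC.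
Qed.

Lemma mono_p_nonadditive : ~ row_additive mono_p.
Proof.
have degE b : deg_p mono_p b = - mono_p b.
  rewrite /deg_p (eq_bigr (fun t => iota (t ^+ 0) * mono_p b)); last first.
    move=> t t0; have ti0 : t^-1 != 0 by rewrite invr_eq0.
    have [_ _ w1 w2] := diag2E b ti0 t0.
    have eT : iota t ^+ p = iota t * iota t ^+ p.-1 by rewrite -exprS prednK.
    rewrite /mono_p w1 w2 !rmorphM exprMn expr0 rmorph1 eT; field.
    by rewrite fmorph_eq0 t0 expf_neq0 // fmorph_eq0.
  by rewrite -mulr_suml -rmorph_sum psum_nz dvdn0 rmorphN rmorph1 mulN1r.
(* The row [(1, 1)] is the sum of [(1, 0)] and [(0, 1)], and [x^(p-1) y] takes the values 1, 0, 0 on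
   them. All three matrices have determinant 1. *)
move=> /(_ (gl22 0 (-1) 1 1) (gl22 0 (-1) 1 0) (gl22 1 0 0 1)).
have h1 : 0 * 1 - (-1) * 1 != 0 :> k by rewrite mul0r mulN1r opprK add0r oner_neq0.
have h2 : 0 * 0 - (-1) * 1 != 0 :> k by rewrite mul0r mulN1r opprK add0r oner_neq0.
have h3 : 1 * 1 - 0 * 0 != 0 :> k by rewrite mul0r subr0 mul1r oner_neq0.
rewrite !degE /mono_p !det2E !(gl22E h1, gl22E h2, gl22E h3).
have p1 : (p.-1 == 0)%N = false.
  by have := prime_gt1 (pcharf_prime kp); case: (p) => [|[]].
rewrite !(rmorph1, rmorph0, mulr0, mul0r, mulr1, mul1r, expr1n, oppr0, expr0n, p1, addr0).
rewrite !sub0r !opprK !add0r => /(_ erefl erefl erefl erefl)/eqP.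
by rewrite oppr_eq0 oner_eq0.
Qed.

Variables (Gm : groupType) (J : set Gm) (lv : level k J).

Definition weyl_op : hecke J E := avg lv (@weyl_ok k E).

(** By linearity [f] may be taken to be a translate of [ind1]. Then [a f] is a translate of
    [z = a ind1], which is invariant under [J] on both sides and killed by [weyl_op]. The condition
    [lv_unip] turns the right invariance of [z] into that of its localization at [x], up to a shift
    by [a1], and [row_additive_ker] applies. *)
Lemma row_additive_loc1 (a : hecke J E) (f : ind J E) :
  weyl_op * a = 0 -> row_additive (loc lv 1%g (a f)).
Proof.
move=> Ta; have [al ac] := endGP a.
have a0 : a 0 = 0 by have := al (-1) 0 0; rewrite scaler0 addr0 scaleN1r addNr.
apply: (ind_gen (lv := lv) (P := fun f => row_additive (loc lv 1%g (a f)))) => [|c g g' h h'|x].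
- by apply: row_additive_eq row_additive0 => b; rewrite /loc a0.
- by apply: row_additive_eq (row_additiveD c h h') => b; rewrite /loc al.
rewrite ac; set z := a _.
have zJ g j : J j -> z (g * j)%g = z g.
  move=> Jj; rewrite -[LHS]/(rtrans j z g) -ac; congr ((a _ : ind J E) g).
  apply: ind_inj => y; rewrite -[LHS]/(ind1 E lv (y * j)%g) !ind1E.
  congr (_%:R); congr nat_of_bool; apply: asbool_equiv_eq; split=> h.
    by rewrite -(mulgK j y); apply: (lvJ_M lv) => //; exact: (lvJ_V lv).
  exact: (lvJ_M lv).
have zT b : avg_fun (weyl_seq k E) (loc lv x z) b = 0.
  by rewrite -(@loc_avg _ _ _ _ lv _ (@weyl_ok k E)) -/weyl_op -[avg _ _ _]/((weyl_op * a) _) Ta.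
have [a1 ha1] := lv_unip lv x.
have e : loc lv 1%g (rtrans x z) =1 loc lv x z by move=> b; rewrite /loc /= mulg1.
apply: (row_additive_eq (fun b => esym (e b))).
apply: (@row_additive_eq (fun b => loc lv x z (b * a1 * a1^-1)%g)).
  by move=> b; rewrite mulgK.
apply: (row_additive_trans (phi := fun b => loc lv x z (b * a1^-1)%g)).
apply: row_additive_ker.
- by move=> u b hu; rewrite -mulgA; apply: loc_unip.
- move=> u b hu; have [t [Kt et Jt]] := ha1 u hu; have Kl := lv_liftP lv (b * a1^-1)%g.
  have -> : (b * u * a1^-1 = b * a1^-1 * lv_red lv t)%g by rewrite et !mulgA mulgVK.
  rewrite -[X in (X * _)%g](lv_liftK lv) -lv_redM // -loc_K; last exact: lv_M.
  by rewrite -[RHS](zJ _ _ Jt) !mulgA mulgK.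
- move=> b; rewrite -[RHS](zT (b * a1^-1)%g); apply: eq_bigr => y _.
  by rewrite mulgA.
Qed.

Lemma flat_contra : ~ flat (hecke J E) (ind_hecke J E).
Proof.
move=> fl; pose c0 : ind (@unip2 k) E := mkC mono_p_unip.
have T0 : weyl_op (ext lv c0) = 0.
  rewrite -ext_avg; set c := avg _ _ c0; suff -> : c = 0 by rewrite linear0.
  apply: ind_inj => b; rewrite -[RHS](avg_mono_p b).
  by apply: eq_bigr => x _.
have [s [hs e]] := flat_relation (M := ind_hecke J E) fl T0.
apply: mono_p_nonadditive.
apply: (@row_additive_eq (loc lv 1%g (ext lv c0))).
  move=> b; rewrite /loc mulg1 ext_K ?lv_liftK //; exact: lv_liftP.
have -> : ext lv c0 = \sum_(x <- s) x.1 x.2 by exact: e.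
have {}hs : all (fun x => weyl_op * x.1 == 0) s by apply/allP => x /hs ->.
elim: s hs {e} => [_|x s IH /= /andP[/eqP h1 /IH h2]].
  by apply: row_additive_eq row_additive0 => b; rewrite big_nil.
apply: row_additive_eq (row_additiveD 1 (row_additive_loc1 x.2 h1) h2) => b.
by rewrite big_cons mul1r.
Qed.

End Nonflat.

Lemma flat_card (k : finFieldType) (E : fieldType) (iota : {rmorphism k -> E}) (p : nat)
    (Gm : groupType) (J : set Gm) (lv : level k J) :
  p \in [pchar k] -> flat (hecke J E) (ind_hecke J E) -> #|k| = p.
Proof.
move=> kp fl; apply/eqP/negPn/negP => ne; apply: (flat_contra iota kp _ lv fl).
(* A nonzero multiple of [p] other than [p] is at least [p + p], hence at least [p + 2]. *)
have /dvdnP[m e] := dvd_p_card kp; have p1 := prime_gt1 (pcharf_prime kp).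
have k0 : (0 < #|k|)%N by rewrite card_k.
case: m e => [|[|m]] e; [by rewrite e in k0|by rewrite e mul1n eqxx in ne|].
rewrite e !mulSn addnA (@leq_trans (p + p)%N) ?leq_addr //.
by rewrite -addn2 leq_add2l.
Qed.

(** * Decomposition under the torus *)

Section Blocks.
Variables (k : finFieldType) (E : fieldType) (iota : {rmorphism k -> E}).
Local Notation n := (#|k|.-1).
Local Notation C := (ind (@unip2 k) E).
Local Notation H := (hecke (@unip2 k) E).
Implicit Types (P : k -> E) (g b u : GL2 k) (c : C) (r l : nat).

Lemma iota_n (x : k) : x != 0 -> iota x ^+ n = 1.
Proof. by move=> x0; rewrite -rmorphXn expf_n // rmorph1. Qed.

Lemma iota_mod (x : k) i : x != 0 -> iota x ^+ (i %% n) = iota x ^+ i.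
Proof.
move=> x0; rewrite [in RHS](divn_eq i n) exprD mulnC exprM iota_n //.
by rewrite expr1n mul1r.
Qed.

Lemma iota_eqmod (x : k) i j : x != 0 -> (i = j %[mod n])%N -> iota x ^+ i = iota x ^+ j.
Proof. by move=> x0 e; rewrite -iota_mod // e iota_mod. Qed.

Lemma iota_psum i : (0 < i)%N -> \sum_(z : k) iota z ^+ i = - (n %| i)%N%:R.
Proof.
move=> i0; under eq_bigr => z _ do rewrite -rmorphXn.
by rewrite -rmorph_sum psum i0 rmorphN rmorph_nat.
Qed.

(* The functions on which diag(t1, t2) acts on the left by (t1 t2)^l t2^r; they
   are determined by their values at the bottom rows (1, z) and (0, 1). *)
Definition blk_val r l P (a : E) g : E :=
  iota (det2 g) ^+ l * (if g 1 0 == 0 then iota (g 1 1) ^+ r * a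
                        else iota (g 1 0) ^+ r * P (g 1 1 / g 1 0)).

Lemma blk_unip r l P a : unip_inv (blk_val r l P a).
Proof.
move=> u b hu; have [u0 u1 u2] := hu; rewrite /blk_val det2M (unip2_det hu) mul1r.
by rewrite !GL2_mulE u0 u2 !mul0r !add0r !mul1r.
Qed.

Definition blk r l P a : C := mkC (@blk_unip r l P a).

Definition row1 (z : k) : GL2 k := gl22 0 (-1) 1 z.

Lemma row1_det z : 0 * z - (-1) * 1 != 0 :> k.
Proof. by rewrite mul0r mulN1r opprK add0r oner_neq0. Qed.

Lemma row1E z : [/\ row1 z 0 0 = 0, row1 z 0 1 = -1, row1 z 1 0 = 1, row1 z 1 1 = z &
  det2 (row1 z) = 1].
Proof. by rewrite det2E !(gl22E (row1_det z)); split=> //; ring. Qed.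

Lemma blk_row1 r l P a z : blk r l P a (row1 z) = P z.
Proof.
have [_ _ e0 e1 d] := row1E z.
by rewrite /= /blk_val d e0 e1 oner_eq0 rmorph1 !expr1n !mul1r divr1.
Qed.

Lemma det2_1 : det2 (1%g : GL2 k) = 1. Proof. exact: det1. Qed.

Lemma blk_1 r l P a : blk r l P a 1%g = a.
Proof. by rewrite /= /blk_val det2_1 !GL2_1E /= mulr0n mulr1n eqxx !rmorph1 !expr1n !mul1r. Qed.

Definition torus_eqv r l (phi : GL2 k -> E) := forall t1 t2 g, t1 != 0 -> t2 != 0 ->
  phi (diag2 t1 t2 * g)%g = iota (t1 * t2) ^+ l * iota t2 ^+ r * phi g.

Lemma blk_torus r l P a : torus_eqv r l (blk r l P a).
Proof.
move=> t1 t2 g h1 h2; have [_ _ w1 w2] := diag2E g h1 h2.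
rewrite /= /blk_val w1 w2 det2M det_diag2 // rmorphM exprMn mulf_eq0 (negPf h2) /=.
case: eqVneq => [e|ne]; rewrite !rmorphM !exprMn; first by ring.
have -> : t2 * g 1 1 / (t2 * g 1 0) = g 1 1 / g 1 0 by field; rewrite ?ne ?h2.
by ring.
Qed.

Lemma torus_eqv_inj r l (phi psi : GL2 k -> E) : unip_inv phi -> unip_inv psi ->
    torus_eqv r l phi -> torus_eqv r l psi ->
    (forall z, phi (row1 z) = psi (row1 z)) -> phi 1%g = psi 1%g ->
  phi =1 psi.
Proof.
move=> ip iq tp tq h1 h2 g; have d0 := det2_neq0 g.
have [x0|x0] := eqVneq (g 1 0) 0.
  have y0 := bottom_neq0 x0; pose d := diag2 (det2 g / g 1 1) (g 1 1).
  have z0 : det2 g / g 1 1 != 0 by rewrite mulf_neq0 ?invr_eq0.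
  have e (f : GL2 k -> E) : unip_inv f -> f g = f (d * 1%g)%g.
    move=> fi; apply: unip_inv_eq; rewrite ?mulg1 //.
    - by rewrite x0 !(gl22E (diag2_det z0 y0)).
    - by rewrite !(gl22E (diag2_det z0 y0)).
    - by rewrite det_diag2 // divfK.
  by rewrite !e // tp // tq // h2.
pose d := diag2 (det2 g / g 1 0) (g 1 0).
have z0 : det2 g / g 1 0 != 0 by rewrite mulf_neq0 ?invr_eq0.
pose z := g 1 1 / g 1 0.
have e (f : GL2 k -> E) : unip_inv f -> f g = f (d * row1 z)%g.
  move=> fi; have [_ _ w1 w2] := diag2E (row1 z) z0 x0.
  have [_ _ e0 e1 ed] := row1E z.
  apply: unip_inv_eq => //.
  - by rewrite /d w1 e0 mulr1.
  - by rewrite /d w2 e1 mulrC divfK.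
  - by rewrite det2M det_diag2 // ed mulr1 divfK.
by rewrite !e // tp // tq // h1.
Qed.

Lemma blk_of r l c : torus_eqv r l c -> c = blk r l (fun z => c (row1 z)) (c 1%g).
Proof.
move=> tc; apply: ind_inj; apply: (@torus_eqv_inj r l) => //.
- exact: unip_inv_ind.
- exact: blk_unip.
- exact: blk_torus.
- by move=> z; rewrite blk_row1.
- by rewrite blk_1.
Qed.

Lemma blk_eq r l P P' a a' : P =1 P' -> a = a' -> blk r l P a = blk r l P' a'.
Proof. by move=> /funext -> ->. Qed.

Lemma blkD r l x P P' a a' :
  blk r l (fun z => x * P z + P' z) (x * a + a') = x *: blk r l P a + blk r l P' a'.
Proof.
apply: ind_inj => g; rewrite -[RHS]/(x * blk_val r l P a g + blk_val r l P' a' g).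
by rewrite /= /blk_val; case: eqP => _; ring.
Qed.

Lemma blkZ r l x P a : blk r l (fun z => x * P z) (x * a) = x *: blk r l P a.
Proof.
apply: ind_inj => g; rewrite -[RHS]/(x * blk_val r l P a g).
by rewrite /= /blk_val; case: eqP => _; ring.
Qed.

Lemma blk0 r l : blk r l (fun=> 0) 0 = 0.
Proof.
by rewrite -[RHS](scale0r (blk r l (fun=> 0) 0)) -blkZ; apply: blk_eq => [z|]; rewrite mul0r.
Qed.

Lemma blk_sum r l (I : Type) (s : seq I) (Q : pred I) (P : I -> k -> E) (a : I -> E) :
  \sum_(i <- s | Q i) blk r l (P i) (a i) =
  blk r l (fun z => \sum_(i <- s | Q i) P i z) (\sum_(i <- s | Q i) a i).
Proof.
elim: s => [|i s IH].
  rewrite !big_nil -(blk0 r l); apply: blk_eq => // z; by rewrite big_nil.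
rewrite big_cons IH; case: ifP => Qi.
  rewrite -[blk r l (P i) _]scale1r -blkD.
  by apply: blk_eq => [z|]; rewrite big_cons Qi mul1r.
by apply: blk_eq => [z|]; rewrite big_cons Qi.
Qed.

Lemma blk_mod r r' l l' P a : (r = r' %[mod n])%N -> (l = l' %[mod n])%N ->
  blk r l P a = blk r' l' P a.
Proof.
move=> er el; apply: ind_inj => g; rewrite /= /blk_val.
rewrite (iota_eqmod (det2_neq0 g) el); congr (_ * _).
case: ifP => x0; rewrite (@iota_eqmod _ r r') //; last by rewrite x0.
exact/bottom_neq0/eqP.
Qed.

Definition weyl1 : H := avg (fin_level k) (@weyl_ok k E).

Lemma weyl1E c g : weyl1 c g = \sum_(z : k) c (weyl_u z * g)%g.
Proof. exact: avg_weyl. Qed.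

(** The Weyl element exchanges the torus entries, so the character [(t1 t2)^l t2^r] becomes
    [(t1 t2)^(l+r) t2^(-r)]; the exponent [-r] is represented by [n - r]. The term [a] comes from
    the one translate whose bottom row starts with 0. *)
Lemma weyl1_blk r l P a : (r < n)%N -> weyl1 (blk r l P a) =
  blk (n - r) (l + r) (fun z => a + \sum_(u : k) iota u ^+ (n - r) * P (z + u))
      ((-1) ^+ r * \sum_(z : k) P z).
Proof.
move=> rn; apply: ind_inj => g; rewrite weyl1E.
have d0 := det2_neq0 g; have m0 : (0 < n - r)%N by rewrite subn_gt0.
have nX (x : k) : x != 0 -> iota x ^+ (n - r) = iota x ^- r.
  move=> x0; apply: (mulIf (x := iota x ^+ r)); first by rewrite expf_neq0 ?fmorph_eq0.
  by rewrite -exprD subnK 1?ltnW // iota_n // mulVf // expf_neq0 ?fmorph_eq0.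
rewrite [RHS]/= /blk_val; case: eqVneq => [x0|x0].
  have y0 := bottom_neq0 x0; have a0 : g 0 0 != 0.
    by move: d0; rewrite det2E x0 mulr0 subr0 mulf_eq0 negb_or => /andP[].
  have ed : det2 g = g 0 0 * g 1 1 by rewrite det2E x0; ring.
  rewrite (reindex_inj (h := fun z => (z * g 0 0 - g 0 1) / g 1 1)); last first.
    move=> z z' /(congr1 (fun t => (t * g 1 1 + g 0 1) / g 0 0)).
    by rewrite !divfK // !subrK !mulfK.
  rewrite !mulr_sumr; apply: eq_bigr => z _.
  have [_ _ w1 w2] := weyl_uE ((z * g 0 0 - g 0 1) / g 1 1) g.
  rewrite /= /blk_val w1 w2 det2M det_weyl_u mul1r x0 mulr0 addr0 oppr_eq0 (negPf a0).
  have -> : - (g 0 1 + (z * g 0 0 - g 0 1) / g 1 1 * g 1 1) / - g 0 0 = z.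
    by field; rewrite y0 oppr_eq0 a0.
  rewrite nX // ed rmorphN -[- iota _]mulN1r !exprMn exprD !rmorphM !exprMn; field.
  by rewrite !expf_neq0 ?fmorph_eq0.
(* The new variable is the lower left entry of the translate of [g], so its value 0 gives the term
   [a]. *)
rewrite (reindex_inj (h := fun z => - (z + g 0 0) / g 1 0)); last first.
  move=> z z' /(congr1 (fun t => - (t * g 1 0) - g 0 0)).
  by rewrite !divfK // !opprK !addrK.
rewrite (bigD1 0) //= !mulrDr; congr (_ + _).
  have [_ _ w1 w2] := weyl_uE (- (0 + g 0 0) / g 1 0) g.
  rewrite /blk_val w1 w2 det2M det_weyl_u mul1r divfK // add0r subrr oppr0 eqxx.
  have -> : - (g 0 1 + - g 0 0 / g 1 0 * g 1 1) = det2 g / g 1 0.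
    by rewrite det2E; field.
  rewrite nX // exprD rmorphM fmorphV exprMn exprVn; field.
  by rewrite expf_neq0 ?fmorph_eq0.
rewrite [in RHS](bigD1 0) //= rmorph0 expr0n eqn0Ngt m0 mul0r add0r.
rewrite [in RHS](reindex_onto (fun z => det2 g / (g 1 0 * z)) (fun t => det2 g / (g 1 0 * t)));
  last first.
  by move=> t t0; field; rewrite x0 d0 t0.
rewrite !mulr_sumr; apply: eq_big => z.
  have [->|z0] := eqVneq z 0; first by rewrite mulr0 invr0 mulr0 eqxx.
  rewrite mulf_neq0 ?invr_eq0 ?mulf_neq0 //=; apply/esym/eqP.
  by field; rewrite x0 d0 z0.
move=> z0; have [_ _ w1 w2] := weyl_uE (- (z + g 0 0) / g 1 0) g.
rewrite /blk_val w1 w2 det2M det_weyl_u mul1r.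
have -> : - (g 0 0 + - (z + g 0 0) / g 1 0 * g 1 0) = z by field.
rewrite (negPf z0).
have -> : - (g 0 1 + - (z + g 0 0) / g 1 0 * g 1 1) / z = g 1 1 / g 1 0 + det2 g / (g 1 0 * z).
  by rewrite det2E; field; rewrite x0 z0.
have u0 : det2 g / (g 1 0 * z) != 0 by rewrite mulf_neq0 ?invr_eq0 ?mulf_neq0.
rewrite !nX // exprD !rmorphM fmorphV rmorphM exprMn exprVn exprMn; field.
by rewrite !expf_neq0 ?fmorph_eq0.
Qed.

End Blocks.

Section LinearFunction.
Variables (R : pzRingType) (U V : lmodType R) (f : U -> V).
Hypothesis fl : linear f.

Definition lin_of (_ : linear f) : U -> V := f.
HB.instance Definition _ := GRing.isLinear.Build _ _ _ _ (lin_of fl) fl.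

Lemma linear_fun0 : f 0 = 0. Proof. exact: (linear0 (lin_of fl)). Qed.
Lemma linear_funD : {morph f : u v / u + v}. Proof. exact: (linearD (lin_of fl)). Qed.
Lemma linear_funZ a u : f (a *: u) = a *: f u. Proof. exact: (linearZ_LR (lin_of fl)). Qed.
Lemma linear_fun_sum (I : Type) (s : seq I) (Q : pred I) (F : I -> U) :
  f (\sum_(i <- s | Q i) F i) = \sum_(i <- s | Q i) f (F i).
Proof. exact: (linear_sum (lin_of fl)). Qed.

End LinearFunction.

(** * Hecke operators on one block *)

Section BlockBasis.
Variables (k : finFieldType) (E : fieldType) (iota : {rmorphism k -> E}).
Local Notation n := (#|k|.-1).
Local Notation C := (ind (@unip2 k) E).
Local Notation H := (hecke (@unip2 k) E).
Local Notation blk := (blk iota).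
Local Notation weyl1 := (weyl1 k E).
Implicit Types (P : k -> E) (g b u : GL2 k) (c : C) (r l o : nat) (h : H).

Let n_pos : (0 < n)%N := n_gt0 k.

Definition pw o : k -> E := fun z => iota z ^+ o.
Definition xi r l : C := blk r l (fun=> 0) 1.
(** On a bottom row [(x, y)] with [x] nonzero this is [det^l x^(r-o) y^o]. The value 1 at the row
    [(0, 1)] for [r = 0] and [o = n] cancels the second surviving term of the power sum, so that
    [vv 0 l o] is an eigenvector of [weyl1] also for [o = n], see [weyl1_vv0]. *)
Definition vv r l o : C := blk r l (pw o) ((r == 0) && (o == n))%N%:R.

Lemma weyl1_xi r l : (r < n)%N -> weyl1 (xi r l) = blk (n - r) (l + r) (fun=> 1) 0.
Proof.
move=> rn; rewrite weyl1_blk //; apply: blk_eq => [z|]; last by rewrite big1 ?mulr0.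
by rewrite big1 ?addr0 // => t _; rewrite mulr0.
Qed.

Lemma sum_pw_shift m o (z : k) : (0 < m)%N ->
  \sum_(t : k) iota t ^+ m * pw o (z + t) =
  - \sum_(j < o.+1) (n %| m + j)%N%:R * ('C(o, j)%:R * iota z ^+ (o - j)).
Proof.
move=> m0; under eq_bigr => t _ do rewrite /pw rmorphD exprDn mulr_sumr.
rewrite exchange_big /= -sumrN; apply: eq_bigr => j _.
rewrite (eq_bigr (fun t => 'C(o, j)%:R * iota z ^+ (o - j) * iota t ^+ (m + j))).
  by rewrite -mulr_sumr (iota_psum iota) ?addn_gt0 ?m0 // mulrN mulrC.
by move=> t _; rewrite exprD -mulr_natl; ring.
Qed.

Lemma sum_delta m i (F : nat -> E) : (i < m)%N ->
  \sum_(j < m) (j == i :> nat)%:R * F j = F i.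
Proof.
move=> im; rewrite (bigD1 (Ordinal im)) //= eqxx mul1r big1 ?addr0 // => j ne.
by rewrite (_ : (j == i :> nat) = false) ?mul0r //; apply: negPf; apply: contra ne => /eqP e;
  apply/eqP/val_inj.
Qed.

(** For [j <= o <= n] the exponent [n - r + j] is a multiple of [n] only if [j = r], or if
    [j = o = n] and [r = 0]. *)
Lemma sum_pw_weyl r o (z : k) : (r < n)%N -> (r < o <= n)%N ->
  \sum_(t : k) iota t ^+ (n - r) * pw o (z + t) =
  - ('C(o, r)%:R * iota z ^+ (o - r)) - ((r == 0) && (o == n))%N%:R.
Proof.
move=> rn /andP[ro on]; rewrite sum_pw_shift ?subn_gt0 // -opprD; congr (- _).
pose F j : E := 'C(o, j)%:R * iota z ^+ (o - j).
have hd (j : 'I_o.+1) : (n %| n - r + j)%N%:R * F j =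
    (j == r :> nat)%:R * F j + ((r == 0) && (o == n))%N%:R * ((j == o :> nat)%:R * F j).
  rewrite mulrA -mulrDl; congr (_ * _); rewrite -natrM -natrD; congr (_%:R).
  have := ltn_ord j; move: (j : nat) => i io; move: rn ro on io; move: n n_pos => N N0 rN ro oN io.
  have -> : (N %| N - r + i)%N = (i == r) || [&& r == 0, o == N & i == o]%N.
    apply/dvdnP/idP => [[m e]|]; last first.
      case/orP => [/eqP -> |/and3P[/eqP r0 /eqP oe /eqP ie]].
        by exists 1%N; lia.
      by exists 2%N; lia.
    by case: m e => [|[|[|m]]] e; nia.
  by case: (i =P r) => [->|_] /=; case: (r =P 0)%N; case: (o =P N); case: eqP => //=; lia.
rewrite (eq_bigr _ (fun j _ => hd j)) big_split /= -mulr_sumr !sum_delta //; last exact: leqW.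
by rewrite /F binn subnn expr0 !mulr1.
Qed.

Lemma weyl1_vv r l o : (r < n)%N -> (r < o <= n)%N -> weyl1 (vv r l o) =
  blk (n - r) (l + r) (fun z => - ('C(o, r)%:R * iota z ^+ (o - r)))
      (- ((-1) ^+ r * (o == n)%:R)).
Proof.
move=> rn ro; rewrite weyl1_blk //; apply: blk_eq => [z|].
  by rewrite sum_pw_weyl // addrC subrK.
have /andP[r0 on] := ro; rewrite /pw iota_psum; last exact: leq_trans r0.
rewrite mulrN; congr (- (_ * _%:R)); congr nat_of_bool.
apply/idP/idP => [/dvdn_leq h|/eqP ->]; last exact: dvdnn.
by rewrite eqn_leq on h //; exact: leq_trans r0.
Qed.

Lemma weyl1_vv0 l o : (0 < o <= n)%N -> weyl1 (vv 0 l o) = - vv 0 l o.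
Proof.
move=> ho; rewrite weyl1_vv // -[RHS]scaleN1r -blkZ subn0 addn0.
rewrite (@blk_mod _ _ iota n 0 l l) ?modnn ?mod0n //; apply: blk_eq => [z|].
  by rewrite bin0 mul1r subn0 mulN1r.
by rewrite expr0 mul1r mulN1r.
Qed.

Lemma weyl1_const l : weyl1 (blk 0 l (fun=> 1) 0) = - blk 0 l (fun=> 1) 0.
Proof.
rewrite weyl1_blk // -[RHS]scaleN1r -blkZ subn0 addn0.
rewrite (@blk_mod _ _ iota n 0 l l) ?modnn ?mod0n //; apply: blk_eq => [z|].
  under eq_bigr => t _ do rewrite mulr1.
  by rewrite iota_psum // dvdnn add0r mulr1.
rewrite expr0 mul1r mulr0 -[RHS]oppr0 -[X in - X]/(0%:R) sumr_const -[_ *+ _]/(#|k|%:R).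
by rewrite -(rmorph_nat iota) natr_card_k rmorph0 oppr0.
Qed.

Lemma xi_val r l g : xi r l g =
  if g 1 0 == 0 then iota (det2 g) ^+ l * iota (g 1 1) ^+ r else 0.
Proof. by rewrite /= /blk_val; case: ifP => _; rewrite ?mulr1 ?mulr0. Qed.

Lemma xi_unip r l u : unip2 u -> rtrans u (xi r l) = xi r l.
Proof.
move=> hu; have [u0 u1 u2] := hu; apply: ind_inj => g.
rewrite -[LHS]/(xi r l (g * u)%g) !xi_val det2M (unip2_det hu) mulr1.
rewrite !GL2_mulE u0 u1 u2 !mulr0 addr0 !mulr1.
by case: eqP => // ->; rewrite mul0r add0r.
Qed.

Definition row_u (z : k) : GL2 k := gl22 z 1 (-1) 0.

Lemma row_u_det z : z * 0 - 1 * -1 != 0 :> k.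
Proof. by rewrite mulr0 sub0r mulrN1 opprK oner_neq0. Qed.

Lemma row_uE z g : [/\ (g * row_u z)%g 1 0 = g 1 0 * z - g 1 1,
  (g * row_u z)%g 1 1 = g 1 0 & det2 (g * row_u z)%g = det2 g].
Proof.
rewrite !GL2_mulE det2M {2}/det2 det22 !(gl22E (row_u_det z)).
by split; ring.
Qed.

(** [xi] is supported on the rows [(0, y)], and [row_u z] sends the row [(1, z)] to [(0, 1)]. So
    within a block, [xi] and its translates act as delta functions at the points of the projective
    line. *)
Lemma blk_translates r l P a :
  blk r l P a = a *: xi r l + \sum_(z : k) P z *: rtrans (row_u z) (xi r l).
Proof.
apply: ind_inj => g.
have -> : (a *: xi r l + \sum_(z : k) P z *: rtrans (row_u z) (xi r l)) g =
    a * xi r l g + \sum_(z : k) P z * xi r l (g * row_u z)%g.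
  rewrite -[LHS]/(a * xi r l g + _); congr (_ + _).
  by elim/big_ind2: _ => [//|x x' y y' <- <-//|z _].
rewrite xi_val; under eq_bigr => z _.
  rewrite xi_val; have [-> -> ->] := row_uE z g; over.
rewrite /= /blk_val; case: eqVneq => [x0|x0].
  rewrite big1 ?addr0 => [|z _]; first by ring.
  by rewrite x0 mul0r sub0r oppr_eq0 (negPf (bottom_neq0 x0)) mulr0.
rewrite mulr0 add0r (bigD1 (g 1 1 / g 1 0)) //= big1 ?addr0 => [|z zne].
  have -> : g 1 0 * (g 1 1 / g 1 0) = g 1 1 by field.
  by rewrite subrr eqxx; ring.
case: eqP; rewrite ?mulr0 // => /eqP; rewrite subr_eq0 => /eqP e.
by case/eqP: zne; rewrite -e; field.
Qed.

Lemma unip_biinv_eq0 r l (phi : GL2 k -> E) : unip_inv phi ->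
    (forall u b, unip2 u -> phi (b * u)%g = phi b) ->
    (forall t1 t2 b, t1 != 0 -> t2 != 0 ->
       phi (b * diag2 t1 t2)%g = iota (t1 * t2) ^+ l * iota t2 ^+ r * phi b) ->
    phi 1%g = 0 -> phi (row1 0) = 0 -> phi =1 (fun=> 0).
Proof.
move=> inv rinv tinv p1 ps g; have d0 := det2_neq0 g.
have [x0|x0] := eqVneq (g 1 0) 0.
  have y0 := bottom_neq0 x0; have z0 : det2 g / g 1 1 != 0 by rewrite mulf_neq0 ?invr_eq0.
  pose d := diag2 (det2 g / g 1 1) (g 1 1).
  rewrite (@unip_inv_eq _ _ _ _ (1 * d)%g inv).
  - by rewrite tinv // p1 mulr0.
  - by rewrite mul1g x0 !(gl22E (diag2_det z0 y0)).
  - by rewrite mul1g !(gl22E (diag2_det z0 y0)).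
  - by rewrite mul1g det_diag2 // divfK.
have z0 : det2 g / g 1 0 != 0 by rewrite mulf_neq0 ?invr_eq0.
pose d := diag2 (g 1 0) (det2 g / g 1 0); pose u := unip_u (g 1 1 / g 1 0).
rewrite (@unip_inv_eq _ _ _ _ (row1 0 * d * u)%g inv).
- by rewrite rinv ?tinv ?ps ?mulr0 //; exact: unip_u_unip.
- rewrite !GL2_mulE !(gl22E (diag2_det x0 z0)) !(gl22E (row1_det 0)) !(gl22E (unip_u_det _)).
  by ring.
- rewrite !GL2_mulE !(gl22E (diag2_det x0 z0)) !(gl22E (row1_det 0)) !(gl22E (unip_u_det _)).
  by field.
have [_ _ _ _ e] := row1E (0 : k).
rewrite !det2M e det_diag2 // (unip2_det (unip_u_unip _)) mulr1 mul1r mulrC divfK //.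
Qed.

(** [h xi] is invariant under [U] on both sides and has the right torus character of [xi]. By the
    Bruhat decomposition it is determined by its values at 1 and at [row1 0], which are [(1, 0)] for
    [xi] and [(0, 1)] for [weyl1 xi]. The translates of [xi] span the block. *)
Lemma hecke_blk (h : H) r l : (r < n)%N -> exists a b : E, forall P x,
  h (blk r l P x) = a *: blk r l P x + b *: weyl1 (blk r l P x).
Proof.
move=> rn; have [hl hc] := endGP h; have [wl wc] := endGP weyl1.
pose X := xi r l; pose a : E := h X 1%g; pose b : E := h X (row1 0).
pose D (c : C) : C := h c - (a *: c + b *: weyl1 c).
have Dl : linear D.
  by move=> s c c'; rewrite /D hl wl !scalerDr !scalerA ![_ * s]mulrC -!scalerA;
    apply: ind_inj => g /=; rewrite !fctE /=; ring.
have Dc g c : D (rtrans g c) = rtrans g (D c).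
  by rewrite /D hc wc; apply: ind_inj.
have X_rtrans t1 t2 : t1 != 0 -> t2 != 0 ->
    rtrans (diag2 t1 t2) X = (iota (t1 * t2) ^+ l * iota t2 ^+ r) *: X.
  move=> h1 h2; apply: ind_inj => g.
  rewrite -[LHS]/(X (g * diag2 t1 t2)%g) -[RHS]/(_ * X g) !xi_val det2M det_diag2 //.
  rewrite !GL2_mulE !(gl22E (diag2_det h1 h2)) !mulr0 addr0 add0r mulf_eq0 (negPf h1) orbF.
  by case: ifP => _; rewrite ?mulr0 // !rmorphM !exprMn; ring.
have DX : D X = 0.
  apply: ind_inj; apply: (@unip_biinv_eq0 r l).
  - exact: unip_inv_ind.
  - by move=> u g hu; rewrite -[LHS]/(rtrans u (D X) g) -Dc xi_unip.
  - move=> t1 t2 g h1 h2; rewrite -[LHS]/(rtrans (diag2 t1 t2) (D X) g) -Dc X_rtrans //.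
    by rewrite (linear_funZ Dl).
  - rewrite -[LHS]/(h X 1%g - (a * X 1%g + b * weyl1 X 1%g)).
    by rewrite weyl1_xi // !blk_1 /a; ring.
  - rewrite -[LHS]/(h X (row1 0) - (a * X (row1 0) + b * weyl1 X (row1 0))).
    by rewrite weyl1_xi // !blk_row1 /b; ring.
exists a, b => P x; apply/eqP; rewrite -subr_eq0; apply/eqP.
rewrite -[LHS]/(D _) blk_translates (linear_funD Dl) (linear_funZ Dl) DX scaler0 add0r.
rewrite (linear_fun_sum Dl) big1 // => z _.
by rewrite (linear_funZ Dl) Dc DX linear0 scaler0.
Qed.

End BlockBasis.

(** * Relations over the finite group *)

Section BlockIndependence.
Variables (k : finFieldType) (E : fieldType) (iota : {rmorphism k -> E}).
Local Notation n := (#|k|.-1).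
Local Notation C := (ind (@unip2 k) E).
Local Notation H := (hecke (@unip2 k) E).
Local Notation blk := (blk iota).
Local Notation weyl1 := (weyl1 k E).
Local Notation block := ('I_n * 'I_n)%type.
Local Notation idx := (block * 'I_n.+1)%type.

Let n_pos : (0 < n)%N := n_gt0 k.

Definition chr r l (t1 t2 : k) : E := iota (t1 * t2) ^- l * iota t2 ^- r.

Lemma sum_chr a b : \sum_(t : k | t != 0) iota t ^+ a * iota t ^- b = - (a == b %[mod n])%N%:R.
Proof.
rewrite (eq_bigr (fun t => iota (t ^+ (a + n.-1 * b)))); last first.
  move=> t t0; have t1 : iota t ^+ b != 0 by rewrite expf_neq0 ?fmorph_eq0.
  apply: (mulIf t1); rewrite mulfVK // rmorphXn -exprD -addnA -mulSnr prednK //.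
  by rewrite exprD exprM iota_n // expr1n mulr1.
rewrite -rmorph_sum psum_nz rmorphN rmorph_nat; congr (- _%:R); congr nat_of_bool.
rewrite /dvdn -[X in _ == X](mod0n n) -(eqn_modDr b) add0n.
by rewrite -addnA -mulSnr prednK // addnC mulnC modnMDl.
Qed.

(** The order [n^2] of the torus is 1 in [E], so this sum is already the projection onto the block
    [(r, l)]. *)
Definition tor r l : H := avg (fin_level k) (torus_ok (chr r l)).

Lemma torE r l (c : C) g : tor r l c g =
  \sum_(t1 : k | t1 != 0) \sum_(t2 : k | t2 != 0) chr r l t1 t2 * c (diag2 t1 t2 * g)%g.
Proof. exact: avg_torus. Qed.

Lemma tor_blk r l r' l' P a : tor r l (blk r' l' P a) =
  ((l' == l %[mod n])%N && (r' == r %[mod n])%N)%:R *: blk r' l' P a.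
Proof.
apply: ind_inj => g; rewrite torE -[RHS]/(_ * blk r' l' P a g).
transitivity (\sum_(t1 : k | t1 != 0) (iota t1 ^+ l' * iota t1 ^- l) *
   (\sum_(t2 : k | t2 != 0) (iota t2 ^+ (l' + r') * iota t2 ^- (l + r)))
      * blk r' l' P a g).
  apply: eq_bigr => t1 h1; rewrite mulr_sumr mulr_suml; apply: eq_bigr => t2 h2.
  rewrite blk_torus // /chr rmorphM !exprMn !exprD; field.
  by rewrite !expf_neq0 ?fmorph_eq0.
rewrite -!mulr_suml !sum_chr mulrNN -natrM mulnb; congr (_%:R * _); congr nat_of_bool.
by case: eqVneq => //= e; rewrite -modnDml e modnDml eqn_modDl.
Qed.

Variable B : pred block.

Definition valid (i : idx) := B i.1 && (i.1.1 <= i.2)%N.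

(* For [r < o], [bas ((r, l), o)] is the function [det ^ l * x ^ (r - o) * y ^ o] of
   the bottom row (x, y), extended to x = 0; for [o = r] it is [xi r l], and it is
   zero on the indices that are not [valid]. *)
Definition bP (i : idx) : {poly E} := if valid i && (i.1.1 < i.2)%N then 'X^(i.2) else 0.
Definition ba (i : idx) : E := if valid i then
  (if (i.1.1 < i.2)%N then ((i.1.1 == 0 :> nat) && (i.2 == n :> nat))%:R else 1) else 0.
(* The components of [weyl1 (bas i)], which lies in the block [par i.1]. *)
Definition tP (i : idx) : {poly E} := if valid i then
  (if (i.1.1 < i.2)%N then (- 'C(i.2, i.1.1)%:R) *: 'X^(i.2 - i.1.1) else 1) else 0.
Definition ta (i : idx) : E := if valid i && (i.1.1 < i.2)%N then
  - ((-1) ^+ i.1.1 * (i.2 == n :> nat)%:R) else 0.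

Definition bas (i : idx) : C := blk i.1.1 i.1.2 (fun z => (bP i).[iota z]) (ba i).

Lemma bas_xi i : valid i -> ~~ (i.1.1 < i.2)%N -> bas i = xi iota i.1.1 i.1.2.
Proof.
move=> vi /negPf lt; apply: blk_eq => [z|]; rewrite /bP /ba vi lt //=.
by rewrite horner0.
Qed.

Lemma bas_vv i : valid i -> (i.1.1 < i.2)%N -> bas i = vv iota i.1.1 i.1.2 i.2.
Proof.
by move=> vi lt; apply: blk_eq => [z|]; rewrite /bP /ba vi lt //= hornerXn.
Qed.

Lemma bas_invalid i : ~~ valid i -> bas i = 0.
Proof.
move=> /negPf vi; rewrite /bas -(blk0 iota i.1.1 i.1.2).
by apply: blk_eq => [z|]; rewrite /bP /ba vi //= horner0.
Qed.

Lemma weyl1_bas i : weyl1 (bas i) =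
  blk (n - i.1.1) (i.1.2 + i.1.1) (fun z => (tP i).[iota z]) (ta i).
Proof.
have [wl _] := endGP weyl1.
have [vi|vi] := boolP (valid i); last first.
  rewrite bas_invalid // (linear_fun0 wl) -(blk0 iota (n - i.1.1) (i.1.2 + i.1.1)).
  by apply: blk_eq => [z|]; rewrite /tP /ta (negPf vi) //= horner0.
have [lt|lt] := boolP (i.1.1 < i.2)%N.
  have rN : (i.1.1 < n)%N := ltn_ord i.1.1.
  have ro : (i.1.1 < i.2 <= n)%N by rewrite lt; exact: leq_ord.
  rewrite bas_vv // (weyl1_vv _ _ rN ro).
  by apply: blk_eq => [z|]; rewrite /tP /ta vi lt //= hornerZ hornerXn mulNr.
rewrite bas_xi // (weyl1_xi _ _ (ltn_ord i.1.1)).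
by apply: blk_eq => [z|]; rewrite /tP /ta vi (negPf lt) //= hornerC.
Qed.

Definition par (b : block) : block :=
  (Ordinal (ltn_pmod (n - b.1) n_pos), Ordinal (ltn_pmod (b.2 + b.1) n_pos)).

Lemma par1 b : (par b).1 = (if b.1 == 0 :> nat then 0 else n - b.1)%N :> nat.
Proof.
rewrite /=; case: eqP => [->|/eqP r0]; first by rewrite subn0 modnn.
by rewrite modn_small // ltn_subrL lt0n r0 n_pos.
Qed.

Lemma parK : involutive par.
Proof.
move=> b; have rN := ltn_ord b.1; have lN := ltn_ord b.2.
have e1 : (par (par b)).1 = b.1 :> nat.
  by rewrite !par1; case: (b.1 : nat) rN => [|r] //= rN;
    rewrite subn_eq0 leqNgt rN /= subKn // ltnW.
have e2 : (par (par b)).2 = b.2 :> nat.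
  rewrite /= modnDm -addnA subnKC 1?ltnW // -[X in (_ + X)%N]mul1n.
  by rewrite addnC modnMDl modn_small.
by apply: injective_projections; apply: val_inj.
Qed.

Lemma tor_bas (b : block) i : tor b.1 b.2 (bas i) =
  blk b.1 b.2 (fun z => ((i.1 == b)%:R *: bP i).[iota z]) ((i.1 == b)%:R * ba i).
Proof.
rewrite tor_blk !modn_small ?ltn_ord //.
have -> : ((i.1.2 == b.2 :> nat) && (i.1.1 == b.1 :> nat)) = (i.1 == b).
  by rewrite andbC; case: (i.1) b => [r l] [r' l'].
case: eqP => [<-|_].
  by rewrite -blkZ; apply: blk_eq => [z|] //; rewrite hornerZ.
rewrite scale0r -(blk0 iota b.1 b.2).
by apply: blk_eq => [z|]; rewrite ?hornerZ mul0r.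
Qed.

Lemma tor_weyl1_bas (b : block) i : tor b.1 b.2 (weyl1 (bas i)) =
  blk b.1 b.2 (fun z => ((par i.1 == b)%:R *: tP i).[iota z]) ((par i.1 == b)%:R * ta i).
Proof.
rewrite weyl1_bas tor_blk -(@blk_mod _ _ iota ((n - i.1.1) %% n) _ ((i.1.2 + i.1.1) %% n))
  ?modn_mod //.
rewrite [X in (_ == X) && _]modn_small ?ltn_ord // [X in _ && (_ == X)]modn_small ?ltn_ord //.
rewrite -[((n - _) %% n)%N]/(nat_of_ord (par i.1).1) -[((i.1.2 + _) %% n)%N]/(nat_of_ord (par
  i.1).2).
have -> : (((par i.1).2 == b.2 :> nat) && ((par i.1).1 == b.1 :> nat)) = (par i.1 == b).
  by rewrite andbC; case: (par i.1) b => [r l] [r' l'].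
case: eqP => [<-|_].
  by rewrite -blkZ; apply: blk_eq => [z|] //; rewrite hornerZ.
rewrite scale0r -(blk0 iota b.1 b.2).
by apply: blk_eq => [z|]; rewrite ?hornerZ mul0r.
Qed.

Hypothesis bin_neq0 : forall b o, B b -> (0 < b.1)%N -> (b.1 < o <= n)%N ->
  'C(o, b.1)%:R != 0 :> E.

(* The image of the characteristic function of the unipotent subgroup under the
   idempotent attached to [i], see [idem_ind1]. *)
Definition wit (i : idx) : C := if valid i then
  (if (i.1.1 == 0 :> nat) && (i.1.1 < i.2)%N then - weyl1 (xi iota 0 i.1.2)
   else xi iota i.1.1 i.1.2) else 0.

Section Relation.
Variable h : idx -> H.
Let F : C := \sum_i h i (bas i).

(** The scalars come from [hecke_blk]. The component of [F] in the block [bl] is a polynomial [Q bl]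
    in [z] together with a value at the row [(0, 1)]. Right invariance under [U] makes this
    polynomial function invariant under translations, hence constant; the identities say that
    coefficients of [Q bl] vanish. *)
Lemma relation_coef : exists (a b : idx -> E), [/\
   forall i P x, h i (blk i.1.1 i.1.2 P x) = a i *: blk i.1.1 i.1.2 P x
      + b i *: weyl1 (blk i.1.1 i.1.2 P x),
   (forall u g, unip2 u -> F (g * u)%g = F g) -> forall (bl : block) j, (0 < j)%N ->
     \sum_i (a i * ((i.1 == bl)%:R * (bP i)`_j) + b i * ((par i.1 == bl)%:R * (tP i)`_j)) = 0
   & F = 0 -> forall (bl : block),
     (forall j, \sum_i (a i * ((i.1 == bl)%:R * (bP i)`_j)
                       + b i * ((par i.1 == bl)%:R * (tP i)`_j)) = 0)
     /\ \sum_i (a i * ((i.1 == bl)%:R * ba i) + b i * ((par i.1 == bl)%:R * ta i)) = 0].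
Proof.
have hab i : exists ab : E * E, forall P x, h i (blk i.1.1 i.1.2 P x) =
    ab.1 *: blk i.1.1 i.1.2 P x + ab.2 *: weyl1 (blk i.1.1 i.1.2 P x).
  have [a [b e]] := hecke_blk iota (h i) i.1.2 (ltn_ord i.1.1).
  by exists (a, b).
pose a i := (sval (cid (hab i))).1; pose b i := (sval (cid (hab i))).2.
have habE i P x : h i (blk i.1.1 i.1.2 P x) = a i *: blk i.1.1 i.1.2 P x
      + b i *: weyl1 (blk i.1.1 i.1.2 P x) by exact: (svalP (cid (hab i))).
exists a, b.
pose Q (bl : block) : {poly E} := \sum_i (a i *: ((i.1 == bl)%:R *: bP i)
  + b i *: ((par i.1 == bl)%:R *: tP i)).
pose psi (bl : block) : E := \sum_i (a i * ((i.1 == bl)%:R * ba i)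
  + b i * ((par i.1 == bl)%:R * ta i)).
have FE (bl : block) : tor bl.1 bl.2 F = blk bl.1 bl.2 (fun z => (Q bl).[iota z]) (psi bl).
  have [tl _] := endGP (tor bl.1 bl.2).
  rewrite /F (linear_fun_sum tl).
  rewrite (eq_bigr (fun i => blk bl.1 bl.2 (fun z => (a i *: ((i.1 == bl)%:R *: bP i)
     + b i *: ((par i.1 == bl)%:R *: tP i)).[iota z])
     (a i * ((i.1 == bl)%:R * ba i) + b i * ((par i.1 == bl)%:R * ta i)))); last first.
    move=> i _; rewrite {1}/bas habE (linear_funD tl) !(linear_funZ tl).
    rewrite -/(bas i) tor_bas tor_weyl1_bas -(blkZ iota _ _ (b i)) -blkD.
    by apply: blk_eq => // z; rewrite hornerD !(hornerZ (a i)) !(hornerZ (b i)).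
  by rewrite blk_sum; apply: blk_eq => // z; rewrite /Q horner_sum.
have Qcoef bl j : (Q bl)`_j = \sum_i (a i * ((i.1 == bl)%:R * (bP i)`_j)
                       + b i * ((par i.1 == bl)%:R * (tP i)`_j)).
  by rewrite /Q coef_sum; apply: eq_bigr => i _; rewrite coefD !coefZ.
have sQ bl : (size (Q bl) <= n.+1)%N.
  apply: (leq_trans (size_sum _ _ _)); apply/bigmax_leqP => i _.
  have sX m : (m <= n)%N -> (size ('X^m : {poly E}) <= n.+1)%N by rewrite size_polyXn ltnS.
  have iN : (i.2 <= n)%N by exact: leq_ord.
  apply: (leq_trans (size_polyD _ _)); rewrite geq_max; apply/andP; split.
    do 2 apply: (leq_trans (size_scale_leq _ _)); rewrite /bP; case: ifP => _; first exact: sX.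
    by rewrite size_poly0.
  do 2 apply: (leq_trans (size_scale_leq _ _)); rewrite /tP; case: ifP => _;
    last by rewrite size_poly0.
  case: ifP => _; last by rewrite size_poly1.
  by apply: (leq_trans (size_scale_leq _ _)); apply: sX; rewrite (leq_trans (leq_subr _ _)).
(* [Q bl] has degree at most [n], so it is determined by its [n + 1] values on [k]. *)
have Qconst bl x : (forall z, (Q bl).[iota z] = x) -> Q bl = x%:P.
  move=> hx; apply/eqP; rewrite -subr_eq0; apply/negPn/negP => ne.
  have := max_poly_roots ne (rs := [seq iota z | z <- enum k]).
  rewrite map_inj_uniq ?enum_uniq; last exact: fmorph_inj.
  have -> : all (root (Q bl - x%:P)) [seq iota z | z <- enum k].
    by apply/allP => y /mapP[z _ ->]; rewrite /root hornerD hornerN hornerC hx subrr.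
  move=> /(_ isT isT); rewrite size_map -cardE (card_k k) ltnNge => /negP; apply.
  apply: (leq_trans (size_polyD _ _)); rewrite geq_max sQ size_polyN.
  by rewrite (leq_trans (size_polyC_leq1 _)).
split=> // [Fu bl j j0|F0 bl].
  have [_ tc] := endGP (tor bl.1 bl.2).
  have e z : (Q bl).[iota z] = (Q bl).[iota 0].
    have [r0 r1 r2 r3 rd] := row1E (0 : k); have [s0 s1 s2 s3 sd] := row1E z.
    rewrite -(blk_row1 iota bl.1 bl.2 (fun z => (Q bl).[iota z]) (psi bl) z) -FE.
    rewrite -(blk_row1 iota bl.1 bl.2 (fun z => (Q bl).[iota z]) (psi bl) 0) -FE.
    have eF : rtrans (unip_u z) (tor bl.1 bl.2 F) = tor bl.1 bl.2 F.
      rewrite -tc; congr (tor bl.1 bl.2 _ : C); apply: ind_inj => g.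
      by rewrite [LHS]/= Fu //; exact: unip_u_unip.
    transitivity (rtrans (unip_u z) (tor bl.1 bl.2 F) (row1 0)); last by rewrite eF.
    rewrite -[RHS]/(tor bl.1 bl.2 F (row1 0 * unip_u z)%g).
    apply: unip_inv_eq; first exact: unip_inv_ind.
    - by rewrite s2 GL2_mulE r2 r3 !(gl22E (unip_u_det z)); ring.
    - by rewrite s3 GL2_mulE r2 r3 !(gl22E (unip_u_det z)); ring.
    - by rewrite sd det2M rd (unip2_det (unip_u_unip _)) mulr1.
  by rewrite -Qcoef (Qconst _ _ e) coefC; case: j j0.
have := FE bl; rewrite F0 (linear_fun0 (endGP (tor bl.1 bl.2)).1) => e.
have Q0 : Q bl = 0.
  rewrite -[RHS]/(0%:P); apply: Qconst => z.
  by rewrite -(blk_row1 iota bl.1 bl.2 (fun z => (Q bl).[iota z]) (psi bl) z) -e.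
split=> [j|]; first by rewrite -Qcoef Q0 coef0.
by rewrite -[LHS]/(psi bl) -(blk_1 iota bl.1 bl.2 (fun z => (Q bl).[iota z]) (psi bl)) -e.
Qed.

Lemma bP_coef i j : (bP i)`_j = (valid i && (i.1.1 < i.2)%N && (j == i.2 :> nat))%:R.
Proof. by rewrite /bP; case: ifP => _; rewrite ?coef0 ?coefXn. Qed.

Lemma tP_coef i j : (tP i)`_j = (if valid i then
  (if (i.1.1 < i.2)%N then - 'C(i.2, i.1.1)%:R * (j == (i.2 - i.1.1)%N)%:R
   else (j == 0)%N%:R) else 0).
Proof.
rewrite /tP; case: ifP => _; last by rewrite coef0.
by case: ifP => _; rewrite ?coefZ ?coefXn ?coef1.
Qed.

End Relation.

Lemma idx_eq (i j : idx) : (j == i) = (j.1 == i.1) && (j.2 == i.2 :> nat).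
Proof. by case: i j => [b o] [b' o']. Qed.

Lemma par0 (b : block) : b.1 = 0 :> nat -> par b = b.
Proof.
move=> r0; apply: injective_projections; apply: val_inj;
  first exact: (etrans (par1 b) (etrans (congr1 (fun m =>
  if m == 0%N then 0%N else (n - m)%N) r0) (esym r0))).
by rewrite /= r0 addn0 modn_small.
Qed.

Lemma bP_self (i j : idx) : valid i -> (i.1.1 < i.2)%N ->
  (j.1 == i.1)%:R * (bP j)`_(i.2) = (j == i)%:R :> E.
Proof.
move=> vi lt; rewrite bP_coef -natrM mulnb idx_eq; congr (_%:R); congr nat_of_bool.
case: eqP => //= e; rewrite eq_sym; case: eqP => e2; rewrite ?andbF // andbT.
by rewrite /valid e e2 -/(valid i) vi lt.
Qed.

Lemma tP_far (i j : idx) : (0 < i.1.1 < i.2)%N ->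
  (par j.1 == i.1)%:R * (tP j)`_(i.2) = 0 :> E.
Proof.
move=> /andP[r0 lt]; case: eqP => e; rewrite ?mul0r // mul1r tP_coef.
case: ifP => // _; have := par1 j.1; rewrite e.
case: eqP => [_ r00|_ re]; first by rewrite r00 in r0.
have jN : (j.2 <= n)%N := leq_ord _; case: ifP => lj.
  rewrite (_ : (_ == _)%N = false) ?mulr0 //; apply: negPf.
  by rewrite neq_ltn (leq_ltn_trans _ lt) ?orbT // re leq_sub2r.
by rewrite (_ : (i.2 == 0 :> nat) = false) //; case: (i.2 : nat) lt.
Qed.

Lemma bP_far (i j : idx) : (0 < i.1.1 < i.2)%N ->
  (j.1 == par i.1)%:R * (bP j)`_(i.2 - i.1.1) = 0 :> E.
Proof.
move=> /andP[r0 lt]; case: eqP => e; rewrite ?mul0r // mul1r bP_coef.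
case: eqP => e2; rewrite ?andbF // andbT.
have := par1 i.1; rewrite -e eqn0Ngt r0 /= => ->; rewrite -e2.
by rewrite ltnNge leq_sub2r ?andbF //; exact: leq_ord.
Qed.

Lemma tP_self (i j : idx) : valid i -> (i.1.1 < i.2)%N ->
  (par j.1 == par i.1)%:R * (tP j)`_(i.2 - i.1.1) = (j == i)%:R * - 'C(i.2, i.1.1)%:R :> E.
Proof.
move=> vi lt; rewrite (inj_eq (inv_inj parK)) idx_eq tP_coef /valid.
case: eqP => [->|_]; rewrite ?mul0r // mul1r /=.
have := vi; rewrite /valid => /andP[-> _] /=.
have m0 : (0 == i.2 - i.1.1)%N = false by rewrite eq_sym subn_eq0 leqNgt lt.
case: (nat_of_ord j.2 =P nat_of_ord i.2) => [->|ne]; first by rewrite (ltnW lt) lt eqxx mulr1 mul1r.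
rewrite mul0r; case: ifP => // le; case: ifP => l2; last by rewrite eq_sym m0.
rewrite (_ : (_ == _)%N = false) ?mulr0 //; apply/eqP => e; apply: ne.
by have := congr1 (addn^~ i.1.1) e; rewrite /= !subnK 1?ltnW // 1?ltnW.
Qed.

Lemma tP_self0 (i j : idx) : valid i -> (i.1.1 < i.2)%N -> i.1.1 = 0 :> nat ->
  (par j.1 == i.1)%:R * (tP j)`_(i.2) = - (j == i)%:R :> E.
Proof.
by move=> vi lt r0; have := tP_self j vi lt; rewrite (par0 r0) r0 subn0 bin0 mulrN1.
Qed.

Lemma bP_0 (i : idx) : (bP i)`_0 = 0.
Proof.
by rewrite bP_coef; case: (i.2 : nat) => [|o]; rewrite ?ltn0 ?andbF.
Qed.

Lemma tP_0 (i j : idx) : valid i -> ~~ (i.1.1 < i.2)%N ->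
  (par j.1 == par i.1)%:R * (tP j)`_0 = (j == i)%:R :> E.
Proof.
move=> vi lt; rewrite (inj_eq (inv_inj parK)) idx_eq tP_coef /valid.
case: eqP => [->|_]; rewrite ?mul0r // mul1r /=.
have := vi; rewrite /valid => /andP[-> le] /=.
have {le}e : i.1.1 = i.2 :> nat by apply/eqP; rewrite eqn_leq le leqNgt.
rewrite e; case: ifP => [l2|l2].
  case: ifP => l3; last by rewrite eqn_leq l2 leqNgt l3.
  rewrite [_ == (_ - _)%N]eq_sym subn_eq0 leqNgt l3 mulr0.
  by rewrite (gtn_eqF l3).
by rewrite (_ : (j.2 == i.2 :> nat) = false) //; apply/negP => /eqP e2; rewrite e2 leqnn in l2.
Qed.

(** If [r > 0], a block receives exponents [o > r] from its own functions, and from the image under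
    [weyl1] of the block paired with it by [par] only exponents [o' - r' <= n - r' = r]. So all
    coefficients can be read off separately, those of [weyl1] up to a binomial coefficient. If
    [r = 0], then [weyl1 (bas i) = - bas i] and only [a i - b i] is visible. *)
Lemma relation_vv (a b : idx -> E) (i : idx) :
    (forall (bl : block) j, (0 < j)%N ->
     \sum_i (a i * ((i.1 == bl)%:R * (bP i)`_j) + b i * ((par i.1 == bl)%:R * (tP i)`_j)) = 0) ->
    valid i -> (i.1.1 < i.2)%N ->
  if i.1.1 == 0 :> nat then a i = b i else a i = 0 /\ b i = 0.
Proof.
move=> hu vi lt.
have sumE (G : idx -> E) : \sum_j G j * (j == i)%:R = G i.
  by rewrite (bigD1 i) //= eqxx mulr1 big1 ?addr0 // => j /negPf ->; rewrite mulr0.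
have o0 : (0 < i.2)%N by exact: leq_trans lt.
case: (posnP i.1.1) => [r0|r0].
  have := hu i.1 _ o0; under eq_bigr => j _ do rewrite bP_self // tP_self0 // mulrN -mulrBl.
  by rewrite sumE => /eqP; rewrite subr_eq0 => /eqP.
have far : (0 < i.1.1 < i.2)%N by rewrite r0.
split.
  have := hu i.1 _ o0; under eq_bigr => j _ do rewrite bP_self // tP_far // mulr0 addr0.
  by rewrite sumE.
have := hu (par i.1) (i.2 - i.1.1)%N; rewrite subn_gt0 => /(_ lt).
rewrite (eq_bigr (fun j => b j * (- 'C(i.2, i.1.1)%:R) * (j == i)%:R)); last first.
  by move=> j _; rewrite bP_far // tP_self // mulr0 add0r -mulrA [_ * (j == i)%:R]mulrC.
rewrite sumE => /eqP; rewrite mulf_eq0 oppr_eq0 => /orP[/eqP//|/negPn/negP[]].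
by apply: bin_neq0 => //; [case/andP: vi|rewrite lt; exact: leq_ord].
Qed.

Lemma relation_wit_vv (h : idx -> H) (i : idx) : valid i -> (i.1.1 < i.2)%N ->
    (forall u g, unip2 u -> (\sum_i h i (bas i)) (g * u)%g = (\sum_i h i (bas i)) g) ->
  h i (wit i) = 0.
Proof.
move=> vi lt Fu; have [a [b [hE hu _]]] := relation_coef h.
have := relation_vv (hu Fu) vi lt; rewrite /wit vi lt andbT.
case: eqP => [r0 ab|_ [a0 b0]]; last by rewrite hE a0 b0 !scale0r addr0.
have [hl _] := endGP (h i).
rewrite -scaleN1r (linear_funZ hl) weyl1_xi // (@blk_mod _ _ iota _ i.1.1 _ i.1.2); first last.
- by rewrite addn0.
- by rewrite r0 subn0 modnn mod0n.
rewrite hE r0 weyl1_const ab scalerN subrr scaler0 //.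
Qed.

(** The new case is [o = r]. The constant term in the block [par i.1] comes from [weyl1 (xi _ _)]
    alone, which gives [b i = 0]. Then the value at the row [(0, 1)] gives [a i = 0], as the other
    contributions to it cancel by [relation_vv]. *)
Lemma relation_wit (h : idx -> H) (i : idx) : valid i -> \sum_i h i (bas i) = 0 ->
  h i (wit i) = 0.
Proof.
move=> vi F0; have Fu u g : unip2 u ->
    (\sum_i h i (bas i)) (g * u)%g = (\sum_i h i (bas i)) g by rewrite F0.
have [lt|ge] := boolP (i.1.1 < i.2)%N; first exact: relation_wit_vv.
have [a [b [hE hu hz]]] := relation_coef h.
have vvr := relation_vv (hu Fu); have {}hz := hz F0.
have sumE (G : idx -> E) : \sum_j G j * (j == i)%:R = G i.
  by rewrite (bigD1 i) //= eqxx mulr1 big1 ?addr0 // => j /negPf ->; rewrite mulr0.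
have bi : b i = 0.
  have [/(_ 0%N) + _] := hz (par i.1).
  by under eq_bigr => j _ do rewrite bP_0 tP_0 // !mulr0 add0r; rewrite sumE.
have ai : a i = 0.
  have [_] := hz i.1; rewrite (bigD1 i) //= [X in _ + X]big1 ?addr0 => [|j ne].
    by rewrite bi mul0r addr0 eqxx mul1r /ba vi (negPf ge) mulr1.
  have [vj|vj] := boolP (valid j); last first.
    by rewrite /ba /ta (negPf vj) /= !mulr0 addr0.
  have [lj|lj] := boolP (j.1.1 < j.2)%N; last first.
    rewrite /ta (negPf lj) andbF !mulr0 addr0; case: eqP => e; rewrite ?mul0r ?mulr0 //.
    case/eqP: ne; apply/eqP; rewrite idx_eq e eqxx /=.
    have /andP[_ l1] := vi; have /andP[_ l2] := vj.
    have e1 : i.1.1 = i.2 :> nat by apply/eqP; rewrite eqn_leq l1 leqNgt.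
    have e2 : j.1.1 = j.2 :> nat by apply/eqP; rewrite eqn_leq l2 leqNgt.
    by rewrite -e1 -e2 e.
  have := vvr j vj lj; case: eqP => [r0 ab|_ [-> ->]]; last by rewrite !mul0r addr0.
  rewrite ab -mulrDr par0 // -mulrDr /ba /ta vj lj r0 eqxx /= expr0 mul1r subrr.
  by rewrite !mulr0.
rewrite /wit vi (negPf ge) andbF hE ai bi !scale0r addr0 //.
Qed.

End BlockIndependence.

(** * Passage from the finite group to a level *)

Section LevelBasis.
Variables (k : finFieldType) (E : fieldType) (iota : {rmorphism k -> E}).
Variables (Gm : groupType) (J : set Gm) (lv : level k J).
Local Notation n := (#|k|.-1).
Local Notation K := (lv_grp lv).
Local Notation red := (lv_red lv).
Local Notation lft := (lv_lift lv).
Local Notation C := (ind (@unip2 k) E).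
Local Notation H := (hecke (@unip2 k) E).
Local Notation HJ := (hecke J E).
Local Notation ext := (ext lv).
Local Notation block := ('I_n * 'I_n)%type.
Local Notation idx := (block * 'I_n.+1)%type.
Variable B : pred block.
Hypothesis bin_neq0 : forall b o, B b -> (0 < b.1)%N -> (b.1 < o <= n)%N ->
  'C(o, b.1)%:R != 0 :> E.
Local Notation bas := (bas iota B).
Local Notation wit := (wit iota B).
Local Notation valid := (valid B).

Definition hweyl : HJ := avg lv (@weyl_ok k E).
Definition htor r l : HJ := avg lv (torus_ok (chr iota r l)).

Lemma ext_weyl c : ext (weyl1 k E c) = hweyl (ext c). Proof. exact: ext_avg. Qed.
Lemma ext_tor r l c : ext (tor iota r l c) = htor r l (ext c). Proof. exact: ext_avg. Qed.

Definition idem (i : idx) : HJ := if valid i then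
  (if (i.1.1 == 0 :> nat) && (i.1.1 < i.2)%N then - (hweyl * htor 0 i.1.2)
   else htor i.1.1 i.1.2) else 0.

Lemma tor_ind1 r l : tor iota r l (ind1 E (fin_level k)) = xi iota r l.
Proof.
apply: ind_inj => g; rewrite torE xi_val.
have E1 t1 t2 : t1 != 0 -> t2 != 0 ->
    ind1 E (fin_level k) (diag2 t1 t2 * g)%g =
    ((g 1 0 == 0) && ((t2 == (g 1 1)^-1) && (t1 == g 1 1 / det2 g)))%:R :> E.
  move=> h1 h2; rewrite ind1E; congr (_%:R); congr nat_of_bool; apply/asboolP/idP.
    have [w1 w2 w3 w4] := diag2E g h1 h2; case; rewrite w1 w3 w4 => /eqP.
    rewrite mulf_eq0 (negPf h2) /= => /eqP x0 e1 e2; have y0 := bottom_neq0 x0.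
    have a0 : g 0 0 != 0 by apply/eqP => a0; move/eqP: e1; rewrite a0 mulr0 eq_sym oner_eq0.
    rewrite x0 eqxx /= -[t2](mulfK y0) e2 mul1r eqxx /= det2E x0 mulr0 subr0.
    by rewrite -[t1](mulfK a0) e1; apply/eqP; field; rewrite y0 a0.
  case/and3P => /eqP x0 /eqP e2 /eqP e1; have y0 := bottom_neq0 x0; have d0 := det2_neq0 g.
  have [w1 w2 w3 w4] := diag2E g h1 h2; have de := det2E g; rewrite x0 mulr0 subr0 in de.
  split; rewrite ?w1 ?w3 ?w4 ?x0 ?mulr0 // ?e2 ?mulVf // e1.
  by rewrite mulrAC [_ * g 0 0]mulrC -de divff.
rewrite (eq_bigr (fun t1 => \sum_(t2 | t2 != 0) chr iota r l t1 t2 * ((g 1 0 == 0) &&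
    ((t2 == (g 1 1)^-1) && (t1 == g 1 1 / det2 g)))%:R)); last first.
  by move=> t1 h1; apply: eq_bigr => t2 h2; rewrite E1.
case: eqP => [x0|x0]; last first.
  by rewrite big1 // => t1 h1; rewrite big1 // => t2 h2; rewrite mulr0.
have y0 := bottom_neq0 x0; have d0 := det2_neq0 g.
have z0 : g 1 1 / det2 g != 0 by rewrite mulf_neq0 ?invr_eq0.
have y1 : (g 1 1)^-1 != 0 by rewrite invr_eq0.
rewrite (bigD1 (g 1 1 / det2 g)) //= [X in _ + X]big1 ?addr0 => [|t1 /andP[h1 ne]]; last first.
  by rewrite big1 // => t2 h2; rewrite (negPf ne) !andbF mulr0.
rewrite (bigD1 (g 1 1)^-1) //= [X in _ + X]big1 ?addr0 => [|t2 /andP[h2 ne]]; last first.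
  by rewrite (negPf ne) mulr0.
rewrite !eqxx mulr1 /chr.
have -> : g 1 1 / det2 g / g 1 1 = (det2 g)^-1 by field; rewrite y0 d0.
by rewrite !fmorphV !exprVn !invrK.
Qed.

Lemma idem_ind1 i : idem i (ind1 E lv) = ext (wit i).
Proof.
rewrite /idem /wit; case: ifP => _; last by rewrite linear0.
rewrite -(ext_ind1 E lv); case: ifP => _; last by rewrite -ext_tor tor_ind1.
by rewrite -[LHS]/(- (hweyl (htor 0 i.1.2 _))) -ext_tor tor_ind1 -ext_weyl linearN.
Qed.

Lemma idem_bas i : idem i (ext (bas i)) = ext (bas i).
Proof.
have [vi|vi] := boolP (valid i); last by rewrite bas_invalid // linear0 /idem (negPf vi).
have torb : tor iota i.1.1 i.1.2 (bas i) = bas i.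
  rewrite tor_bas eqxx; apply: blk_eq => [z|]; last by rewrite mul1r.
  by rewrite scale1r.
rewrite /idem vi; case: ifP => [/andP[/eqP r0 lt]|_]; last by rewrite -ext_tor torb.
have {}torb : tor iota 0 i.1.2 (bas i) = bas i by move: torb; rewrite r0.
rewrite -[LHS]/(- (hweyl (htor 0 i.1.2 _))) -ext_tor torb -ext_weyl -linearN.
have o0 : (0 < i.2 <= n)%N by rewrite (leq_trans _ lt) //; exact: leq_ord.
by rewrite bas_vv // r0 (weyl1_vv0 _ _ o0) opprK.
Qed.

Lemma kernel_inv (h : HJ) c x y y' : K y -> K y' -> red y = red y' ->
  h (ext c) (x * y)%g = h (ext c) (x * y')%g.
Proof.
move=> Ky Ky' e; have [_ hc] := endGP h; have KV := lv_V Ky'.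
have KM : K (y'^-1 * y)%g by exact: lv_M.
have -> : (x * y = x * y' * (y'^-1 * y))%g by rewrite mulgA mulgK.
have fix_ext : rtrans (y'^-1 * y)%g (ext c) = ext c.
  rewrite -ext_rtrans // lv_redM // redV // e mulVg.
  by congr ext; apply: ind_inj => b; rewrite /= mulg1.
by have := congr1 (fun f : ind J E => h f (x * y')%g) fix_ext; rewrite hc.
Qed.

(** For such [g] the function [b -> h (ext c) (g * lft b)] belongs to [C] for all [h] and [c]. Every
    coset of [K] contains such a [g], by [good_exists]. *)
Definition good g := forall (h : HJ) c u b, unip2 u ->
  h (ext c) (g * lft (u * b))%g = h (ext c) (g * lft b)%g.

Lemma good_exists g : exists a, good (g * lft a)%g.
Proof.
have [a ha] := lv_unip lv (g^-1)%g; exists a => h c u b hu.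
have [t [Kt et Jt]] := ha u hu; have Kl := lv_liftP lv.
rewrite invgK in Jt.
have -> : h (ext c) (g * lft a * lft (u * b))%g = h (ext c) (g * (t * lft a * lft b))%g.
  rewrite -mulgA; apply: kernel_inv; try by do ?apply: lv_M.
  rewrite !lv_redM //; try by do ?apply: lv_M.
  by rewrite !lv_liftK et !mulgA mulgVK.
have -> : (g * (t * lft a * lft b) = g * t * g^-1 * (g * lft a * lft b))%g.
  by rewrite !mulgA mulgVK.
by rewrite (indP (h (ext c))).1.
Qed.

Section RightLocalization.
Variables (g : Gm) (gg : good g) (h : HJ).

Fact rloc_unip c : unip_inv (fun b => h (ext c) (g * lft b)%g : E).
Proof. by move=> u b hu; exact: gg. Qed.

Definition rloc_fun c : C := mkC (@rloc_unip c).

Fact rloc_equivariant :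
  rloc_fun \in equivariant_pred (fun x : GL2 k => rtrans x : {linear C -> C}).
Proof.
have [hl hc] := endGP h; have Kl := lv_liftP lv.
apply/asboolP; split=> [a c c'|x c]; apply: ind_inj => b.
  by rewrite -[LHS]/(h (ext _) _) linearP hl.
have ex : h (ext (rtrans x c)) = rtrans (lft x) (h (ext c)).
  by rewrite -{1}(lv_liftK lv x) ext_rtrans //; exact: hc.
rewrite -[LHS]/(h (ext (rtrans x c)) (g * lft b)%g) ex.
rewrite -[RHS]/(h (ext c) (g * lft (b * x))%g) -[LHS]/(h (ext c) (g * lft b * lft x)%g) -mulgA.
by apply: kernel_inv; rewrite ?lv_redM ?lv_liftK //; exact: lv_M.
Qed.
Definition rloc : H := EndG rloc_equivariant.

End RightLocalization.

Lemma rloc_sum g (gg : good g) (h : idx -> HJ) (c : idx -> C) b :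
  (\sum_i rloc gg (h i) (c i)) b = (\sum_i h i (ext (c i))) (g * lft b)%g.
Proof.
by elim/big_ind2: _ => [//|f f' f2 f2' e e'|i _ //]; rewrite -[LHS]/(f' b + f2' b) e e'.
Qed.

Lemma rloc_eq0 (h : HJ) c : (forall g (gg : good g), rloc gg h c = 0) -> h (ext c) = 0.
Proof.
move=> h0; apply: ind_inj => g; have [a ga] := good_exists g; have Kl := lv_liftP lv.
have := congr1 (fun f : C => f (a^-1)%g) (h0 _ ga).
rewrite -[X in X = _]/(h (ext c) (g * lft a * lft (a^-1))%g) => e.
rewrite -[RHS]e -{1}[g]mulg1 -mulgA; apply: kernel_inv; rewrite ?red1 ?lv_redM ?lv_liftK ?mulgV //.
  exact: lv_1.
exact: lv_M.
Qed.

(** A Hecke operator that kills [ind1] is zero, and [idem i] sends [ind1] to [ext (wit i)]. So the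
    claim can be tested on good cosets, where it is [relation_wit_vv]. *)
Lemma level_wit_vv (h : idx -> HJ) (i : idx) : (i.1.1 < i.2)%N ->
    (forall j g, J j -> (\sum_i h i (ext (bas i))) (g * j)%g = (\sum_i h i (ext (bas i))) g) ->
  h i * idem i = 0.
Proof.
move=> lt fJ; have [vi|vi] := boolP (valid i); last by rewrite /idem (negPf vi) mulr0.
apply: (hecke_eq0 (lv := lv)); rewrite -[LHS]/(h i (idem i _)) idem_ind1.
apply: rloc_eq0 => g gg; have Kl := lv_liftP lv.
apply: (relation_wit_vv bin_neq0 (h := fun i => rloc gg (h i))) => // u b hu.
rewrite !rloc_sum; have KV := lv_V (Kl b).
have Jj : J ((lft b)^-1 * lft (b * u))%g.
  apply/(lv_J lv); split; first exact: lv_M.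
  by rewrite lv_redM // redV // !lv_liftK mulKg.
by rewrite -[RHS](fJ _ _ Jj) !mulgA mulgK.
Qed.

Lemma level_wit (h : idx -> HJ) (i : idx) : \sum_i h i (ext (bas i)) = 0 -> h i * idem i = 0.
Proof.
move=> f0; have [vi|vi] := boolP (valid i); last by rewrite /idem (negPf vi) mulr0.
apply: (hecke_eq0 (lv := lv)); rewrite -[LHS]/(h i (idem i _)) idem_ind1.
apply: rloc_eq0 => g gg; apply: (relation_wit bin_neq0 (h := fun i => rloc gg (h i))) => //.
by apply: ind_inj => b; rewrite rloc_sum f0.
Qed.

Definition in_span (f : ind J E) := exists h : idx -> HJ, f = \sum_i h i (ext (bas i)).

Lemma in_span0 : in_span 0.
Proof. by exists (fun=> 0); rewrite big1. Qed.

Lemma in_spanD f f' : in_span f -> in_span f' -> in_span (f + f').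
Proof.
move=> [h ->] [h' ->]; exists (fun i => h i + h' i).
by rewrite -big_split; apply: eq_bigr => i _.
Qed.

Lemma in_span_hecke (t : HJ) f : in_span f -> in_span (t f).
Proof.
move=> [h ->]; exists (fun i => t * h i).
by rewrite (linear_fun_sum (endGP t).1).
Qed.

Lemma in_spanZ (a : E) f : in_span f -> in_span (a *: f).
Proof. by move=> h; apply: (in_span_hecke (hscal J a)). Qed.

Lemma in_span_bas i : in_span (ext (bas i)).
Proof.
exists (fun j => if j == i then 1 else 0); rewrite (bigD1 i) //= eqxx big1 ?addr0 //.
by move=> j /negPf ->.
Qed.

Lemma in_span_sum (I : Type) (s : seq I) (Q : pred I) (F : I -> ind J E) :
  (forall i, Q i -> in_span (F i)) -> in_span (\sum_(i <- s | Q i) F i).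
Proof. by move=> hF; elim/big_ind: _ => //; [exact: in_span0|exact: in_spanD]. Qed.

Lemma interpolation (P : k -> E) : exists2 p : {poly E}, (size p <= n.+1)%N &
  forall z, p.[iota z] = P z.
Proof.
pose L (y : k) : {poly E} := P y *: (1 - ('X - (iota y)%:P) ^+ n).
exists (\sum_y L y) => [|z].
  apply: (leq_trans (size_sum _ _ _)); apply/bigmax_leqP => y _.
  apply: (leq_trans (size_scale_leq _ _)); apply: (leq_trans (size_polyD _ _)).
  by rewrite size_polyN geq_max size_poly1 size_exp_XsubC ltnSn.
rewrite horner_sum (bigD1 z) //= big1 => [|y ne].
  by rewrite /L !hornerE subrr expr0n eqn0Ngt n_gt0 subr0 mulr1.
rewrite /L !hornerE -rmorphB iota_n ?subrr ?mulr0 //.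
by rewrite subr_eq0 eq_sym.
Qed.

Hypothesis B_par : forall b, B b -> B (par b).

Lemma blk_par (b : block) P a :
  blk iota (n - (par b).1) ((par b).2 + (par b).1) P a = blk iota b.1 b.2 P a.
Proof.
have e1 := congr1 (fun b : block => nat_of_ord b.1) (parK b).
have e2 := congr1 (fun b : block => nat_of_ord b.2) (parK b).
by apply: blk_mod; rewrite [RHS]modn_small ?ltn_ord.
Qed.

Lemma in_span_xi (b : block) : B b -> in_span (ext (xi iota b.1 b.2)).
Proof.
move=> Bb; have le : (b.1 < n.+1)%N by rewrite ltnS ltnW.
have vi : valid (b, Ordinal le) by rewrite /valid Bb leqnn.
by have := in_span_bas (b, Ordinal le); rewrite bas_xi ?ltnn.
Qed.

Lemma in_span_vv (b : block) o : B b -> (b.1 < o <= n)%N -> in_span (ext (vv iota b.1 b.2 o)).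
Proof.
move=> Bb /andP[lt le]; have oN : (o < n.+1)%N by [].
have vi : valid (b, Ordinal oN) by rewrite /valid Bb ltnW.
by have := in_span_bas (b, Ordinal oN); rewrite bas_vv.
Qed.

(** By interpolation it suffices to treat [z^o] with [o <= n]. For [o > r] this comes from [vv]; for
    [o = 0] and for [0 < o <= r] it comes from [weyl1] applied to [xi] and to [vv] in the block
    [par b], up to a multiple of [xi]. *)
Lemma in_span_blk (b : block) P a : B b -> in_span (ext (blk iota b.1 b.2 P a)).
Proof.
move=> Bb; have bN := ltn_ord b.1; have n0 := n_gt0 k.
have span_pow o : (o <= n)%N -> in_span (ext (blk iota b.1 b.2 (pw iota o) 0)).
  move=> oN; have [lt|ge] := ltnP b.1 o.
    pose c : E := ((b.1 == 0 :> nat) && (o == n))%:R.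
    have -> : blk iota b.1 b.2 (pw iota o) 0 = - c *: xi iota b.1 b.2 + vv iota b.1 b.2 o.
      by rewrite -blkD; apply: blk_eq => [z|]; rewrite ?mulr0 ?add0r // mulr1 addNr.
    rewrite linearD linearZ; apply: in_spanD; first by apply: in_spanZ; exact: in_span_xi.
    by apply: in_span_vv; rewrite ?lt.
  have Bp := B_par Bb; have pN := ltn_ord (par b).1.
  case: o oN ge => [|o] oN ge.
    have -> : blk iota b.1 b.2 (pw iota 0) 0 = weyl1 k E (xi iota (par b).1 (par b).2).
      by rewrite weyl1_xi // blk_par.
    by rewrite ext_weyl; apply: in_span_hecke; exact: in_span_xi.
  have r0 : (0 < b.1)%N by exact: leq_trans ge.
  have p1 : (par b).1 = (n - b.1)%N :> nat by rewrite par1 eqn0Ngt r0.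
  pose o' := (o.+1 + (n - b.1))%N.
  have ho' : ((par b).1 < o' <= n)%N.
    apply/andP; split; first by rewrite p1 /o' addSn ltnS leq_addl.
    by rewrite /o' -[X in (_ <= X)%N](subnKC (ltnW bN)) leq_add2r.
  have c0 : 'C(o', (par b).1)%:R != 0 :> E by apply: bin_neq0; rewrite // p1 subn_gt0.
  pose c : E := 'C(o', (par b).1)%:R.
  pose d : E := - ((-1) ^+ (par b).1 * (o' == n)%:R).
  have -> : blk iota b.1 b.2 (pw iota o.+1) 0 =
      (- c^-1) *: weyl1 k E (vv iota (par b).1 (par b).2 o') + (c^-1 * d) *: xi iota b.1 b.2.
    rewrite weyl1_vv // blk_par -[(c^-1 * d) *: _]blkZ -blkD.
    apply: blk_eq => [z|]; last by rewrite /d; ring.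
    rewrite mulr0 addr0 (_ : (o' - _)%N = o.+1); last by rewrite p1 /o' addnK.
    by rewrite mulrNN mulrA mulVf // mul1r.
  have sw : in_span (ext (weyl1 k E (vv iota (par b).1 (par b).2 o'))).
    by rewrite ext_weyl; apply: in_span_hecke; exact: in_span_vv.
  by rewrite linearD !linearZ; apply: in_spanD; apply: in_spanZ => //; exact: in_span_xi.
have [p sp hp] := interpolation P.
have -> : blk iota b.1 b.2 P a = a *: xi iota b.1 b.2 +
    \sum_(o < n.+1) blk iota b.1 b.2 (fun z => p`_o * pw iota o z) (p`_o * 0).
  rewrite blk_sum -blkD; apply: blk_eq => [z|]; rewrite ?mulr0 ?mulr1 ?add0r.
    by rewrite -hp (horner_coef_wide _ sp).
  by rewrite big1 ?addr0 // => o _; rewrite mulr0.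
rewrite linearD linear_sum linearZ; apply: in_spanD; first by apply: in_spanZ; exact: in_span_xi.
apply: in_span_sum => o _; rewrite blkZ linearZ; apply: in_spanZ.
by apply: span_pow; exact: leq_ord.
Qed.

(** For all blocks this is the characteristic function of [U] ([gen_C_full]), for the trivial block
    that of the Borel subgroup ([gen_C_trivial]). *)
Definition gen_C : C := \sum_(b | B b) xi iota b.1 b.2.

Lemma gen_rtrans x : K x -> in_span (rtrans x (ext gen_C)).
Proof.
move=> Kx.
have hb b : B b -> in_span (ext (rtrans (red x) (xi iota b.1 b.2))).
  move=> Bb; set c := rtrans _ _; have tc : torus_eqv iota b.1 b.2 c.
    move=> t1 t2 g h1 h2; rewrite -[LHS]/(xi iota b.1 b.2 (diag2 t1 t2 * g * red x)%g) -mulgA.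
    exact: blk_torus.
  by rewrite (blk_of tc); exact: in_span_blk.
rewrite -ext_rtrans // /gen_C linear_sum linear_sum.
by apply: in_span_sum => b /hb.
Qed.

Lemma xi_gen (b : block) : B b -> htor b.1 b.2 (ext gen_C) = ext (xi iota b.1 b.2).
Proof.
move=> Bb; rewrite -ext_tor; congr ext.
rewrite /gen_C (linear_fun_sum (endGP (tor iota b.1 b.2)).1) (bigD1 b) //=.
rewrite big1 ?addr0 => [|b' /andP[Bb' ne]]; first by rewrite [X in X = _]tor_blk !eqxx scale1r.
rewrite [X in X = _]tor_blk !modn_small ?ltn_ord // (_ : _ && _ = false) ?scale0r //.
apply/negP => /andP[/eqP e2 /eqP e1]; case/eqP: ne.
by apply: injective_projections; apply: val_inj.
Qed.

Lemma gen_xi : ext gen_C = \sum_(i : idx | ~~ (i.1.1 < i.2)%N) ext (bas i).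
Proof.
rewrite /gen_C linear_sum /= -(pair_big_dep xpredT (fun (b : block) (o : 'I_n.+1) => ~~ (b.1 < o)%N)
  (fun b o => ext (bas (b, o)))) /= big_mkcond; apply: eq_bigr => b _.
have le : (b.1 < n.+1)%N by rewrite ltnS ltnW.
rewrite (bigD1 (Ordinal le)) ?ltnn //= big1 ?addr0 => [|o /andP[ge ne]]; last first.
  rewrite bas_invalid ?linear0 // /valid /= negb_and -ltnNge orbC ltn_neqAle leqNgt ge andbT.
  by rewrite (_ : o != b.1 :> nat) //; apply: contra ne => /eqP e; apply/eqP/val_inj.
case: ifP => Bb; last by rewrite bas_invalid ?linear0 // /valid Bb.
by rewrite bas_xi ?ltnn // /valid Bb leqnn.
Qed.

Lemma bas_gen (i : idx) : ~~ (i.1.1 < i.2)%N -> exists h : HJ, ext (bas i) = h (ext gen_C).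
Proof.
move=> ge; have [vi|vi] := boolP (valid i); last first.
  by exists 0; rewrite bas_invalid ?linear0.
by exists (htor i.1.1 i.1.2); rewrite bas_xi // xi_gen //; case/andP: vi.
Qed.

End LevelBasis.

(** * Direct sums along a tree *)

Lemma rtransM (Gm : groupType) (J : set Gm) (E : fieldType) (x y : Gm) (f : ind J E) :
  rtrans (x * y)%g f = rtrans x (rtrans y f).
Proof. by apply: ind_inj => g /=; rewrite mulgA. Qed.

Lemma rtrans1 (Gm : groupType) (J : set Gm) (E : fieldType) (f : ind J E) :
  rtrans 1%g f = f.
Proof. by apply: ind_inj => g /=; rewrite mulg1. Qed.

Lemma hecke_rtrans (Gm : groupType) (J : set Gm) (E : fieldType) (h : hecke J E) x f :
  h (rtrans x f) = rtrans x (h f).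
Proof. by have [_ hc] := endGP h; exact: hc. Qed.

Section FullGenerator.
Variables (k : finFieldType) (E : fieldType) (iota : {rmorphism k -> E}).
Local Notation n := (#|k|.-1).
Local Notation block := ('I_n * 'I_n)%type.
Local Notation idx := (block * 'I_n.+1)%type.

Lemma sum_geom (x : k) : x != 0 -> \sum_(i < n) iota x ^+ i = - (x == 1)%:R.
Proof.
move=> x0; case: eqP => [->|/eqP ne].
  under eq_bigr => i _ do rewrite rmorph1 expr1n.
  by rewrite sumr_const card_ord -(rmorph_nat iota) natr_n rmorphN rmorph1.
apply: (mulfI (x := iota x - 1)); first by rewrite subr_eq0 -(rmorph1 iota) (inj_eq (fmorph_inj _)).
by rewrite -subrX1 iota_n // subrr oppr0 mulr0.
Qed.

Lemma gen_C_full : gen_C iota predT = ind1 E (fin_level k).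
Proof.
apply: ind_inj => g; rewrite ind1E.
have -> : gen_C iota predT g = \sum_(b : block) xi iota b.1 b.2 g.
  rewrite /gen_C; elim/big_ind2: _ => [//|f a f' a' <- <-//|b _ //].
under eq_bigr => b _ do rewrite xi_val.
rewrite -(pair_bigA _ (fun (b1 b2 : 'I_n) => if g 1 0 == 0 then
   iota (det2 g) ^+ b2 * iota (g 1 1) ^+ b1 else 0)) /=.
case: eqP => [x0|x0]; last first.
  by rewrite big1 => [|i _]; rewrite ?big1 //; case: asboolP => // -[].
have y0 := bottom_neq0 x0; have d0 := det2_neq0 g.
under eq_bigr => b _ do rewrite -mulr_suml sum_geom //.
rewrite -mulr_sumr sum_geom // mulrNN -natrM mulnb; congr (_%:R); congr nat_of_bool.
apply/andP/asboolP => [[/eqP d1 /eqP y1]|[_ a1 y1]].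
  by split=> //; move: d1; rewrite det2E x0 y1 mulr1 mulr0 subr0.
by rewrite det2E x0 y1 a1 mulr1 mulr0 subr0 eqxx.
Qed.

Hypothesis bin_neq0 : forall r o, (0 < r)%N -> (r < o <= n)%N -> 'C(o, r)%:R != 0 :> E.

Lemma fin_dual_basis : dual_basis (ind_hecke (@unip2 k) E).
Proof.
have bin (b : block) o : predT b -> (0 < b.1)%N -> (b.1 < o <= n)%N ->
  'C(o, b.1)%:R != 0 :> E by move=> _; exact: bin_neq0.
pose lv := fin_level k; pose M := ind_hecke (@unip2 k) E.
have extid (c : ind (@unip2 k) E) : ext lv c = c by apply/esym/ext_eq => // g []; split.
apply: (@idempotent_dual_basis _ M idx (fun i =>
  ext lv (bas iota predT i) : M) (idem iota lv predT)).
- by move=> i; exact: idem_bas.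
- move=> s c us s0 i si.
  have := @level_wit _ _ iota _ _ lv predT bin (fun i => if i \in s then c i else 0) i.
  rewrite si; apply; rewrite -[RHS]s0.
  rewrite [LHS](big_uniq_sub _ us) ?index_enum_uniq //; last 2 first.
  - by move=> j _; rewrite mem_index_enum.
  - by move=> j /negPf ->.
  by rewrite !big_seq; apply: eq_bigr => j ->.
move=> m; suff [h e] : in_span iota lv predT m.
  by exists [seq (i, h i) | i <- index_enum idx]; rewrite big_map; exact: e.
apply: (ind_gen (lv := lv) (P := in_span iota lv predT)) => [|a f f' h h'|x].
- exact: in_span0.
- by apply: in_spanD => //; exact: in_spanZ.
rewrite -(extid (ind1 E lv)) -gen_C_full; exact: gen_rtrans.
Qed.

End FullGenerator.

Section Tree.
Variables (k : finFieldType) (E : fieldType) (iota : {rmorphism k -> E}).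
Variables (Gm : groupType) (J : set Gm) (lv : level k J).
Local Notation n := (#|k|.-1).
Local Notation K := (lv_grp lv).
Local Notation red := (lv_red lv).
Local Notation HJ := (hecke J E).
Local Notation ext := (ext lv).
Local Notation block := ('I_n * 'I_n)%type.
Local Notation idx := (block * 'I_n.+1)%type.
Variable B : pred block.
Hypothesis bin_neq0 : forall b o, B b -> (0 < b.1)%N -> (b.1 < o <= n)%N ->
  'C(o, b.1)%:R != 0 :> E.
Hypothesis B_par : forall b, B b -> B (par b).
Local Notation bas i := (ext (bas iota B i)).
Local Notation idem := (idem iota lv B).
Local Notation u0 := (ext (gen_C iota B)).

Definition inv_K1 (f : ind J E) := forall y x, K y -> red y = 1%g -> f (x * y)%g = f x.
Definition inv_J (f : ind J E) := forall y x, J y -> f (x * y)%g = f x.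

Lemma inv_J_K1 f : inv_J f -> inv_K1 f.
Proof.
by move=> fJ y x Ky ry; apply: fJ; apply/(lv_J lv); rewrite ry; split=> //; exact: unip2_1.
Qed.

Lemma hecke_inv_K1 (h : HJ) c : inv_K1 (h (ext c)).
Proof.
move=> y x Ky ry; rewrite -[in RHS](mulg1 x); apply: kernel_inv => //; first exact: lv_1.
by rewrite ry red1.
Qed.

Lemma hecke_sum_inv_K1 (h : idx -> HJ) (c : idx -> ind (@unip2 k) E) :
  inv_K1 (\sum_i h i (ext (c i))).
Proof.
move=> y x Ky ry.
elim/big_ind: _ => [//|f f' e e'|i _]; last exact: hecke_inv_K1.
by rewrite -[LHS]/(f (x * y)%g + f' (x * y)%g) e e'.
Qed.

Variables (V : choiceType) (gam : V -> Gm) (dep : V -> nat).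
(* [beyond h]: the vertex [h] lies on the far side of the base edge, seen from the
   base vertex; [far] holds for the functions attached to such vertices. *)
Variables (beyond : Gm -> Prop) (far : ind J E -> Prop) (om : Gm).
Hypothesis far0 : far 0.
Hypothesis farD : forall f f', far f -> far f' -> far (f + f').
Hypothesis far_beyond : forall h f, beyond h -> inv_K1 f -> far (rtrans h f).
Hypothesis far_inv : forall f, inv_K1 f -> far f -> inv_J f.
Hypothesis beyond_gam : forall j j', j' != j -> (dep j' <= dep j)%N ->
  beyond ((gam j)^-1 * gam j')%g.
Hypothesis beyond_root : forall j, exists2 m, (forall y, J (m * y * m^-1)%g <-> J y) &
  beyond ((gam j)^-1 * m)%g.
Hypothesis om_gen : exists h : HJ, rtrans om u0 = h u0.
Hypothesis gam_rec : forall j, [\/ gam j = 1%g, gam j = om |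
  exists j' y, [/\ (dep j' < dep j)%N, K y & gam j = gam j' * y * om]%g].
Hypothesis gam_cover : forall g, exists j y z, [/\ K y, g = (gam j * y * z)%g &
  exists h : HJ, rtrans z u0 = h u0].

Local Notation X := (option V * idx)%type.

(** Excluded indices carry the vector 0 and the operator 0, which keeps the index set a full
    product. A vertex keeps the functions with [o > r]; those with [o = r] come from the parent, see
    [in_tree_gen]. *)
Definition tree_vec (x : X) : ind J E := match x.1 with
  | None => if (x.2.1.1 < x.2.2)%N then 0 else bas x.2
  | Some j => if (x.2.1.1 < x.2.2)%N then rtrans (gam j) (bas x.2) else 0
  end.

Definition tree_idem (x : X) : HJ := match x.1 with
  | None => if (x.2.1.1 < x.2.2)%N then 0 else idem x.2
  | Some j => if (x.2.1.1 < x.2.2)%N then idem x.2 else 0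
  end.

Lemma tree_idemE x : tree_idem x (tree_vec x) = tree_vec x.
Proof.
rewrite /tree_idem /tree_vec; case: x => -[j|] i /=; case: ifP => _ //; last exact: idem_bas.
by have [_ ->] := endGP (idem i); rewrite /= idem_bas.
Qed.

Lemma tree_vec_inv_K1 (h : HJ) j i : rtrans (gam j)^-1%g (h (tree_vec (Some j, i))) =
  if (i.1.1 < i.2)%N then h (bas i) else 0.
Proof.
have [hl hc] := endGP h; rewrite /tree_vec /=; case: ifP => _; last first.
  by rewrite (linear_fun0 hl) linear0.
by rewrite hecke_rtrans -rtransM mulVg rtrans1.
Qed.

Lemma gen_C_inv_J : inv_J u0.
Proof.
move=> y x /(lv_J lv)[Ky uy]; rewrite -[LHS]/(rtrans y u0 x) -ext_rtrans //.
congr (ext _ x); rewrite /gen_C linear_sum; apply: eq_bigr => b _; exact: xi_unip.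
Qed.

Lemma bas_inv_J (i : idx) : ~~ (i.1.1 < i.2)%N -> inv_J (bas i).
Proof.
move=> ge y x Jy; have [h ->] := @bas_gen _ _ iota _ _ lv B _ ge.
have [_ hc] := endGP h.
rewrite -[LHS]/(rtrans y (h u0) x) -hc; congr ((h _ : ind J E) x).
by apply: ind_inj => z; exact: gen_C_inv_J.
Qed.

Lemma tree_vec_far (h : HJ) j x : (forall i, x != (Some j, i)) ->
    (forall j' i, x = (Some j', i) -> (dep j' <= dep j)%N) ->
  far (rtrans (gam j)^-1%g (h (tree_vec x))).
Proof.
have [hl hc] := endGP h; case: x => -[j'|] i ne le; rewrite /tree_vec /=; case: ifP => lt;
  rewrite ?(linear_fun0 hl) ?linear0 //.
  rewrite hecke_rtrans -rtransM; apply: far_beyond; last exact: hecke_inv_K1.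
  apply: beyond_gam; last exact: le.
  by apply: contra_neq (ne i) => ->.
(* The functions at the base edge are right invariant under [J], which [m] normalises, so they can
   be seen from either end of the edge; [m] is an end lying beyond, as seen from [j]. *)
have [m nJ bm] := beyond_root j.
rewrite -[h _](rtrans1) -(mulgV m) rtransM -rtransM; apply: far_beyond => //.
apply: inv_J_K1 => y x Jy /=.
have hJ : inv_J (h (bas i)).
  move=> y' x' Jy'; rewrite -[LHS]/(rtrans y' (h (bas i)) x') -hc.
  congr ((h _ : ind J E) x'); apply: ind_inj => z.
  by apply: bas_inv_J; rewrite ?lt.
have -> : (x * y * m^-1 = x * m^-1 * (m * y * m^-1))%g by rewrite !mulgA mulgVK.
by apply: hJ; apply/nJ.
Qed.

(* A relation is killed at the deepest vertices first: translated to such a vertex,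
   all the other terms are [far], so the terms at that vertex have a sum which is
   right invariant under [J], and [level_wit_vv] applies. *)
Lemma tree_indep (s : seq X) (c : X -> HJ) : uniq s ->
  \sum_(x <- s) c x (tree_vec x) = 0 -> forall x, x \in s -> c x * tree_idem x = 0.
Proof.
move=> us s0.
have kill x : c x * tree_idem x = 0 -> c x (tree_vec x) = 0.
  by move=> e; rewrite -[in LHS]tree_idemE -[LHS]/((c x * tree_idem x) _) e.
pose D (x : X) : nat := if x.1 is Some j then (dep j).+1 else 0%N.
pose M := (\max_(x <- s) D x)%N.
have ltM j (i : idx) : (Some j, i) \in s -> (dep j < M)%N.
  by move=> xs; exact: (@leq_bigmax_seq X s xpredT D (Some j, i) xs isT).
have deep d : forall j i, (M - dep j < d)%N -> (Some j, i) \in s ->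
    c (Some j, i) * tree_idem (Some j, i) = 0.
  elim: d => // d IH j i jd xs.
  have {}IH j' i' : (Some j', i') \in s -> (dep j < dep j')%N ->
      c (Some j', i') (tree_vec (Some j', i')) = 0.
    move=> xs' lt; apply/kill/IH => //; rewrite -ltnS; apply: leq_trans jd.
    by rewrite ltnS ltn_sub2l // (ltM j i).
  rewrite /tree_idem /=; case: ifP => [lt|_]; last exact: mulr0.
  pose h i' := if (Some j, i') \in s then (if (i'.1.1 < i'.2)%N then c (Some j, i') else 0) else 0.
  have -> : c (Some j, i) = h i by rewrite /h xs lt.
  (* Translated to [j], the terms at [j] form a combination of the finite basis, and the relation
     equates it with minus all the other terms. *)
  have hs : \sum_(x <- s | x.1 != Some j) rtrans (gam j)^-1%g ((- c x) (tree_vec x)) =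
      \sum_i' h i' (bas i').
    have := congr1 (fun f => rtrans (gam j)^-1%g f) s0; rewrite linear0 linear_sum.
    rewrite (bigID (fun x : X => x.1 == Some j)) /= => /eqP.
    rewrite addrC addr_eq0 => /eqP e.
    rewrite (eq_bigr (fun x => - rtrans (gam j)^-1%g (c x (tree_vec x)))); last first.
      by move=> x _; apply: ind_inj.
    rewrite sumrN e opprK -big_filter.
    pose L := [seq (Some j, i') | i' <- enum {: idx} & (Some j, i') \in s].
    rewrite (perm_big L) /=; first rewrite /L big_map big_filter big_enum_cond /= big_mkcond.
      apply: eq_bigr => i' _; by rewrite tree_vec_inv_K1 /h; do 2 case: ifP => _ //.
    apply: uniq_perm; first exact: filter_uniq.
      by rewrite map_inj_uniq => [|a b []] //; apply: filter_uniq; exact: enum_uniq.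
    move=> [o i']; rewrite mem_filter; apply/andP/mapP => [[/eqP /= -> m]|[i2]].
      by exists i'; rewrite // mem_filter m mem_enum.
    by rewrite mem_filter => /andP[m _] [-> ->].
  apply: (level_wit_vv bin_neq0) => // y x Jy; rewrite -hs.
  apply: far_inv => //; first by rewrite hs; exact: hecke_sum_inv_K1.
  rewrite big_seq_cond; elim/big_ind: _ => // x' /andP[xs' ne].
  case: x' xs' ne => -[j'|] i' xs' ne; last by apply: tree_vec_far.
  have [le|lt'] := leqP (dep j') (dep j).
    apply: tree_vec_far => [i2|j2 i2 [<- _] //].
    by apply: contra_neq ne => -[-> _].
  have e0 : - rtrans (gam j)^-1%g (c (Some j', i') (tree_vec (Some j', i'))) = 0.
    by rewrite IH // linear0 oppr0.
  by move: far0; rewrite -e0; congr far; apply: ind_inj.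
have deep' j i : (Some j, i) \in s -> c (Some j, i) * tree_idem (Some j, i) = 0.
  by apply: (deep (M - dep j).+1).
move=> x xs; case: x xs => -[j|] i xs; first exact: deep'.
rewrite /tree_idem /=; case: ifP => [_|lt]; first exact: mulr0.
pose h i' := if (None, i') \in s then (if (i'.1.1 < i'.2)%N then 0 else c (None, i')) else 0.
have -> : c (None, i) = h i by rewrite /h xs lt.
apply: (level_wit bin_neq0); rewrite -[RHS]s0 [RHS](bigID (fun x : X => x.1 == None)) /=.
rewrite [X in _ = _ + X]big_seq_cond [X in _ = _ + X]big1 ?addr0 => [|x]; last first.
  by move=> /andP[]; case: x => -[j|] i' // xs' _; apply/kill/deep'.
pose L : seq X := [seq (None, i') | i' <- enum {: idx} & (None, i') \in s].
rewrite -[RHS]big_filter [RHS](perm_big L) /=;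
  first rewrite /L [RHS]big_map [RHS]big_filter [RHS]big_enum_cond /= [RHS]big_mkcond.
  apply: eq_bigr => i' _; rewrite /h /tree_vec /=; case: ifP => // _; case: ifP => // _.
  by rewrite (linear_fun0 (endGP _).1).
apply: uniq_perm; first exact: filter_uniq.
  by rewrite map_inj_uniq => [|a b []] //; apply: filter_uniq; exact: enum_uniq.
move=> [o i']; rewrite mem_filter; apply/andP/mapP => [[/eqP /= -> m]|[i2]].
  by exists i'; rewrite // mem_filter m mem_enum.
by rewrite mem_filter => /andP[m _] [-> ->].
Qed.
Definition in_tree (f : ind J E) := exists s : seq (X * HJ),
  f = \sum_(p <- s) p.2 (tree_vec p.1).

Lemma in_tree0 : in_tree 0. Proof. by exists [::]; rewrite big_nil. Qed.

Lemma in_treeD f f' : in_tree f -> in_tree f' -> in_tree (f + f').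
Proof. by move=> [s ->] [s' ->]; exists (s ++ s'); rewrite big_cat. Qed.

Lemma in_tree_hecke (h : HJ) f : in_tree f -> in_tree (h f).
Proof.
move=> [s ->]; exists [seq (p.1, h * p.2) | p <- s]; rewrite big_map.
by rewrite (linear_fun_sum (endGP h).1).
Qed.

Lemma in_treeZ (a : E) f : in_tree f -> in_tree (a *: f).
Proof. by move=> h; apply: (in_tree_hecke (hscal J a)). Qed.

Lemma in_tree_vec x : in_tree (tree_vec x).
Proof. by exists [:: (x, 1)]; rewrite big_seq1. Qed.

(** [om] exchanges the ends of the base edge and acts on [u0] as a Hecke operator. So
    [rtrans (gam j) u0] is obtained from a [K]-translate at the parent of [j], and the
    [K]-translates at [j] are generated by it and the functions with [o > r] at [j]. *)
Lemma in_tree_gen j y : K y -> in_tree (rtrans (gam j * y)%g u0).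
Proof.
have [d] := ubnP (dep j); elim: d j y => // d IH j y jd Ky.
have root : in_tree u0.
  rewrite gen_xi; elim/big_ind: _ => [||i ge]; [exact: in_tree0|exact: in_treeD|].
  by have := in_tree_vec (None, i); rewrite /tree_vec /= (negPf ge).
have base : in_tree (rtrans (gam j) u0).
  case: (gam_rec j) => [->|->|[j' [y' [lt Ky' ->]]]].
  - by rewrite rtrans1.
  - by have [h ->] := om_gen; exact: in_tree_hecke.
  have [h e] := om_gen; rewrite rtransM e.
  by rewrite -hecke_rtrans; apply/in_tree_hecke/IH => //; exact: leq_trans lt _.
have [h e] := @gen_rtrans _ _ iota _ _ lv B bin_neq0 B_par y Ky.
have hi i : in_tree (rtrans (gam j) (h i (bas i))).
  rewrite -hecke_rtrans; apply: in_tree_hecke; have [lt|ge] := boolP (i.1.1 < i.2)%N.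
    by have := in_tree_vec (Some j, i); rewrite /tree_vec /= lt.
  have [h' ->] := @bas_gen _ _ iota _ _ lv B _ ge.
  by rewrite -hecke_rtrans; exact: in_tree_hecke.
rewrite rtransM e linear_sum.
by elim/big_ind: _ => [||i _]; [exact: in_tree0|exact: in_treeD|exact: hi].
Qed.

Lemma in_tree_all g : in_tree (rtrans g u0).
Proof.
have [j [y [z [Ky -> [h e]]]]] := gam_cover g; rewrite rtransM e.
by rewrite -hecke_rtrans; apply: in_tree_hecke; exact: in_tree_gen.
Qed.

Variables (M : lmodType HJ) (inc : M -> ind J E).
Hypothesis inc_inj : injective inc.
Hypothesis incD : {morph inc : m m' / m + m'}.
Hypothesis incZ : forall h m, inc (h *: m) = h (inc m).
Hypothesis inc_gen : forall m, in_tree (inc m).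
Hypothesis inc_vec : forall x, exists m, inc m = tree_vec x.

(** Passing through [inc] lets one statement serve both for [ind J E] itself and for the submodule
    of functions invariant under the Iwahori subgroup; independence is inherited from [ind J E]. *)
Lemma tree_dual_basis : dual_basis M.
Proof.
have inc0 : inc 0 = 0 by rewrite -(scale0r 0) incZ.
have [v hv] : exists v : X -> M, forall x, inc (v x) = tree_vec x.
  by exists (fun x => sval (cid (inc_vec x))) => x; exact: (svalP (cid (inc_vec x))).
have inc_sum (I : Type) (s : seq I) (F : I -> M) :
    inc (\sum_(i <- s) F i) = \sum_(i <- s) inc (F i).
  exact: (big_morph inc incD inc0).
apply: (@idempotent_dual_basis _ M X v tree_idem).
- by move=> x; apply: inc_inj; rewrite incZ hv tree_idemE.
- move=> s c us s0; apply: tree_indep => //.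
  rewrite -[RHS]inc0 -s0 inc_sum; apply: eq_bigr => x _.
  by rewrite incZ hv.
move=> m; have [s e] := inc_gen m; exists s; apply: inc_inj; rewrite e inc_sum.
by apply: eq_bigr => p _; rewrite incZ hv.
Qed.

End Tree.

(** * The Iwahori subgroup *)

Section Uniformizer.
Variables (R : realType) (F : fieldType) (v : nonarch_abs R F).

Lemma expr_le_small (t y : R) : 0 <= t < 1 -> 0 < y -> exists m, t ^+ m <= y.
Proof.
move=> /andP[t0 t1] y0; have [->|tn0] := eqVneq t 0.
  by exists 1; rewrite expr1 ltW.
have tp : 0 < t by rewrite lt_neqAle eq_sym tn0.
have h1 : 0 < t^-1 - 1 by rewrite subr_gt0 invf_gt1.
have [m hm] : exists m : nat, y^-1 <= (t^-1 - 1) *+ m.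
  exists (Num.bound (y^-1 / (t^-1 - 1))).
  rewrite -mulr_natr mulrC -ler_pdivrMr //; apply/ltW.
  by apply: archi_boundP; apply: divr_ge0; [rewrite invr_ge0|]; exact: ltW.
exists m; have bern (x : R) i : 0 <= x -> x *+ i <= (1 + x) ^+ i.
  move=> x0; suff h : 1 + x *+ i <= (1 + x) ^+ i by apply: le_trans h; rewrite lerDr.
  elim: i => [|i IH]; first by rewrite mulr0n addr0 expr0.
  rewrite exprS; apply: (@le_trans _ _ ((1 + x) * (1 + x *+ i))); last first.
    by rewrite ler_wpM2l // addr_ge0.
  have -> : (1 + x) * (1 + x *+ i) = 1 + x *+ i.+1 + x * (x *+ i) by rewrite mulrS; ring.
  by rewrite lerDl mulr_ge0 // mulrn_wge0.
have := bern _ m (ltW h1); rewrite (_ : 1 + _ = t^-1) => [h2|]; last by ring.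
have := le_trans hm h2; rewrite exprVn.
by rewrite lef_pV2 // posrE ?exprn_gt0.
Qed.

(** If the absolute values below 1 had no maximum, there would be a sequence [u] with strictly
    increasing ones. Scaled by [b], it lies in a compact neighbourhood of 0; but for [i < j] the
    ultrametric inequality makes the distance of the scaled terms equal to
    [v (b * u j) >= v (b * a0)], which excludes a cluster point. *)
Lemma uniformizer : locally_compact [set: nabs_space v] ->
  exists w : F, [/\ w != 0, v w < 1 & forall x, v x < 1 -> v x <= v w].
Proof.
move=> lc; apply: contrapT => nex.
have step (x : F) : x != 0 -> v x < 1 -> exists y : F, v y < 1 /\ v x < v y.
  move=> x0 x1; apply: contrapT => h; apply: nex; exists x; split=> // y y1.
  by rewrite leNgt; apply/negP => xy; apply: h; exists y.
have [a0 a00 a01] : exists2 a : F, a != 0 & v a < 1.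
  have [a a0 a1] := nabs_nontrivial v; have va := nabs_gt0 v a0.
  have [lt|gt|e] := ltgtP (v a) 1; [by exists a| |by rewrite e eqxx in a1].
  by exists a^-1; rewrite ?invr_eq0 // nabsV invf_lt1.
pose next (x : F) : F := if pselect (exists y : F, v y < 1 /\ v x < v y) is left e
  then sval (cid e) else x.
pose u m : F := iter m next a0.
have uP m : [/\ u m != 0, v (u m) < 1 & v a0 <= v (u m)].
  elim: m => [|m [h1 h2 h3]]; first by split.
  rewrite /u iterS -/(u m) /next; case: pselect => [e|[]]; last exact: step.
  have [y1 lt] := svalP (cid e); split=> //.
    by apply/eqP => y0; move: lt; rewrite y0 nabs0 ltNge nabs_ge0.
  exact: le_trans h3 (ltW lt).
have uS m : v (u m) < v (u m.+1).
  rewrite /u iterS -/(u m) /next; case: pselect => [e|[]].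
    by have [] := svalP (cid e).
  by apply: step; have [] := uP m.
have ulT i j : (i < j)%N -> v (u i) < v (u j).
  elim: j => // j IH; rewrite ltnS leq_eqVlt => /orP[/eqP ->|/IH h]; first exact: uS.
  exact: lt_trans h (uS j).
pose o : nabs_space v := (0 : F); have [U UT [cU _]] := lc o I.
have U0 : nbhs o U by apply: (@filterS _ (nbhs o) (nbhs_filter o) _ _ _ UT) => t; apply.
have [e /= e0 eU] := (@nbhs_ballP R (nabs_space v) o U).1 U0.
have ballE (x y : nabs_space v) d : ball x d y = (v ((x : F) - y) < d).
  by rewrite (@ballEmdist R (nabs_space v)).
have [b b0 be] : exists2 b : F, b != 0 & v b < e.
  have [m hm] := @expr_le_small (v a0) (e / 2) (introT andP (conj (nabs_ge0 v a0) a01)) (divr_gt0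
    e0 (ltr0Sn R 1)).
  exists (a0 ^+ m); first by rewrite expf_neq0.
  have -> : v (a0 ^+ m) = v a0 ^+ m.
    by elim: (m) => [|i IH]; rewrite ?expr0 ?nabs1 // !exprS nabsM IH.
  apply: (le_lt_trans hm); rewrite ltr_pdivrMr // mulr_natr mulr2n ltrDl //.
pose w m : nabs_space v := b * u m.
have wU m : U (w m).
  apply: eU; rewrite ballE /w sub0r nabsN nabsM; have [_ u1 _] := uP m.
  by apply: le_lt_trans be; rewrite ler_piMr ?nabs_ge0 // ltW.
have Fw : (w @ \oo) U by exists 0%N => // m _; exact: wU.
have [p [Up clp]] := cU (w @ \oo) _ Fw.
have d0 : 0 < v (b * a0) by rewrite nabs_gt0 // mulf_neq0.
have Bp : nbhs p (ball p (v (b * a0))) by apply: nbhsx_ballx.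
have [y [[i _ <-]]] : (w @` setT) `&` ball p (v (b * a0)) !=set0.
  by apply: clp => //; exists 0%N => // m _; exists m.
rewrite ballE => hi.
have [y' [[j /= ij <-]]] : (w @` [set m | (i < m)%N]) `&` ball p (v (b * a0)) !=set0.
  by apply: clp => //; exists i.+1 => // m /= im; exists m.
rewrite ballE => hj.
have lt : v (w i : F) < v (w j : F).
  by rewrite /w !nabsM ltr_pM2l ?nabs_gt0 //; exact: ulT.
have dj : v (b * a0) <= v (w j : F).
  by rewrite /w !nabsM ler_pM2l ?nabs_gt0 //; have [] := uP j.
have : v (w j : F) < v (w j : F); last by rewrite ltxx.
have {1}-> : (w j : F) = (w i : F) + (((p : F) - w i) - ((p : F) - w j)) by ring.
apply: (le_lt_trans (nabs_max _ _ _)); rewrite gt_max lt /=.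
apply: (le_lt_trans (nabs_max _ _ _)); rewrite nabsN gt_max.
by rewrite !(lt_le_trans _ dj).
Qed.

End Uniformizer.

(** * Integral matrices and their reduction *)

Section IwahoriLevel.
Variables (R : realType) (F : fieldType) (v : nonarch_abs R F).
Variables (k : finFieldType) (red : residue_map v k).
Implicit Types (g h n : GL2 F) (x y : F).

Local Notation I := (iwahori red).
Local Notation I1 := (iwahori1 red).
Local Notation emb := (GL2_map (val : {rmorphism nabs_ring v -> F})).

Lemma nabs_addl x y c : v x <= c -> v y <= c -> v (x + y) <= c.
Proof. by move=> hx hy; apply: (le_trans (nabs_max _ _ _)); rewrite ge_max hx. Qed.

Lemma nabs_addlt x y c : v x < c -> v y < c -> v (x + y) < c.
Proof. by move=> hx hy; apply: (le_lt_trans (nabs_max _ _ _)); rewrite gt_max hx. Qed.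

Lemma nabs_addE x y : v y < v x -> v (x + y) = v x.
Proof.
move=> h; have le := nabs_addl (lexx (v x)) (ltW h).
apply/eqP; rewrite eq_le le leNgt; apply/negP => h'.
have : v (x + y - y) < v x by apply: nabs_addlt; rewrite ?nabsN.
by rewrite addrK ltxx.
Qed.

Definition maximal g := (forall i j, v (g i j) <= 1) /\ v (\det (GL2_mx g)) = 1.

Lemma maximalP g : maximal g <-> exists A, g = emb A.
Proof.
split=> [[h hd]|[A ->]]; first exact: iwahori_lift.
split=> [i j|]; first by rewrite mxE; exact: nabs_ringP.
have := GL2_unit A; rewrite unitmxE /= => uA.
have -> : \det (GL2_mx (emb A)) = val (\det (GL2_mx A)) by exact: det_map_mx.
exact/eqP.
Qed.

Lemma maximal_intro g : v (g 0 0) <= 1 -> v (g 0 1) <= 1 -> v (g 1 0) <= 1 ->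
  v (g 1 1) <= 1 -> v (det2 g) = 1 -> maximal g.
Proof.
by move=> h1 h2 h3 h4 hd; split=> // i j; case: (ord2 i) => ->; case: (ord2 j) => ->.
Qed.

Lemma emb_inj : injective emb.
Proof.
move=> A B /(congr1 (@GL2_mx F))/matrixP e; apply/val_inj/matrixP => i j.
by have := e i j; rewrite !mxE => h; exact: val_inj.
Qed.

Lemma maximal_1 : maximal 1%g.
Proof. by apply/maximalP; exists 1%g; rewrite GL2_map1. Qed.

Lemma maximal_M g h : maximal g -> maximal h -> maximal (g * h)%g.
Proof.
move=> /maximalP[A ->] /maximalP[B ->]; apply/maximalP; exists (A * B)%g.
by rewrite GL2_mapM.
Qed.

Lemma maximal_V g : maximal g -> maximal g^-1%g.
Proof. by move=> /maximalP[A ->]; apply/maximalP; exists A^-1%g; rewrite GL2_mapV. Qed.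

Definition reduct g : GL2 k :=
  if pselect (exists A, g = emb A) is left e then GL2_map red (sval (cid e)) else 1%g.

Lemma reduct_emb A : reduct (emb A) = GL2_map red A.
Proof.
rewrite /reduct; case: pselect => [e|[]]; last by exists A.
by rewrite -(emb_inj (svalP (cid e))).
Qed.

Lemma reductM g h : maximal g -> maximal h -> reduct (g * h)%g = (reduct g * reduct h)%g.
Proof.
move=> /maximalP[A ->] /maximalP[B ->]; rewrite -GL2_mapM !reduct_emb; exact: GL2_mapM.
Qed.

Lemma reductE g i j (x : nabs_ring v) : maximal g ->
  v (g i j - val x) < 1 <-> reduct g i j = red x.
Proof.
move=> /maximalP[A ->]; rewrite reduct_emb !mxE.
split=> [h|/eqP]; last first.
  by rewrite -subr_eq0 -rmorphB => /eqP/(resmap_ker red) /=.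
by apply/eqP; rewrite -subr_eq0 -rmorphB; apply/eqP/(resmap_ker red).
Qed.

Lemma reduct0 g i j : maximal g -> v (g i j) < 1 <-> reduct g i j = 0.
Proof.
by move=> M; have := reductE i j 0 M; rewrite !rmorph0 subr0.
Qed.

Lemma reduct1 g i j : maximal g -> v (g i j - 1) < 1 <-> reduct g i j = 1.
Proof. by move=> M; have := reductE i j 1 M; rewrite !rmorph1. Qed.

(** An arbitrary section of the residue map, not assumed multiplicative. *)
Definition teich (z : k) : nabs_ring v := sval (cid (resmap_surj red z)).

Lemma teichK z : red (teich z) = z.
Proof. exact: (svalP (cid (resmap_surj red z))). Qed.

Lemma residue_unit (A : nabs_ring v) : red A != 0 -> v A = 1.
Proof.
move=> h; apply/eqP; rewrite eq_le nabs_ringP leNgt; apply: contra h => h.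
by apply/eqP/(resmap_ker red).
Qed.

Lemma teich_sub z z' : z != z' -> v (val (teich z) - val (teich z')) = 1.
Proof.
move=> ne; apply: (@residue_unit (teich z - teich z')).
by rewrite rmorphB !teichK subr_eq0.
Qed.

Lemma reduct_surj a : exists A, GL2_map red A = a.
Proof.
pose A : 'M_2 := mx22 (teich (a 0 0)) (teich (a 0 1)) (teich (a 1 0)) (teich (a 1 1)).
have uA : A \in unitmx.
  rewrite unitmxE; apply: nabs_unit; apply: residue_unit.
  by rewrite det22 !mx22E rmorphB !rmorphM !teichK -det2E det2_neq0.
by exists (MkGL2 uA); apply: GL2_eq; rewrite mxE /= mx22E teichK.
Qed.

Definition lift_mx a : GL2 F := emb (sval (cid (reduct_surj a))).

Lemma lift_mxP a : maximal (lift_mx a).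
Proof. by apply/maximalP; eexists. Qed.

Lemma lift_mxK a : reduct (lift_mx a) = a.
Proof. by rewrite reduct_emb; exact: (svalP (cid (reduct_surj a))). Qed.

Lemma iwahori1P g : I1 g <-> maximal g /\ unip2 (reduct g).
Proof.
split=> [[A uA <-]|[/maximalP[A ->] u]].
  by split; [apply/maximalP; exists A|rewrite reduct_emb].
by exists A => //; rewrite /= -reduct_emb.
Qed.

Lemma iwahoriP g : I g <-> maximal g /\ v (g 1 0) < 1.
Proof.
split=> [Ig|[[hi hd] h]]; last exact: iwahori_intro.
by have [_ h _ _] := iwahori_elim Ig; split=> //; case: Ig => A _ <-; apply/maximalP; exists A.
Qed.

Lemma iwahori_maximal g : I g -> maximal g. Proof. by case/iwahoriP. Qed.
Lemma iwahori1_maximal g : I1 g -> maximal g. Proof. by case/iwahori1P. Qed.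

Definition up_type n := forall x, v x <= 1 -> I1 (n * up_mx x * n^-1)%g.
Definition lo_type n := forall x, v x <= 1 -> I1 (n * lo_mx x * n^-1)%g.

Lemma conj_iwahori1 (n y z : GL2 F) : (n * y = z * n)%g -> I1 z -> I1 (n * y * n^-1)%g.
Proof. by move=> ->; rewrite mulgK. Qed.

Lemma nabs_mulr x y z : z != 0 -> v x <= 1 -> v y <= v z -> v (x * y / z) <= 1.
Proof.
move=> z0 hx hy; rewrite !nabsM nabsV -mulrA mulr_ile1 ?nabs_ge0 //.
  by rewrite mulr_ge0 ?invr_ge0 ?nabs_ge0.
by rewrite ler_pdivrMr ?mul1r ?nabs_gt0.
Qed.

Lemma nabs_mulr_lt x y z : z != 0 -> v x <= 1 -> v y < v z -> v (x * y / z) < 1.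
Proof.
move=> z0 hx hy; rewrite !nabsM nabsV -mulrA.
apply: (@le_lt_trans _ _ (v y / v z)); last by rewrite ltr_pdivrMr ?mul1r ?nabs_gt0.
by rewrite ler_piMl // mulr_ge0 ?invr_ge0 ?nabs_ge0.
Qed.

Lemma monomial_type n : monomial n -> up_type n \/ lo_type n.
Proof.
have hd := det2_neq0 n; rewrite det2E in hd.
case=> -[e1 e2].
  rewrite e1 e2 mul0r subr0 mulf_eq0 negb_or in hd; case/andP: hd => a0 d0.
  have [le|lt] := leP (v (n 0 0)) (v (n 1 1)); [left|right] => x hx.
    apply: (@conj_iwahori1 _ _ (up_mx (x * n 0 0 / n 1 1))).
      have [f1 f2 f3 f4] := mul_upE x n.
      have [f5 f6 f7 f8] := up_mulE (x * n 0 0 / n 1 1) n.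
      by apply: GL2_eq; rewrite ?(f1, f2, f3, f4) ?(f5, f6, f7, f8) ?e1 ?e2; field.
    by apply: up_mx_iwahori1; exact: nabs_mulr.
  apply: (@conj_iwahori1 _ _ (lo_mx (x * n 1 1 / n 0 0))).
    have [f1 f2 f3 f4] := mul_loE x n.
    have [f5 f6 f7 f8] := lo_mulE (x * n 1 1 / n 0 0) n.
    by apply: GL2_eq; rewrite ?(f1, f2, f3, f4) ?(f5, f6, f7, f8) ?e1 ?e2; field.
  by apply: lo_mx_iwahori1; exact: nabs_mulr_lt.
rewrite e1 mul0r sub0r oppr_eq0 mulf_eq0 negb_or in hd; case/andP: hd => b0 c0.
have [le|lt] := leP (v (n 0 1)) (v (n 1 0)); [right|left] => x hx.
  apply: (@conj_iwahori1 _ _ (up_mx (x * n 0 1 / n 1 0))).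
    have [f1 f2 f3 f4] := mul_loE x n.
    have [f5 f6 f7 f8] := up_mulE (x * n 0 1 / n 1 0) n.
    by apply: GL2_eq; rewrite ?(f1, f2, f3, f4) ?(f5, f6, f7, f8) ?e1 ?e2; field.
  by apply: up_mx_iwahori1; exact: nabs_mulr.
apply: (@conj_iwahori1 _ _ (lo_mx (x * n 1 0 / n 0 1))).
  have [f1 f2 f3 f4] := mul_upE x n.
  have [f5 f6 f7 f8] := lo_mulE (x * n 1 0 / n 0 1) n.
  by apply: GL2_eq; rewrite ?(f1, f2, f3, f4) ?(f5, f6, f7, f8) ?e1 ?e2; field.
by apply: lo_mx_iwahori1; exact: nabs_mulr_lt.
Qed.

Lemma up_mxE x : (up_mx x 0 0 = 1) * (up_mx x 0 1 = x) * (up_mx x 1 0 = 0) * (up_mx x 1 1 = 1).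
Proof. by rewrite !mx22E. Qed.
Lemma lo_mxE x : (lo_mx x 0 0 = 1) * (lo_mx x 0 1 = 0) * (lo_mx x 1 0 = x) * (lo_mx x 1 1 = 1).
Proof. by rewrite !mx22E. Qed.

Lemma maximal_up x : v x <= 1 -> maximal (up_mx x).
Proof. by move=> hx; apply: iwahori1_maximal; exact: up_mx_iwahori1. Qed.

Lemma maximal_lo x : v x <= 1 -> maximal (lo_mx x).
Proof.
move=> hx; apply: maximal_intro; rewrite ?det2E !lo_mxE ?nabs0 ?nabs1 ?ler01 //.
by rewrite mul0r mulr1 subr0 nabs1.
Qed.

Lemma reduct_up (x : nabs_ring v) : reduct (up_mx (val x)) = unip_u (red x).
Proof.
have M := maximal_up (nabs_ringP x); have E := gl22E (unip_u_det (red x)).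
apply: GL2_eq; rewrite E.
- by apply/(reduct1 _ _ M); rewrite up_mxE subrr nabs0.
- by apply/(reductE _ _ _ M); rewrite up_mxE subrr nabs0.
- by apply/(reduct0 _ _ M); rewrite up_mxE nabs0.
- by apply/(reduct1 _ _ M); rewrite up_mxE subrr nabs0.
Qed.

Lemma reduct_lo (x : nabs_ring v) :
  (reduct (lo_mx (- val x)) * weyl_u 0 = weyl_u 0 * unip_u (red x))%g.
Proof.
have M : maximal (lo_mx (- val x)) by apply: maximal_lo; rewrite nabsN nabs_ringP.
have E := gl22E (unip_u_det (red x)); have E' := gl22E (weyl_u_det (0 : k)).
have e00 : reduct (lo_mx (- val x)) 0 0 = 1.
  by apply/(reduct1 _ _ M); rewrite lo_mxE subrr nabs0.
have e01 : reduct (lo_mx (- val x)) 0 1 = 0.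
  by apply/(reduct0 _ _ M); rewrite lo_mxE nabs0.
have e10 : reduct (lo_mx (- val x)) 1 0 = - red x.
  have <- : red (- x) = - red x by rewrite rmorphN.
  by apply/(reductE _ _ _ M); rewrite lo_mxE rmorphN subrr nabs0.
have e11 : reduct (lo_mx (- val x)) 1 1 = 1.
  by apply/(reduct1 _ _ M); rewrite lo_mxE subrr nabs0.
by apply: GL2_eq; rewrite !GL2_mulE ?e00 ?e01 ?e10 ?e11 !E' !E; ring.
Qed.

(** Write [g^-1 = i n j] with [n] monomial. Conjugation by [n] sends the upper or the lower
    unipotent integral matrices into [I1], and [I1] is stable under conjugation by [i]. In the lower
    case the Weyl element relates lower to upper matrices, whence the factor [weyl_u 0]. *)
Lemma iwahori_unip g : exists a, forall u, unip2 u ->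
  exists t, [/\ maximal t, reduct t = (a * u * a^-1)%g & I1 (g^-1 * t * g)%g].
Proof.
have [i [n [j [Ii mn Ij e]]]] := iwahori_decomposition red g^-1%g.
have Mj := iwahori_maximal Ij; have MV := maximal_V Mj.
have conj (y : GL2 F) : I1 (n * y * n^-1)%g -> I1 (g^-1 * (j^-1 * y * j) * g)%g.
  move=> h; rewrite -[X in I1 (_ * X)%g]invgK e.
  have -> : (i * n * j * (j^-1 * y * j) * (i * n * j)^-1 = i * (n * y * n^-1) * i^-1)%g.
    by rewrite !invgM !mulgA !mulgK.
  by apply: iwahori1_M; [exact: iwahori1_M|exact: iwahori1_V].
have rj : reduct (j^-1)%g = (reduct j)^-1%g.
  apply: (mulgI (reduct j)); rewrite -reductM // !mulgV.
  rewrite -[1%g](GL2_map1 (val : {rmorphism nabs_ring v -> F})) reduct_emb; exact: GL2_map1.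
have red3 (y : GL2 F) : maximal y -> reduct (j^-1 * y * j)%g = ((reduct j)^-1 * reduct y * reduct
  j)%g.
  by move=> My; rewrite !reductM ?rj //; exact: maximal_M.
have [h|h] := monomial_type mn.
  exists (reduct j)^-1%g => u /unip2_u ->; move: (u 0 1) => z.
  have My := maximal_up (nabs_ringP (teich z)).
  exists (j^-1 * up_mx (val (teich z)) * j)%g; split.
  - by apply: maximal_M => //; exact: maximal_M.
  - by rewrite red3 // reduct_up teichK invgK.
  - by apply/conj/h; exact: nabs_ringP.
exists ((reduct j)^-1 * weyl_u 0)%g => u /unip2_u ->; move: (u 0 1) => z.
have lez : v (- val (teich z)) <= 1 by rewrite nabsN; exact: nabs_ringP.
have My := maximal_lo lez.
exists (j^-1 * lo_mx (- val (teich z)) * j)%g; split.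
- by apply: maximal_M => //; exact: maximal_M.
- rewrite red3 // invgM invgK !mulgA -[(_ * weyl_u 0 * unip_u z)%g]mulgA.
  by rewrite -[in RHS](teichK z) -reduct_lo !mulgA mulgK.
- exact/conj/h.
Qed.

Definition iwahori_level : level k I1 :=
  Level maximal_1 maximal_M maximal_V reductM lift_mxP lift_mxK iwahori1P iwahori_unip.

End IwahoriLevel.

(** * The tree and its vertices *)

Section IwahoriTree.
Variables (R : realType) (F : fieldType) (v : nonarch_abs R F).
Variables (k : finFieldType) (red : residue_map v k).
Variable w : F.
Hypothesis w0 : w != 0.
Hypothesis w1 : v w < 1.
Hypothesis w_max : forall x, v x < 1 -> v x <= v w.
Implicit Types (g h n y : GL2 F) (z : k) (s : seq k).

Local Notation I := (iwahori red).
Local Notation I1 := (iwahori1 red).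
Local Notation K := (maximal v).
Local Notation "[ z ]" := (val (teich red z)) (at level 0, z at level 99).

Lemma om_det : 0 * 0 - 1 * w != 0. Proof. by rewrite mul0r mul1r sub0r oppr_eq0. Qed.
Lemma stp_det z : w * 1 - [z] * 0 != 0. Proof. by rewrite mulr0 mulr1 subr0. Qed.
Lemma turn_det z : [z] * 0 - 1 * 1 != 0.
Proof. by rewrite mulr0 mulr1 sub0r oppr_eq0 oner_neq0. Qed.

Definition om : GL2 F := gl22 0 1 w 0.
Definition stp z : GL2 F := gl22 w [z] 0 1.
Definition turn z : GL2 F := gl22 [z] 1 1 0.

Lemma omE : (om 0 0 = 0) * (om 0 1 = 1) * (om 1 0 = w) * (om 1 1 = 0).
Proof. exact: gl22E om_det. Qed.
Lemma stpE z : (stp z 0 0 = w) * (stp z 0 1 = [z]) * (stp z 1 0 = 0) * (stp z 1 1 = 1).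
Proof. exact: gl22E (stp_det z). Qed.
Lemma turnE z :
  (turn z 0 0 = [z]) * (turn z 0 1 = 1) * (turn z 1 0 = 1) * (turn z 1 1 = 0).
Proof. exact: gl22E (turn_det z). Qed.

Lemma stp_turn z : stp z = (turn z * om)%g.
Proof. by apply: GL2_eq; rewrite GL2_mulE !turnE !omE !stpE; ring. Qed.

Lemma K_turn z : K (turn z).
Proof.
apply: maximal_intro; rewrite ?det2E !turnE ?nabs0 ?nabs1 ?ler01 ?nabs_ringP //.
by rewrite mulr0 mulr1 sub0r nabsN nabs1.
Qed.

Definition central (c : GL2 F) := forall g, (c * g = g * c)%g.

Lemma centralM (c c' : GL2 F) : central c -> central c' -> central (c * c')%g.
Proof. by move=> cc cc' g; rewrite -mulgA cc' !mulgA cc. Qed.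

Lemma scalar_central (c : F) : c != 0 -> central (diag2 c c).
Proof.
move=> c0 g; have [e1 e2 e3 e4] := diag2E g c0 c0; have E := gl22E (diag2_det c0 c0).
by apply: GL2_eq; rewrite ?(e1, e2, e3, e4) GL2_mulE /diag2 !E; ring.
Qed.

Lemma om_om : (om * om = diag2 w w)%g.
Proof.
by apply: GL2_eq; rewrite GL2_mulE !omE (gl22E (diag2_det w0 w0)); ring.
Qed.

Lemma om_central : central (om * om)%g.
Proof. by rewrite om_om; exact: scalar_central. Qed.

Definition om_conj y : GL2 F := (om * y * om^-1)%g.

Lemma om_conjE y : [/\ om_conj y 0 0 = y 1 1, om_conj y 0 1 = y 1 0 / w,
  om_conj y 1 0 = w * y 0 1 & om_conj y 1 1 = y 0 0].
Proof.
have : (om_conj y * om = om * y)%g by exact: mulgVK.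
move: (om_conj y) => y' e.
have ent i j := congr1 (fun g : GL2 F => g i j) e.
have := (ent 0 0, ent 0 1, ent 1 0, ent 1 1); rewrite !GL2_mulE !omE.
rewrite !mulr0 !mul0r !add0r !addr0 !mul1r !mulr1 => -[[[<- ->] e10] ->].
by split; rewrite ?mulfK //; apply: (mulIf w0); rewrite e10 mulrC.
Qed.

Lemma om_conjK y : om_conj (om_conj y) = y.
Proof.
have -> : om_conj (om_conj y) = (om * om * y * (om * om)^-1)%g.
  by rewrite invgM /om_conj !mulgA.
by rewrite om_central mulgK.
Qed.

Lemma om_conj_I y : I y -> I (om_conj y).
Proof.
move=> /iwahori_elim[h h10 h00 h11]; have [e00 e01 e10 e11] := om_conjE y.
have w1' : v (y 1 0 / w) <= 1.
  by rewrite nabsM nabsV ler_pdivrMr ?mul1r ?nabs_gt0 //; exact: w_max.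
have lt : v (w * y 0 1) < 1.
  by rewrite nabsM; apply: le_lt_trans w1; rewrite ler_piMr ?nabs_ge0.
apply/iwahoriP; split; last by rewrite e10.
apply: maximal_intro; rewrite ?e00 ?e01 ?e10 ?e11 ?h // ?ltW //.
rewrite /om_conj !det2M mulrAC -det2M mulgV.
have -> : det2 (1%g : GL2 F) = 1 by rewrite det2E !GL2_1E mulr0 mulr1 subr0.
rewrite mul1r det2E nabs_addE ?nabsM ?h00 ?h11 ?mulr1 //.
rewrite nabsN nabsM; apply: le_lt_trans h10; rewrite ler_piMl ?nabs_ge0 //.
Qed.

Lemma iwahori1_diag y : I1 y <-> [/\ I y, v (y 0 0 - 1) < 1 & v (y 1 1 - 1) < 1].
Proof.
split=> [Iy|[Iy h0 h1]].
  have [My [r0 r1 r2]] := (iwahori1P red y).1 Iy.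
  by split; [exact: iwahori1_sub|apply/(reduct1 red)..].
have [h h10 _ _] := iwahori_elim Iy; have [[_ hd] _] := (iwahoriP red y).1 Iy.
exact: iwahori1_intro.
Qed.

Lemma om_conj_I1 y : I1 y -> I1 (om_conj y).
Proof.
move=> /iwahori1_diag[Iy h0 h1]; have [e00 _ _ e11] := om_conjE y.
by apply/iwahori1_diag; rewrite e00 e11; split=> //; exact: om_conj_I.
Qed.

Lemma om_norm_I y : I (om_conj y) <-> I y.
Proof. by split=> [/om_conj_I|]; [rewrite om_conjK|exact: om_conj_I]. Qed.

Lemma om_norm_I1 y : I1 (om_conj y) <-> I1 y.
Proof. by split=> [/om_conj_I1|]; [rewrite om_conjK|exact: om_conj_I1]. Qed.

(* The vertices of the tree are reached from the two ends of the base edge by walks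
   away from it; [stp] sends a vertex to its neighbours that are not closer. *)
Definition walk s : GL2 F := foldr (fun z g => stp z * g)%g 1%g s.
Definition vertex := (bool * seq k)%type.
(** [gam j] carries the base edge, which joins 1 and [om], to the edge from [j] to its parent; for
    an empty walk the parent is the other end of the base edge. *)
Definition gam (j : vertex) : GL2 F := ((if j.1 then om else 1) * walk j.2)%g.
Definition dep (j : vertex) := size j.2.

Lemma walk_rcons s z : walk (rcons s z) = (walk s * stp z)%g.
Proof. by elim: s => [|x s IH] /=; rewrite ?mulg1 ?mul1g // -/(walk _) IH mulgA. Qed.

Lemma walkE s : [/\ walk s 1 0 = 0, walk s 1 1 = 1, v (walk s 0 0) <= 1 & v (walk s 0 1) <= 1].
Proof.
elim: s => [|x s [h1 h2 h3 h4]] /=; first by rewrite !GL2_1E nabs1 nabs0 ler01 lexx.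
rewrite -/(walk s) !GL2_mulE !stpE h1 h2 !mul0r !mulr0 !mulr1 !add0r !addr0; split=> //.
  by rewrite nabsM mulr_ile1 ?nabs_ge0 // ltW.
by apply: nabs_addl; rewrite ?nabs_ringP // nabsM mulr_ile1 ?nabs_ge0 // ltW.
Qed.

Definition rn (i : 'I_2) g : R := Num.max (v (g i 0)) (v (g i 1)).
(** Row norms are invariant under right multiplication by [K] and scaled together by the centre, so
    this is a property of the vertex of [g]. It holds for [om] and fails for 1. *)
Definition beyond g := rn 1 g < rn 0 g.

Lemma rn_le i g c : rn i g <= c <-> v (g i 0) <= c /\ v (g i 1) <= c.
Proof. by rewrite /rn ge_max; split=> [/andP[]|[-> ->]]. Qed.

Lemma le_rn i j g : v (g i j) <= rn i g.
Proof. by rewrite /rn le_max; case: (ord2 j) => ->; rewrite lexx ?orbT. Qed.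

Lemma stp_mul z g j : (stp z * g)%g 0 j = w * g 0 j + [z] * g 1 j /\ (stp z * g)%g 1 j = g 1 j.
Proof. by rewrite !GL2_mulE !stpE; split; ring. Qed.

(** By contraposition: left multiplication by [stp z] preserves [rn 0 <= rn 1]. What lies beyond the
    base edge stays behind after a step away from it. *)
Lemma beyond_stp z g : beyond g -> beyond ((stp z)^-1 * g)%g.
Proof.
set h := (_ * g)%g; have -> : g = (stp z * h)%g by rewrite mulVKg.
rewrite /beyond !ltNge; apply: contra => le.
have e1 : rn 1 (stp z * h)%g = rn 1 h.
  by rewrite /rn; have [_ ->] := stp_mul z h 0; have [_ ->] := stp_mul z h 1.
have col j : v ((stp z * h)%g 0 j) <= rn 1 h.
  have [-> _] := stp_mul z h j; apply: nabs_addl.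
    rewrite nabsM; apply: le_trans le; apply: le_trans (le_rn 0 j h).
    by rewrite ler_piMl ?nabs_ge0 // ltW.
  by rewrite nabsM; apply: le_trans (le_rn 1 j h); rewrite ler_piMl ?nabs_ge0 ?nabs_ringP.
by rewrite e1; apply/rn_le.
Qed.

Lemma beyond_walk s g : beyond g -> beyond ((walk s)^-1 * g)%g.
Proof.
elim: s g => [|z s IH] g bg /=; first by rewrite invg1 mul1g.
by rewrite -/(walk s) invgM -mulgA; apply/IH/beyond_stp.
Qed.

Lemma beyond_intro g j : 1 < v (g 0 j) -> v (g 1 0) <= 1 -> v (g 1 1) <= 1 -> beyond g.
Proof.
move=> lt h0 h1; have le1 : rn 1 g <= 1 by apply/rn_le.
exact: (le_lt_trans le1 (lt_le_trans lt (le_rn 0 j g))).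
Qed.

Lemma inv_w : 1 < v w^-1.
Proof. by rewrite nabsV invf_gt1 // nabs_gt0. Qed.

Lemma beyond_fork z g j : v (g 1 0) <= 1 -> v (g 1 1) <= 1 ->
  v (g 0 j - [z] * g 1 j) = 1 -> beyond ((stp z)^-1 * g)%g.
Proof.
set h := (_ * g)%g; have -> : g = (stp z * h)%g by rewrite mulVKg.
have [_ ->] := stp_mul z h 0; have [_ ->] := stp_mul z h 1; have [-> ->] := stp_mul z h j.
rewrite addrK nabsM => h0 h1 e; apply: (@beyond_intro _ j) => //.
suff -> : v (h 0 j) = v w^-1 by exact: inv_w.
have vw : v w != 0 by rewrite lt0r_neq0 ?nabs_gt0.
by apply: (mulfI vw); rewrite e nabsV divff.
Qed.

Lemma beyond_om s : beyond (om * walk s)%g.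
Proof.
have [h1 h2 h3 h4] := walkE s; rewrite /beyond.
have le : rn 1 (om * walk s)%g <= v w.
  apply/rn_le; rewrite !GL2_mulE !omE !mul0r !addr0 !nabsM.
  by rewrite !ler_piMr ?nabs_ge0.
apply: (le_lt_trans le); apply: (lt_le_trans w1); apply: le_trans (le_rn 0 1 _).
by rewrite GL2_mulE !omE h2 mul0r mul1r add0r nabs1.
Qed.

Lemma beyond_omV s : beyond (om^-1 * walk s)%g.
Proof.
have [h1 h2 h3 h4] := walkE s; set h := (_ * _)%g.
have e : (om * h = walk s)%g by rewrite /h mulVKg.
clearbody h.
move: h2 h3 h4; rewrite -e !GL2_mulE !omE !mul0r !mul1r !addr0 !add0r => h2 h3 h4.
apply: (@beyond_intro _ 1) => //; suff -> : h 0 1 = w^-1 by exact: inv_w.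
by apply: (mulfI w0); rewrite h2 divff.
Qed.

(** A common first letter cancels. Where the letters differ, the difference of their representatives
    is a unit and [beyond_fork] applies, as it does when [s'] is a proper prefix of [s]. The bound
    on the sizes excludes the opposite case. *)
Lemma beyond_walks s s' : s' != s -> (size s' <= size s)%N ->
  beyond ((walk s)^-1 * walk s')%g.
Proof.
elim: s s' => [|z s IH] [|z' s'] //= ne le; rewrite -?/(walk _) invgM -mulgA; last first.
  have [ez|nz] := eqVneq z' z.
    by rewrite ez mulKg; apply: IH => //; move: ne; rewrite ez eqseq_cons eqxx.
  apply: beyond_walk; apply: (@beyond_fork _ _ 1).
  - by have [_ ->] := stp_mul z' (walk s') 0; have [-> _ _ _] := walkE s'; rewrite nabs0 ler01.
  - by have [_ ->] := stp_mul z' (walk s') 1; have [_ -> _ _] := walkE s'; rewrite nabs1.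
  have [-> ->] := stp_mul z' (walk s') 1; have [_ -> _ le1] := walkE s'.
  rewrite !mulr1 -addrA addrC nabs_addE teich_sub // nabsM.
  by apply: le_lt_trans w1; rewrite ler_piMr ?nabs_ge0.
apply: beyond_walk; apply: (@beyond_fork _ _ 0); rewrite !GL2_1E ?nabs0 ?nabs1 ?ler01 //.
by rewrite mulr0 subr0 nabs1.
Qed.

Lemma beyond_gam j j' : j' != j -> (dep j' <= dep j)%N -> beyond ((gam j)^-1 * gam j')%g.
Proof.
case: j => b s; case: j' => b' s' ne le; rewrite /gam /dep /= in ne le *.
rewrite invgM -!mulgA; case: b b' ne => -[] ne /=; rewrite ?invg1 ?mul1g.
- by rewrite mulKg; apply: beyond_walks => //; apply: contra_neq ne => ->.
- by apply/beyond_walk/beyond_omV.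
- by apply/beyond_walk/beyond_om.
- by apply: beyond_walks => //; apply: contra_neq ne => ->.
Qed.

Lemma beyond_root j : exists2 m, (forall y, I1 (m * y * m^-1)%g <-> I1 y) &
  beyond ((gam j)^-1 * m)%g.
Proof.
case: j => -[] s; rewrite /gam /=; [exists 1%g|exists om].
- by move=> y; rewrite mul1g invg1 mulg1.
- rewrite mulg1 invgM; apply: beyond_walk.
  by have := beyond_omV [::]; rewrite /= mulg1.
- exact: om_norm_I1.
- by rewrite mul1g; apply: beyond_walk; have := beyond_om [::]; rewrite /= mulg1.
Qed.

Lemma gam_rcons b s z : gam (b, rcons s z) = (gam (b, s) * stp z)%g.
Proof. by rewrite /gam /= walk_rcons mulgA. Qed.

Lemma gam_rec j : [\/ gam j = 1%g, gam j = om |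
  exists j' y, [/\ (dep j' < dep j)%N, K y & gam j = gam j' * y * om]%g].
Proof.
case: j => b s; case/lastP: s => [|s z].
  by rewrite /gam /= mulg1; case: b; [constructor 2|constructor 1].
constructor 3; exists (b, s), (turn z); split; [|exact: K_turn|].
  by rewrite /dep /= size_rcons.
by rewrite gam_rcons stp_turn mulgA.
Qed.

Definition cov g := exists j y c, [/\ K y, central c & g = (gam j * y * c)%g].
Definition stab h := forall g, cov g -> cov (g * h)%g.

Lemma stabM h h' : stab h -> stab h' -> stab (h * h')%g.
Proof. by move=> sh sh' g /sh/sh'; rewrite mulgA. Qed.

Lemma stabK h : K h -> stab h.
Proof.
move=> Kh g [j [y [z [Ky cz ->]]]]; exists j, (y * h)%g, z; split=> //; first exact: maximal_M.
by rewrite -!mulgA cz.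
Qed.

Lemma stab_central h : central h -> stab h.
Proof.
move=> Ch g [j [y [z [Ky cz ->]]]]; exists j, y, (z * h)%g; split=> //; first exact: centralM.
by rewrite !mulgA.
Qed.

Lemma K_turn_I y : K y -> I y \/ exists z y', I y' /\ y = (turn z * y')%g.
Proof.
move=> Ky; have [h hd] := Ky.
have [lt|ge] := ltP (v (y 1 0)) 1; first by left; apply/iwahoriP.
right; have e1 : v (y 1 0) = 1 by apply/eqP; rewrite eq_le h.
have n0 := nabs1_neq0 e1.
have le : v (y 0 0 / y 1 0) <= 1 by rewrite nabsM nabsV e1 invr1 mulr1.
pose x := to_ring v (y 0 0 / y 1 0); exists (red x), ((turn (red x))^-1 * y)%g.
split; last by rewrite mulVKg.
set y' := (_ * y)%g; have e : (turn (red x) * y' = y)%g by rewrite /y' mulVKg.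
have Ky' : K y' by apply: maximal_M => //; apply/maximal_V/K_turn.
apply/iwahoriP; split=> //; clearbody y'.
have e00 := congr1 (fun g : GL2 F => g 0 0) e; have e10 := congr1 (fun g : GL2 F => g 1 0) e.
move: {e} e00 e10 => e00 e10; rewrite !GL2_mulE !turnE mul0r addr0 mul1r in e10;
  rewrite !GL2_mulE !turnE mul1r in e00.
have -> : y' 1 0 = (val x - [red x]) * y 1 0.
  rewrite e10 in e00; apply: (addrI ([red x] * y 1 0)); rewrite e00.
  by rewrite mulrBl (to_ringK le) divfK // addrC subrK.
rewrite nabsM e1 mulr1; apply/(resmap_ker red (x - teich red (red x))).
by rewrite rmorphB teichK subrr.
Qed.

(** Multiplying [gam j * y] by [om] moves from [j] to a neighbour: to the parent, or across the base
    edge, if [y] is in [I], and to the child with letter [x] if [y] is in [turn x] times [I]. *)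
Lemma stab_om : stab om.
Proof.
have conj y : I y -> exists2 y', K y' & (y * om = om * y')%g.
  move=> Iy; exists (om_conj y); first by apply/(iwahori_maximal (red := red))/om_conj_I.
  by rewrite /om_conj !mulgA om_central mulgA mulgK.
move=> g [j [y [z [Ky cz ->]]]]; rewrite -[(_ * z * om)%g]mulgA cz mulgA.
apply: stab_central => // {z cz}.
have c1 : central 1%g by move=> h; rewrite mulg1 mul1g.
have [/conj[y' Ky' e]|[x [y0 [/conj[y' Ky' e] ->]]]] := K_turn_I Ky; last first.
  case: j => b s; exists (b, rcons s x), y', 1%g; split=> //.
  by rewrite mulg1 gam_rcons stp_turn !mulgA -[(_ * y0 * om)%g]mulgA e !mulgA.
rewrite -mulgA e mulgA; apply: stabK => //.
case: j => b s; case/lastP: s => [|s x].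
  case: b; rewrite /gam /= mulg1.
    exists (false, [::]), 1%g, (om * om)%g; split; [exact: maximal_1|exact: om_central|].
    by rewrite /gam /= !mul1g.
  exists (true, [::]), 1%g, 1%g; split=> //; first exact: maximal_1.
  by rewrite /gam /= !mulg1 mul1g.
exists (b, s), (turn x), (om * om)%g; split; [exact: K_turn|exact: om_central|].
by rewrite gam_rcons stp_turn !mulgA.
Qed.

Definition swap : GL2 F := gl22 0 1 1 0.
Lemma swap_det : 0 * 0 - 1 * 1 != 0 :> F.
Proof. by rewrite mulr0 mulr1 sub0r oppr_eq0 oner_neq0. Qed.
Lemma swapE : (swap 0 0 = 0) * (swap 0 1 = 1) * (swap 1 0 = 1) * (swap 1 1 = 0).
Proof. exact: gl22E swap_det. Qed.
Lemma K_swap : K swap.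
Proof.
apply: maximal_intro; rewrite ?det2E !swapE ?nabs0 ?nabs1 ?ler01 //.
by rewrite mulr0 mulr1 sub0r nabsN nabs1.
Qed.

(** Since [diag2 w 1 = swap * om], powers of [w] and units give all [x] with [v x <= 1]; conjugation
    by [swap] and the centre give the inverses. *)
Lemma stab_diag (x : F) : x != 0 -> stab (diag2 x 1).
Proof.
have o0 := oner_neq0 F.
have step (y x' : F) : x' != 0 -> y != 0 -> (diag2 (x' * y) 1 = diag2 x' 1 * diag2 y 1)%g.
  move=> h h'; have [e1 e2 e3 e4] := diag2E (diag2 y 1) h o0.
  have E := gl22E (diag2_det h' o0); have E' := gl22E (diag2_det (mulf_neq0 h h') o0).
  by apply: GL2_eq; rewrite ?(e1, e2, e3, e4) !E !E'; ring.
have unit (y : F) : v y = 1 -> stab (diag2 y 1).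
  move=> y1; have y0 := nabs1_neq0 y1; have E := gl22E (diag2_det y0 o0).
  apply: stabK; apply: maximal_intro; rewrite ?det_diag2 // ?mulr1 //
    !E ?nabs0 ?nabs1 ?y1 ?ler01 //.
have sw : stab (diag2 w 1).
  have -> : diag2 w 1 = (swap * om)%g.
    by apply: GL2_eq; rewrite GL2_mulE !swapE !omE (gl22E (diag2_det w0 o0)); ring.
  by apply: stabM; [apply/stabK/K_swap|exact: stab_om].
have small (y : F) : y != 0 -> v y <= 1 -> stab (diag2 y 1).
  move=> y0 le1; have [m hm] := @expr_le_small R (v w) (v y) (introT andP (conj (nabs_ge0 v w)
    w1)) (nabs_gt0 v y0).
  elim: m y y0 le1 hm => [|m IH] y y0 le1 hm.
    by apply: unit; apply/eqP; rewrite eq_le le1 -[X in X <= _](expr0 (v w)).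
  have [lt|ge] := ltP (v y) 1; last by apply: unit; apply/eqP; rewrite eq_le le1.
  have -> : y = y / w * w by rewrite divfK.
  have yw : y / w != 0 by rewrite mulf_neq0 ?invr_eq0.
  rewrite step //; apply: stabM => //; apply: IH => //; rewrite nabsM nabsV.
    by rewrite ler_pdivrMr ?mul1r ?nabs_gt0 //; exact: w_max.
  by rewrite ler_pdivlMr ?nabs_gt0 // -exprSr.
move=> x0; have [le|lt] := leP (v x) 1; first exact: small.
have x0' : x^-1 != 0 by rewrite invr_eq0.
have -> : diag2 x 1 = (diag2 x x * (swap * (diag2 x^-1 1 * swap)))%g.
  have E := gl22E (diag2_det x0 o0); have E' := gl22E (diag2_det x0' o0).
  have E2 := gl22E (diag2_det x0 x0).
  by apply: GL2_eq; rewrite !GL2_mulE !swapE !E' !E2 !E; field.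
apply: stabM; first by apply/stab_central/scalar_central.
apply: stabM; first exact/stabK/K_swap.
apply: stabM; last exact/stabK/K_swap.
by apply: small => //; rewrite nabsV invf_le1 ?ltW // nabs_gt0.
Qed.

Lemma stab_all g : stab g.
Proof.
have [i [n [j [/iwahori1_maximal Ki mn /iwahori_maximal Kj ->]]]] := iwahori_decomposition red g.
apply: stabM; last exact: stabK.
apply: stabM; first exact: stabK.
have diag (a d : F) : a != 0 -> d != 0 -> stab (diag2 a d).
  move=> a0 d0; have ad0 : a / d != 0 by rewrite mulf_neq0 ?invr_eq0.
  have -> : diag2 a d = (diag2 d d * diag2 (a / d) 1)%g.
    have [e1 e2 e3 e4] := diag2E (diag2 (a / d) 1) d0 d0.
    have E := gl22E (diag2_det ad0 (oner_neq0 F)).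
    by apply: GL2_eq; rewrite ?(e1, e2, e3, e4) !E !(gl22E (diag2_det a0 d0)); field.
  by apply: stabM; [apply/stab_central/scalar_central|exact: stab_diag].
have := det2_neq0 n; rewrite det2E; case: mn => -[e1 e2]; rewrite e1 ?e2.
  rewrite mul0r subr0 mulf_eq0 negb_or => /andP[a0 d0].
  have -> : n = diag2 (n 0 0) (n 1 1).
    by apply: GL2_eq; rewrite ?e1 ?e2 (gl22E (diag2_det a0 d0)).
  exact: diag.
rewrite mul0r sub0r oppr_eq0 mulf_eq0 negb_or => /andP[b0 c0].
have -> : n = (diag2 (n 0 1)%R (n 1 0)%R * swap)%g.
  have E := gl22E (diag2_det b0 c0).
  by apply: GL2_eq; rewrite [RHS]GL2_mulE !swapE !E ?e1 ?e2; ring.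
by apply: stabM; [exact: diag|exact/stabK/K_swap].
Qed.

Lemma cov_all g : cov g.
Proof.
rewrite -[g]mul1g; apply: stab_all; exists (false, [::]), 1%g, 1%g; split.
- exact: maximal_1.
- by move=> h; rewrite mulg1 mul1g.
- by rewrite /gam /= !mulg1.
Qed.

End IwahoriTree.

(** * Right invariance under the pro-p Iwahori subgroup *)

Section Far.
Variables (R : realType) (F : fieldType) (v : nonarch_abs R F).
Variables (k : finFieldType) (red : residue_map v k) (E : fieldType).
Implicit Types (g h n y : GL2 F).

Local Notation I := (iwahori red).
Local Notation I1 := (iwahori1 red).
Local Notation K := (maximal v).
Local Notation lv := (iwahori_level red).
Implicit Types f : ind I1 E.

(* The monomial [n] of [lo_type] index the double cosets on which invariance under
   the principal congruence subgroup does not give invariance under [I1]. *)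
Definition far f := forall n i, monomial n -> lo_type red n -> I1 i -> f (n * i)%g = f n.

Lemma far0 : far 0. Proof. by []. Qed.

Lemma farD f f' : far f -> far f' -> far (f + f').
Proof. by move=> hf hf' n i mn tn Ii; congr (_ + _); [exact: hf|exact: hf']. Qed.

Lemma inv_K1_conj f y x : inv_K1 lv f -> K x -> K y -> reduct red y = 1%g ->
  forall g, f (g * y * x)%g = f (g * x)%g.
Proof.
move=> fK Kx Ky ry g; have Kx' := maximal_V Kx.
have -> : (g * y * x = g * x * (x^-1 * y * x))%g by rewrite !mulgA mulgK.
apply: fK; first by apply: maximal_M => //; exact: maximal_M.
rewrite -[lv_red _ _]/(reduct red _) !reductM //; last exact: maximal_M.
rewrite ry mulg1 -reductM // mulVg.
by have := red1 lv.
Qed.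

(** By the Iwahori decomposition, with the torus part absorbed into [n], it suffices to compare
    [n * i] with [n]. If [n] is of [up_type], split [i] into an upper unipotent matrix, which passes
    through [n] to the left, and a factor reducing to 1, which [inv_K1] absorbs. Otherwise the
    hypothesis [far] applies. *)
Lemma far_inv f : inv_K1 lv f -> far f -> inv_J f.
Proof.
move=> fK ff y g Iy; have li := (indP f).1.
have base n i : monomial n -> I1 i -> f (n * i)%g = f n.
  move=> mn Ii; have [tn|tn] := monomial_type red mn; last exact: ff.
  have Ki := iwahori1_maximal Ii; have [hi _] := Ki.
  pose x := i 0 1; have lex : v x <= 1 by exact: hi.
  have Kx := maximal_up red lex.
  have nx : f (n * up_mx x)%g = f n by rewrite -[(n * _)%g](mulgVK n) li //; exact: tn.
  have -> : i = (up_mx x * ((up_mx x)^-1 * i))%g by rewrite mulVKg.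
  rewrite mulgA fK //; first by apply: maximal_M => //; exact: maximal_V.
  have KV := maximal_V Kx.
  rewrite -[lv_red _ _]/(reduct red _) reductM // -[X in (X * _)%g]/(lv_red lv _) redV //.
  have [_ ui] := (iwahori1P red i).1 Ii.
  rewrite (unip2_u ui) -[lv_red _ _]/(reduct red (up_mx x)).
  have -> : reduct red (up_mx x) = unip_u (reduct red i 0 1); last by rewrite mulVg.
  rewrite -[x](to_ringK lex) reduct_up; congr unip_u; apply/esym/(reductE red _ _ _ Ki).
  by rewrite to_ringK // subrr nabs0.
have [i [n [j [Ii mn Ij ->]]]] := iwahori_decomposition red g.
have [j1 [d [Ij1 td ej]]] := iwahori_torus (iwahori_V Ij).
have -> : j = (d^-1 * j1^-1)%g by rewrite -invgM -ej invgK.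
have md : monomial (n * d^-1)%g.
  have [d01 d10 /nabs1_neq0 a0 /nabs1_neq0 b0] := td.
  have e : (n * d^-1 * d)%g = n by exact: mulgVK.
  have ent i0 j0 := congr1 (fun g : GL2 F => g i0 j0) e.
  move: (ent 0 0) (ent 0 1) (ent 1 0) (ent 1 1); move: (n * d^-1)%g => m.
  rewrite !GL2_mulE d01 d10 !mulr0 !addr0 !add0r => e00 e01 e10 e11.
  by case: mn; rewrite -?e00 -?e01 -?e10 -?e11 => -[/eqP h1 /eqP h2]; [left|right]; split;
    apply/eqP; move: h1 h2; rewrite !mulf_eq0 ?(negPf a0) ?(negPf b0) ?orbF.
have Ij1' := iwahori1_V Ij1.
rewrite -!mulgA !(li i) // !mulgA -[in LHS]mulgA.
by rewrite [RHS](base _ _ md) // (base _ _ md) //; exact: iwahori1_M.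
Qed.

(** After a possible column exchange by [s], the upper left entry dominates the top row, and by
    [beyond] strictly dominates the bottom row. Clearing the upper right entry then takes an
    integral factor [x], clearing the lower left one a small [c]. *)
Lemma beyond_decomp h : beyond v h -> exists c (m x : GL2 F),
  [/\ v c < 1, [/\ m 0 1 = 0, m 1 0 = 0 & v (m 1 1) < v (m 0 0)], K x & h = (lo_mx c * m * x)%g].
Proof.
pose s : GL2 F := weyl_u 0; have sE := gl22E (weyl_u_det (0 : F)).
have Ks : K s.
  apply: maximal_intro; rewrite ?det_weyl_u ?sE ?nabsN ?nabs0 ?nabs1 ?ler01 //.
suff main h' : beyond v h' -> v (h' 0 1) <= v (h' 0 0) -> exists c (m x : GL2 F),
    [/\ v c < 1, [/\ m 0 1 = 0, m 1 0 = 0 & v (m 1 1) < v (m 0 0)], K x & h' = (lo_mx c * m * x)%g].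
  move=> bh; have [le|lt] := leP (v (h 0 1)) (v (h 0 0)); first exact: main.
  have e00 : (h * s)%g 0 0 = - h 0 1 by rewrite GL2_mulE !sE; ring.
  have e01 : (h * s)%g 0 1 = h 0 0 by rewrite GL2_mulE !sE; ring.
  have e10 : (h * s)%g 1 0 = - h 1 1 by rewrite GL2_mulE !sE; ring.
  have e11 : (h * s)%g 1 1 = h 1 0 by rewrite GL2_mulE !sE; ring.
  have [||c [m [x [hc hm Kx e]]]] := main (h * s)%g.
  - by move: bh; rewrite /beyond /rn e00 e01 e10 e11 !nabsN ![Num.max _ (v (h _ 0))]maxC.
  - by rewrite e00 e01 nabsN ltW.
  exists c, m, (x * s^-1)%g; split=> //; first by apply: maximal_M => //; exact: maximal_V.
  by rewrite mulgA -e mulgK.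
move=> bh le; have n0 : rn v 0 h' = v (h' 0 0) by rewrite /rn max_l.
rewrite /beyond n0 in bh.
have lt0 : v (h' 1 0) < v (h' 0 0) by exact: le_lt_trans (le_rn v 1 0 h') bh.
have lt1 : v (h' 1 1) < v (h' 0 0) by exact: le_lt_trans (le_rn v 1 1 h') bh.
have a0 := nabs_lt_neq0 lt0; have vb : v (h' 0 1 / h' 0 0) <= 1 by rewrite -nabsN nabs_div_le1.
pose d := h' 1 1 - h' 1 0 * (h' 0 1 / h' 0 0).
have d0 : d != 0.
  apply: contra_neq (det2_neq0 h') => d0; rewrite det2E.
  have -> : h' 0 0 * h' 1 1 - h' 0 1 * h' 1 0 = h' 0 0 * d by rewrite /d; field.
  by rewrite d0 mulr0.
exists (h' 1 0 / h' 0 0), (diag2 (h' 0 0) d), (up_mx (h' 0 1 / h' 0 0)).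
have M := gl22E (diag2_det a0 d0).
split; [by rewrite -nabsN nabs_div_lt1| |exact: (maximal_up red)|].
  split; rewrite ?M //; apply: nabs_addlt; rewrite // nabsN nabsM.
  by apply: le_lt_trans lt0; rewrite ler_piMr ?nabs_ge0.
by apply: GL2_eq; rewrite !GL2_mulE !lo_mxE !up_mxE !M /d; field.
Qed.

(** An element of [I1] between [n] and [m] is [lo_mx c'] times an upper triangular [b]. The first
    factor passes through [n], of [lo_type], to the left. Conjugation by [m] shrinks the upper right
    entry of [b], so that the result reduces to 1 and is absorbed by [inv_K1]. *)
Lemma far_beyond h f : beyond v h -> inv_K1 lv f -> far (rtrans h f).
Proof.
move=> /beyond_decomp[c [m [x [hc [m01 m10 lt] Kx ->]]]] fK n i mn tn Ii.
have li := (indP f).1.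
have val j : I1 j -> f (n * j * m * x)%g = f (n * m * x)%g.
  move=> Ij; have [j0 j1 j2] := (iwahori1_diag red j).1 Ij.
  have [hj j10 j00 j11] := iwahori_elim j0.
  pose c' := j 1 0 / j 0 0.
  have hc' : v c' < 1 by rewrite nabsM nabsV j00 invr1 mulr1.
  pose b := ((lo_mx c')^-1 * j)%g.
  have Ib : I1 b by apply: iwahori1_M => //; apply/iwahori1_V/lo_mx_iwahori1.
  have b10 : b 1 0 = 0.
    have e : (lo_mx c' * b)%g = j by exact: mulVKg.
    clearbody b; have ent i0 := congr1 (fun g : GL2 F => g i0 0) e.
    move: (ent 0) (ent 1); rewrite !GL2_mulE !lo_mxE mul1r mul0r addr0 mul1r => -> e1.
    by apply: (addrI (c' * j 0 0)); rewrite e1 addr0 divfK ?(nabs1_neq0 j00).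
  have -> : j = (lo_mx c' * b)%g by rewrite mulVKg.
  have -> : (n * (lo_mx c' * b) * m * x = (n * lo_mx c' * n^-1) * (n * b * m * x))%g.
    by rewrite !mulgA mulgVK.
  rewrite li; last exact: tn (ltW hc').
  have [ib b1 b2] := (iwahori1_diag red b).1 Ib; have [hb _ b00 b11] := iwahori_elim ib.
  have a0 := nabs_lt_neq0 lt.
  pose y := (m^-1 * b * m)%g; have ey : (m * y = b * m)%g by rewrite /y !mulgA mulgV mul1g.
  have -> : (n * b * m = n * m * y)%g by rewrite -mulgA -ey mulgA.
  have d0 : m 1 1 != 0.
    by have := det2_neq0 m; rewrite det2E m01 mul0r subr0 mulf_eq0 negb_or => /andP[].
  have ent i0 j0 := congr1 (fun g : GL2 F => g i0 j0) ey.
  have [y00 y01 y10 y11] : [/\ y 0 0 = b 0 0, m 0 0 * y 0 1 = b 0 1 * m 1 1, y 1 0 = 0 & y 1 1 =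
    b 1 1].
    clearbody y b; move: (ent 0 0) (ent 0 1) (ent 1 0) (ent 1 1).
    rewrite !GL2_mulE m01 m10 b10 !mul0r !mulr0 !addr0 !add0r => e1 e2 e3 e4; split=> //.
    - by apply: (mulfI a0); rewrite e1 mulrC.
    - by apply: (mulfI d0); rewrite e3 mulr0.
    - by apply: (mulfI d0); rewrite e4 mulrC.
  have vy : v (y 0 1) < 1.
    rewrite -(ltr_pM2l (nabs_gt0 v a0)) -nabsM y01 nabsM mulr1.
    by apply: le_lt_trans lt; rewrite ler_piMl ?nabs_ge0.
  have dety : v (det2 y) = 1 by rewrite det2E y10 mulr0 subr0 y00 y11 nabsM b00 b11 mulr1.
  have Ky : K y.
    by apply: maximal_intro; rewrite ?y00 ?y10 ?y11 ?b00 ?b11 ?nabs0 ?ler01 // ltW.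
  apply: inv_K1_conj => //; apply: GL2_eq; rewrite GL2_1E /=.
  - by apply/(reduct1 red _ _ Ky); rewrite y00.
  - exact/(reduct0 red _ _ Ky).
  - by apply/(reduct0 red _ _ Ky); rewrite y10 nabs0.
  - by apply/(reduct1 red _ _ Ky); rewrite y11.
have Ic := lo_mx_iwahori1 red hc.
rewrite /= !mulgA val // -[(n * i * lo_mx c)%g]mulgA val //; exact: iwahori1_M.
Qed.

Lemma central_rtrans c : central c -> exists h : hecke I1 E, forall f, rtrans c f = h f.
Proof.
move=> cc; have nJ y : I1 (c * y * c^-1)%g <-> I1 y by rewrite cc mulgK.
by exists (ltrans E nJ) => f; apply: ind_inj => x /=; rewrite cc.
Qed.

End Far.

(** * Dual bases for the p-adic modules *)

Section IwahoriBasis.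
Variables (R : realType) (F : fieldType) (v : nonarch_abs R F).
Variables (k : finFieldType) (red : residue_map v k).
Variables (E : fieldType) (iota : {rmorphism k -> E}).
Local Notation n := (#|k|.-1).
Local Notation block := ('I_n * 'I_n)%type.
Local Notation I := (iwahori red).
Local Notation I1 := (iwahori1 red).
Local Notation K := (maximal v).
Local Notation lv := (iwahori_level red).
Local Notation HJ := (hecke I1 E).

Section Uniformizer.
Variable w : F.
Hypothesis w0 : w != 0.
Hypothesis w1 : v w < 1.
Hypothesis w_max : forall x, v x < 1 -> v x <= v w.

Section Blocks.
Variable B : pred block.
Hypothesis bin_neq0 : forall b o, B b -> (0 < b.1)%N -> (b.1 < o <= n)%N ->
  'C(o, b.1)%:R != 0 :> E.
Hypothesis B_par : forall b, B b -> B (par b).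
Local Notation u0 := (ext lv (gen_C iota B)).

Variable X : set (GL2 F).
Hypothesis om_norm : forall y, X (om_conj w y) <-> X y.
Hypothesis u0E : forall g, u0 g = `[< X g >]%:R.

(** [om] normalises [X], so on its characteristic function [u0] right translation by [om] agrees
    with left translation, which is a Hecke operator because [om] normalises [I1]. *)
Lemma iwahori_om_gen : exists h : HJ, rtrans (om w) u0 = h u0.
Proof.
exists (ltrans E (om_norm_I1 red w0 w1 w_max)); apply: ind_inj => g.
rewrite -[LHS]/(u0 (g * om w)%g) -[RHS]/(u0 (om w * g)%g) !u0E.
have -> : (om w * g = om_conj w (g * om w))%g by rewrite /om_conj !mulgA mulgK.
by congr (_%:R); congr nat_of_bool; apply: asbool_equiv_eq; split=> /om_norm.
Qed.

Lemma iwahori_gam_cover g : exists j y c,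
  [/\ lv_grp lv y, g = (gam red w j * y * c)%g & exists h : HJ, rtrans c u0 = h u0].
Proof.
have [j [y [c [Ky cc e]]]] := cov_all red w0 w1 w_max g; exists j, y, c; split=> //.
by have [h hc] := central_rtrans red E cc; exists h.
Qed.

Lemma iwahori_in_tree g : in_tree iota lv B (gam red w) (rtrans g u0).
Proof.
apply: (in_tree_all bin_neq0 B_par (dep := @dep k) iwahori_om_gen) => [j|].
  exact: gam_rec.
exact: iwahori_gam_cover.
Qed.

Lemma iwahori_tree_basis (M : lmodType HJ) (inc : M -> ind I1 E) :
    injective inc -> {morph inc : m m' / m + m'} ->
    (forall h m, inc (h *: m) = (h : HJ) (inc m)) ->
    (forall m, in_tree iota lv B (gam red w) (inc m)) ->
    (forall x, exists m, inc m = tree_vec iota lv B (gam red w) x) ->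
  dual_basis M.
Proof.
move=> inj add scal gen vec.
apply: (tree_dual_basis bin_neq0 (lv := lv) (gam := gam red w) (dep := @dep k)
  (beyond := beyond v) (far := @far _ _ _ _ red E) _ _ _ _ _ _ inj add scal gen vec).
- exact: far0.
- exact: farD.
- exact: far_beyond.
- exact: far_inv.
- exact: beyond_gam.
- exact: beyond_root.
Qed.

End Blocks.

Lemma iwahori1_basis :
    (forall r o, (0 < r)%N -> (r < o <= n)%N -> 'C(o, r)%:R != 0 :> E) ->
  dual_basis (ind_hecke I1 E).
Proof.
move=> bin.
have binB (b : block) o : predT b -> (0 < b.1)%N -> (b.1 < o <= n)%N ->
  'C(o, b.1)%:R != 0 :> E by move=> _; exact: bin.
have par_ok (b : block) : predT b -> predT (par b) by [].
have u0E : ext lv (gen_C iota predT) = ind1 E lv by rewrite gen_C_full ext_ind1.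
apply: (@iwahori_tree_basis predT binB (ind_hecke I1 E : lmodType HJ) (fun f => f)) => //.
- apply: (ind_gen (lv := lv)) => [|c f f' hf hf'|x]; first exact: in_tree0.
    by apply: in_treeD => //; exact: in_treeZ.
  rewrite -u0E; apply: (iwahori_in_tree binB par_ok (X := I1)); first exact: om_norm_I1.
  by move=> g; rewrite u0E ind1E.
- by move=> x; exists (tree_vec iota lv predT (gam red w) x).
Qed.

(* The functions in [iwahori_ind] only involve the trivial character of the torus, for
   which no binomial coefficient has to be inverted. *)
Definition trivial_block (b : block) := (b.1 == 0 :> nat) && (b.2 == 0 :> nat).

Lemma gen_C_trivial g : gen_C iota trivial_block g = (g 1 0 == 0)%:R.
Proof.
have n0 := n_gt0 k.
rewrite /gen_C (big_pred1 (Ordinal n0, Ordinal n0)) => [|[[b1 h1] [b2 h2]]]; last first.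
  by rewrite /trivial_block /= xpair_eqE -!val_eqE.
by rewrite xi_val /= !expr0 mulr1; case: ifP.
Qed.

Lemma ext_trivial g : ext lv (gen_C iota trivial_block) g = `[< I g >]%:R.
Proof.
have [Kg|nK] := pselect (K g); last first.
  rewrite ext_nK // (_ : `[< I g >] = false) //; apply/asboolP => Ig; apply: nK.
  exact: iwahori_maximal Ig.
rewrite ext_K // gen_C_trivial; congr (_%:R); congr nat_of_bool.
apply/eqP/asboolP => [h|/iwahoriP[_ h]]; last by apply/(reduct0 red).
by apply/iwahoriP; split=> //; apply/(reduct0 red _ _ Kg).
Qed.

(** For [r = l = 0] the functions depend only on the point of the projective line given by the
    bottom row. This places the vectors of the tree in [iwahori_ind]. *)
Lemma bas_borel i (t g : GL2 k) : borel2 t ->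
  bas iota trivial_block i (t * g)%g = bas iota trivial_block i g.
Proof.
move=> t10; have [_ t11] := borel2_diag t10.
rewrite /bas /= /blk_val /bP /ba /valid.
have [/andP[/eqP -> /eqP ->]|nB] := boolP (trivial_block i.1); last first.
  by rewrite !horner0 !mulr0 !if_same !mulr0.
rewrite !expr0 !mul1r !GL2_mulE t10 !mul0r !add0r mulf_eq0 (negPf t11) /=.
by rewrite -mulf_div divff // mul1r.
Qed.

Lemma ext_borel (c : ind (@unip2 k) E) : (forall t g, borel2 t -> c (t * g)%g = c g) ->
  left_inv I (ext lv c).
Proof.
move=> cB t x It; have Kt := iwahori_maximal It.
have [Kx|nK] := pselect (K x); last first.
  rewrite !ext_nK // => Ktx; apply: nK.
  by rewrite -(mulKg t x); apply: maximal_M => //; exact: maximal_V.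
rewrite !ext_K //; last exact: maximal_M.
rewrite -[lv_red lv]/(reduct red) reductM // cB // /borel2 /=.
by apply/(reduct0 red _ _ Kt); have [_ h] := (iwahoriP red t).1 It.
Qed.

Lemma iwahori_basis : dual_basis (iwahori_ind red E).
Proof.
have binB (b : block) o : trivial_block b -> (0 < b.1)%N -> (b.1 < o <= n)%N ->
  'C(o, b.1)%:R != 0 :> E by move=> /andP[/eqP ->].
have par_ok (b : block) : trivial_block b -> trivial_block (par b).
  by move=> /andP[h1 /eqP h2]; rewrite /trivial_block par1 h1 /= h2 (eqP h1) mod0n.
pose inc (f : iwahori_ind red E) : ind I1 E := ind_incl (iwahori_pair red) f.
apply: (@iwahori_tree_basis trivial_block binB (iwahori_ind red E : lmodType HJ) inc).
- exact: ind_incl_inj.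
- exact: ind_inclD.
- exact: ind_sub_scaleE.
- apply: (ind_char_gen (hp := iwahori_pair red)
    (P := fun f => in_tree iota lv trivial_block (gam red w) (inc f))) => [|c f f' hf hf'|x].
  + have -> : inc 0 = 0 by exact: ind_inj.
    exact: in_tree0.
  + have -> : inc (c *: f + f') = c *: inc f + inc f' by exact: ind_inj.
    by apply: in_treeD => //; exact: in_treeZ.
  have -> : inc (rtrans x (ind_char (iwahori_pair red) E 1%g)) =
      rtrans x (ext lv (gen_C iota trivial_block)).
    apply: ind_inj => g; rewrite -[RHS]/(ext lv _ (g * x)%g) ext_trivial.
    exact: (ind_char1E (iwahori_pair red) E (g * x)%g).
  apply: (iwahori_in_tree binB par_ok (X := I)); first exact: om_norm_I.
  exact: ext_trivial.
move=> x; suff : left_inv I (tree_vec iota lv trivial_block (gam red w) x).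
  by move=> /(ind_inclP (iwahori_pair red))[f ->]; exists f.
have hb i : left_inv I (ext lv (bas iota trivial_block i)).
  by apply: ext_borel => t g; exact: bas_borel.
rewrite /tree_vec; case: x => -[j|] i /=; case: ifP => _ //.
by move=> t y It; rewrite /= -mulgA; exact: hb.
Qed.

End Uniformizer.

End IwahoriBasis.

(** * Binomial coefficients modulo p and conclusion *)

Lemma prime_fact_coprime p o : prime p -> (o < p)%N -> ~~ (p %| o`!)%N.
Proof.
move=> pr; elim: o => [|o IH] lt; first by rewrite dvdn1 neq_ltn prime_gt1 ?orbT.
by rewrite factS Euclid_dvdM // negb_or IH ?(ltnW lt) // andbT gtnNdvd.
Qed.

(** ['C(o, r)] divides the factorial of [o], which is prime to [p] for [o < p]. *)
Lemma bin_char_neq0 (E : fieldType) p r o : p \in [pchar E] -> (r <= o)%N -> (o < p)%N ->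
  'C(o, r)%:R != 0 :> E.
Proof.
move=> cp ro op; rewrite -(dvdn_pcharf cp).
have pr := pcharf_prime cp; apply: contra (prime_fact_coprime pr op) => d.
by rewrite -(bin_fact ro) dvdn_mulr.
Qed.

Lemma dual_basis_projective (A : pzRingType) (M : lmodType A) :
  dual_basis M -> projective A M.
Proof. by case=> X [x [lam lamP]]; exact: dual_projective lamP. Qed.

Theorem proposition6p9
    (R : realType) (F : fieldType) (v : nonarch_abs R F)
    (F_locally_compact : locally_compact [set: nabs_space v])
    (k : finFieldType) (red : residue_map v k)
    (p q : nat) (k_char : p \in [pchar k]) (k_card : #|k| = q)
    (Fpbar : closedFieldType) (iota : {rmorphism k -> Fpbar})
    (Fpbar_algebraic : forall x : Fpbar, algebraicOver iota x) :
  ((flat (hecke (iwahori1 red) Fpbar) (ind_hecke (iwahori1 red) Fpbar)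
      <-> flat (hecke (@unip2 k) Fpbar) (ind_hecke (@unip2 k) Fpbar))
   /\ (flat (hecke (@unip2 k) Fpbar) (ind_hecke (@unip2 k) Fpbar) <-> q = p)
   /\ (q = p ->
        projective (hecke (iwahori1 red) Fpbar) (ind_hecke (iwahori1 red) Fpbar)
        /\ projective (hecke (@unip2 k) Fpbar) (ind_hecke (@unip2 k) Fpbar)))
  /\ projective (hecke (iwahori1 red) Fpbar) (iwahori_ind red Fpbar).
Proof.
have [w [w0 w1 w_max]] := uniformizer F_locally_compact.
have bin : q = p -> forall r o, (0 < r)%N -> (r < o <= #|k|.-1)%N ->
    'C(o, r)%:R != 0 :> Fpbar.
  move=> qp r o _ /andP[ro on]; apply: (@bin_char_neq0 _ p); last 2 first.
  - exact: ltnW.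
  - by rewrite -qp -k_card (card_k k) ltnS.
  by rewrite (fmorph_pchar iota).
have basis1 qp := iwahori1_basis red iota w0 w1 w_max (bin qp).
have basis qp := fin_dual_basis iota (bin qp).
have flat1 : flat (hecke (iwahori1 red) Fpbar) (ind_hecke (iwahori1 red) Fpbar) -> q = p.
  by move=> h; rewrite -k_card; exact: (flat_card iota (iwahori_level red) k_char).
have flat0 : flat (hecke (@unip2 k) Fpbar) (ind_hecke (@unip2 k) Fpbar) -> q = p.
  by move=> h; rewrite -k_card; exact: (flat_card iota (fin_level k) k_char).
split; last exact/dual_basis_projective/(iwahori_basis red iota w0 w1 w_max).
split.
  by split=> [/flat1|/flat0] qp; [exact: dual_flat (basis qp)|exact: dual_flat (basis1 qp)].
split; first by split=> [|qp]; [exact: flat0|exact: dual_flat (basis qp)].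
by move=> qp; split; apply: dual_basis_projective; [exact: basis1|exact: basis].
Qed.
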